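(* Let $\mathcal A$ be a bridge-addable class of graphs with a growth constant, and let $\rho=\rho_{\mathcal A}$. Let $\mathcal C$ be a non-empty class of connected graphs such that every $H\in\mathcal C$ is bridge-deletable in $\mathcal A$, weakly attachable to $\mathcal A$, and weakly detachable from $\mathcal A$. Let $C(x)=\sum_{n\ge1}|\mathcal C_n|x^n/n!$. Then $0<C(\rho)\le\tfrac12$, and for $R_n\in_u\mathcal A$, $\operatorname{Frag}(R_n,\mathcal C)$ converges in total variation to $\mathrm{BP}(\mathcal C,\rho)$ as $n\to\infty$.
   Context: A class of graphs is a set of graphs closed under isomorphism; $\mathcal A_n$ is the set of graphs in $\mathcal A$ on vertex set $[n]$; $\rho_{\mathcal A}=\big(\limsup_n(|\mathcal A_n|/n!)^{1/n}\big)^{-1}$; $\mathcal A$ has a growth constant if $(|\mathcal A_n|/n!)^{1/n}\to\gamma\in(0,\infty)$, in which case $\rho_{\mathcal A}=1/\gamma$. $R_n\in_u\mathcal A$ means $R_n$ is uniform on $\mathcal A_n$. $\mathcal A$ is bridge-addable if for every $G\in\mathcal A$ and vertices $u,v$ in distinct components of $G$, $G+uv\in\mathcal A$. A connected graph $H$ is bridge-deletable in $\mathcal A$ if for each $G\in\mathcal A$ with a bridge $e$ such that at least one of the two new components of $G-e$ is isomorphic to $H$, $G-e\in\mathcal A$. Pendant appearances, weak attachability and weak detachability: for $H$ with root $r$ (forming $H^{\bullet}$), $G$ has a pendant appearance of $H^{\bullet}$ on a $v(H)$-set $W$ if exactly one edge $wx$ joins $W$ to $V(G)\setminus W$ ($w\in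 W$) and some isomorphism $\phi:H\to G[W]$ has $\phi(r)=w$. Attaching a pendant copy of $H^{\bullet}$ means adding a disjoint copy of $H$ and an edge from its root to a vertex of $G$; detaching means deleting the vertex set of a pendant appearance. $H$ is weakly attachable to (resp. weakly detachable from) $\mathcal A$ if for every choice of root there exist $\delta>0$ and a set $\mathcal B$ of graphs with $\rho_{\mathcal B}=\rho_{\mathcal A}$ such that for all large $n$ and all $G\in\mathcal A_n$, every graph formed from $G$ by simultaneously attaching (resp. detaching) at most $\delta n$ pendant copies of $H^{\bullet}$ is in $\mathcal B$. The fragment $\operatorname{Frag}(G)$ is the unlabelled graph obtained from $G$ by deleting a largest component (ties broken in some way); $\operatorname{Frag}(G,\mathcal C)$ is the unlabelled graph formed by the components of $\operatorname{Frag}(G)$ that lie in $\mathcal C$. Boltzmann Poisson random graph: let $\mathcal F$ be the class of graphs all of whose components are in $\mathcal C$, $\widetilde{\mathcal F}$ the set of unlabelled graphs in $\mathcal F$ including the empty graph, $\mu(G)=\rho^{v(G)}/\operatorname{aut}G$ (with $\mu(\emptyset)=1$); if $C(\rho)<\infty$, $\mathrm{BP}(\mathcal C,\rho)$ is the random element $R$ of $\widetilde{\mathcal F}$ with $\mathbb P(R=G)=e^{-C(\rho)}\mu(G)$. Random elements $X_n$ of a countable set converge in total variation to $Y$ if $\sup_A|\mathbb P(X_n\in A)-\mathbb P(Y\in A)|\to0$. *)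

(* Defs.v *)
From HB Require Import structures.
From mathcomp Require Import all_boot all_order all_algebra all_fingroup.
From mathcomp Require Import all_classical all_reals all_analysis.
Set Implicit Arguments. Unset Strict Implicit. Unset Printing Implicit Defensive.
Import Order.TTheory GRing.Theory Num.Theory numFieldNormedType.Exports.

Definition wfg (V : finType) (E : {set V * V}) : bool :=
  [forall x : V, forall y : V, ((x, y) \in E) == ((y, x) \in E)] &&
  [forall x : V, (x, x) \notin E].

Definition graph (V : finType) := {E : {set V * V} | wfg E}.

Definition edge (V : finType) (G : graph V) : rel V := fun x y => (x, y) \in val G.

Definition symcl (V : finType) (r : rel V) : {set V * V} :=
  [set p : V * V | (r p.1 p.2 || r p.2 p.1) && (p.1 != p.2)].

Lemma wfg_symcl (V : finType) (r : rel V) : wfg (symcl r).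
Proof.
apply/andP; split.
- apply/forallP => x; apply/forallP => y; rewrite !inE /=.
  by rewrite [r y x || _]orbC [y == x]eq_sym.
- by apply/forallP => x; rewrite !inE /= eqxx andbF.
Qed.

Definition mkgraph (V : finType) (r : rel V) : graph V := exist _ (symcl r) (wfg_symcl r).

Definition iso (V W : finType) (G : graph V) (H : graph W) : Prop :=
  exists f : V -> W, bijective f /\ forall x y, edge H (f x) (f y) = edge G x y.

(* a (possibly non iso-closed) collection of graphs; a class is an iso-closed one *)
Definition gclass := forall V : finType, graph V -> Prop.
Definition iso_closed (A : gclass) : Prop :=
  forall (V W : finType) (G : graph V) (H : graph W), iso G H -> A V G -> A W H.

Definition conn (V : finType) (G : graph V) : rel V := connect (edge G).
Definition comp (V : finType) (G : graph V) (x : V) : {set V} := [set y | conn G x y].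
Definition gconnected (V : finType) (G : graph V) : Prop :=
  0 < #|V| /\ forall x y : V, conn G x y.

Definition addE (V : finType) (G : graph V) (u v : V) : graph V :=
  mkgraph (fun x y => edge G x y || ((x == u) && (y == v))).
Definition delE (V : finType) (G : graph V) (u v : V) : graph V :=
  mkgraph (fun x y => edge G x y && ~~ (((x == u) && (y == v)) || ((x == v) && (y == u)))).
Definition induced (V : finType) (G : graph V) (S : {set V}) : graph {x : V | x \in S} :=
  mkgraph (fun x y : {x : V | x \in S} => edge G (val x) (val y)).

Definition cnt (A : gclass) (n : nat) : nat :=
  #|[pred G : graph 'I_n | `[< A _ G >] ]|.

Section Reals.
Variable R : realType.
Local Open Scope ring_scope.

Definition growth_seq (A : gclass) (n : nat) : R :=
  ((cnt A n)%:R / (n`!)%:R) `^ (n%:R^-1).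

Definition rho_cls (A : gclass) : \bar R :=
  let L := limn_esup (fun n => (growth_seq A n)%:E) in
  if L == 0%E then +oo%E else if L == +oo%E then 0%E else ((fine L)^-1)%:E.

Definition has_growth_constant (A : gclass) (gamma : R) : Prop :=
  0 < gamma /\ (growth_seq A n @[n --> \oo] --> gamma)%classic.
End Reals.

Definition bridge_addable (A : gclass) : Prop :=
  forall (V : finType) (G : graph V) (u v : V),
    A V G -> ~~ conn G u v -> A V (addE G u v).

(* H connected; H is bridge-deletable in A: whenever G in A has a bridge uv
   and (one of) the new component(s) of G - uv is isomorphic to H, G - uv in A.
   (By symmetry in u, v, "the component of u" covers both components.) *)
Definition bridge_deletable (W : finType) (H : graph W) (A : gclass) : Prop :=
  forall (V : finType) (G : graph V) (u v : V),
    A V G -> edge G u v -> ~~ conn (delE G u v) u v ->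
    iso (induced (delE G u v) (comp (delE G u v) u)) H ->
    A V (delE G u v).

Definition pendant_app (W : finType) (H : graph W) (r : W)
    (V : finType) (G : graph V) (S : {set V}) : Prop :=
  #|[set p : V * V | [&& p.1 \in S, p.2 \notin S & edge G p.1 p.2]]| = 1%N /\
  exists phi : W -> V,
    [/\ injective phi, [set phi a | a : W] = S,
        forall a b, edge G (phi a) (phi b) = edge H a b &
        forall x y, x \in S -> y \notin S -> edge G x y -> x = phi r].

Definition attach (V W : finType) (G : graph V) (H : graph W) (r : W)
    (k : nat) (w : 'I_k -> V) : graph (V + ('I_k * W))%type :=
  mkgraph (fun x y : (V + ('I_k * W))%type =>
    match x, y with
    | inl a, inl b => edge G a b
    | inr (i, a), inr (j, b) => (i == j) && edge H a b
    | inl a, inr (i, b) => (b == r) && (w i == a)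
    | inr _, inl _ => false
    end).

Section Weak.
Variable R : realType.
Local Open Scope ring_scope.

Definition weakly_attachable (W : finType) (H : graph W) (A : gclass) : Prop :=
  forall r : W, exists (delta : R) (B : gclass),
    [/\ 0 < delta, iso_closed B, rho_cls R B = rho_cls R A &
    exists N : nat, forall n : nat, (N <= n)%N ->
      forall G : graph 'I_n, A _ G ->
      forall (k : nat) (w : 'I_k -> 'I_n), k%:R <= delta * n%:R ->
        B _ (attach G H r w)].

Definition weakly_detachable (W : finType) (H : graph W) (A : gclass) : Prop :=
  forall r : W, exists (delta : R) (B : gclass),
    [/\ 0 < delta, iso_closed B, rho_cls R B = rho_cls R A &
    exists N : nat, forall n : nat, (N <= n)%N ->
      forall G : graph 'I_n, A _ G ->
      forall (k : nat) (S : 'I_k -> {set 'I_n}), k%:R <= delta * n%:R ->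
        (forall i, pendant_app H r G (S i)) ->
        (forall i j, i != j -> [disjoint S i & S j]) ->
        B _ (induced G (~: \bigcup_(i < k) S i))].
End Weak.

Definition largest_choice (L : forall n, graph 'I_n -> {set 'I_n}) : Prop :=
  forall (n : nat) (G : graph 'I_n), (0 < n)%N ->
    exists x, L n G = comp G x /\ forall y, #|comp G y| <= #|comp G x|.

Definition FragC (L : forall n, graph 'I_n -> {set 'I_n}) (C : gclass)
    (n : nat) (G : graph 'I_n) :=
  induced G [set x | (x \notin L n G) && `[< C _ (induced G (comp G x)) >] ].

(* unlabelled graphs on n vertices are represented by the canonical element
   (least in enum order) of their isomorphism class among graphs on 'I_n *)
Definition canonical (n : nat) (G : graph 'I_n) : Prop :=
  forall G' : graph 'I_n, iso G G' -> (enum_rank G <= enum_rank G')%N.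

Definition aut (n : nat) (G : graph 'I_n) : nat :=
  #|[set s : {perm 'I_n} | [forall x, forall y, edge G (s x) (s y) == edge G x y]]|.

(* F: graphs all of whose components are in C (includes the empty graph) *)
Definition inF (C : gclass) (V : finType) (G : graph V) : Prop :=
  forall x : V, C _ (induced G (comp G x)).

Section BP.
Variable R : realType.
Local Open Scope ring_scope.

Definition egf (C : gclass) (x : R) : \bar R :=
  (\sum_(1 <= n <oo) ((cnt C n)%:R / (n`!)%:R * x ^+ n)%:E)%E.

Definition BP_mass (C : gclass) (rho : R) (A' : gclass) : \bar R :=
  (\sum_(0 <= n <oo)
     (\sum_(G : graph 'I_n | `[< canonical G /\ inF C G /\ A' _ G >])
         rho ^+ n / (aut G)%:R)%:E)%E.

Definition BP_prob (C : gclass) (rho : R) (A' : gclass) : R :=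
  expR (- fine (egf C rho)) * fine (BP_mass C rho A').

Definition frag_prob (A C : gclass) (L : forall n, graph 'I_n -> {set 'I_n})
    (n : nat) (A' : gclass) : R :=
  (#|[pred G : graph 'I_n | `[< A _ G /\ A' _ (FragC L C G) >] ]|)%:R / (cnt A n)%:R.
End BP.

(* Main.v *)
Require Import Defs.
From HB Require Import structures.
From mathcomp Require Import all_boot all_order all_algebra all_fingroup.
From mathcomp Require Import all_classical all_reals all_analysis.
Import Order.TTheory GRing.Theory Num.Theory numFieldNormedType.Exports.
(* the second import makes [induced] denote induced subgraphs again: the name is
   shadowed by MathComp-Analysis *)
Require Import Defs.
From mathcomp Require Import zify ring lra.
Set Implicit Arguments. Unset Strict Implicit. Unset Printing Implicit Defensive.

(** A component isomorphic to [H] in [C] can be joined to the rest by a bridge from a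
fixed root, and a pendant copy of [H] can be cut off, both without leaving [A].
Weak attachability and detachability together with the growth constant force the
number of pendant embeddings of [H] in a random graph of [A] on [n] vertices to be
[rho^|H| n + o(n)] outside an exponentially small set.  Hence, uniformly, the expected
number of embeddings of a fixed graph [F] with components in [C] as the union of all
small [C]-components is [rho^|F|] times the probability that there are none, up to
[o(1)].  Bridge-addability bounds the expected number of vertices outside the largest
component by 4, since a graph has few bridges; this tightness normalises the limit law.

The normalising constant is [exp C(rho)] by the exponential formula.  For
[C(rho) <= 1/2], let [C*] be the connected graphs that arise from graphs with all
components in [C] by adding bridges.  The expectations above give
[P <= 4] for the sum [P] of [|H| rho^|H| / aut H] over [C*], and marking a bridge of a graph of [C*] whose
two sides lie in [C*], of which there are at most [|H| - 1], gives
[P^2 / 2 <= P - C*(rho)], so [C(rho) <= C*(rho) <= P - P^2 / 2 <= 1/2]. *)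

(** * Graphs, closed sets and components *)

Section GraphBasics.
Implicit Types (V W U : finType).

(** All double counts use labelled embeddings, injections [f] with [pull f G = F] and closed image,
    so automorphisms appear only when labelled masses are turned into the unlabelled Boltzmann
    weights. The number of embeddings of [F] in a graph on n vertices is bounded only by n^|F|, so
    concentration in probability alone would not control expectations; the tails are shown to beat
    every fixed power of n. They do because a linear number k of copies is attached or detached:
    each copy contributes a constant factor below 1, whereas the subexponential uncertainty in the
    sizes of [A] and [B] costs only L^O(n) with L as near to 1 as desired. A cut-off m on component
    sizes makes the bridging move safe: joined to a component of more than m vertices, a copy
    creates no new small component, and the excluded choices are rare since small components cover
    few vertices. Fragments of at most m vertices come from finitely many graphs, whence the
    uniformity in the event [A']. The probability that no small component of [C] is present is never
    computed: the event that always holds determines it. *)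

Lemma edge_sym V (G : graph V) x y : edge G x y = edge G y x.
Proof.
have /andP[/forallP H _] := valP G.
by move/forallP/(_ y)/eqP: (H x).
Qed.

Lemma edge_irr V (G : graph V) x : edge G x x = false.
Proof. by have /andP[_ /forallP /(_ x) /negbTE] := valP G. Qed.

Lemma edge_neq V (G : graph V) x y : edge G x y -> x != y.
Proof. by apply: contraTneq => ->; rewrite edge_irr. Qed.

Lemma graph_ext V (G G' : graph V) : edge G =2 edge G' -> G = G'.
Proof. by move=> e; apply/val_inj/setP => -[x y]; exact: e. Qed.

Lemma edge_mkgraph V (r : rel V) x y :
  edge (mkgraph r) x y = (r x y || r y x) && (x != y).
Proof. by rewrite /edge inE. Qed.

(** Preimage of a graph along an arbitrary map. Induced subgraphs are by conversion the case of an
    inclusion, so relabelling and restriction share one calculus. *)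
Definition pull W V (f : W -> V) (G : graph V) : graph W :=
  mkgraph (fun a b => edge G (f a) (f b)).

Lemma edge_pull W V (f : W -> V) (G : graph V) a b :
  edge (pull f G) a b = edge G (f a) (f b).
Proof.
rewrite edge_mkgraph [edge G (f b) _]edge_sym orbb.
by case: eqVneq => [->|]; rewrite ?edge_irr ?andbT.
Qed.

Lemma pull_comp U W V (g : U -> W) (f : W -> V) (G : graph V) :
  pull g (pull f G) = pull (f \o g) G.
Proof. by apply: graph_ext => a b; rewrite !edge_pull. Qed.

Lemma eq_pull W V (f f' : W -> V) (G : graph V) : f =1 f' -> pull f G = pull f' G.
Proof. by move=> e; apply: graph_ext => a b; rewrite !edge_pull !e. Qed.

Lemma inducedE V (G : graph V) (S : {set V}) :
  induced G S = pull (fun x : {x : V | x \in S} => val x) G.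
Proof. by []. Qed.

Lemma edge_addE V (G : graph V) u v x y : u != v ->
  edge (addE G u v) x y =
  edge G x y || ((x == u) && (y == v)) || ((x == v) && (y == u)).
Proof.
move=> uv; rewrite edge_mkgraph [edge G y x]edge_sym.
case: (eqVneq x y) => [->|xy]; rewrite ?edge_irr ?andbT /=.
  rewrite andbF; case: (eqVneq y u) => [->|_] /=; last by rewrite andbF.
  by rewrite (negbTE uv).
rewrite [(y == u) && _]andbC.
by case: (edge G x y); case: (_ && _); case: (_ && _).
Qed.

Lemma edge_delE V (G : graph V) u v x y :
  edge (delE G u v) x y =
  edge G x y && ~~ (((x == u) && (y == v)) || ((x == v) && (y == u))).
Proof.
rewrite edge_mkgraph [edge G y x]edge_sym.
rewrite [(y == u) && _]andbC [(y == v) && _]andbC [X in _ && ~~ X || _]orbC orbb.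
rewrite [X in ~~ X]orbC.
by case: (eqVneq x y) => [->|xy]; rewrite ?edge_irr ?andbT.
Qed.

Lemma addEK V (G : graph V) u v : u != v -> ~~ edge G u v ->
  delE (addE G u v) u v = G.
Proof.
move=> uv e; apply: graph_ext => x y; rewrite edge_delE edge_addE //.
case: (boolP ((x == u) && (y == v))) => [/andP[/eqP -> /eqP ->]|_] /=.
  by rewrite (negbTE e) !andbF.
case: (boolP ((x == v) && (y == u))) => [/andP[/eqP -> /eqP ->]|_] /=.
  by rewrite edge_sym (negbTE e) !andbF.
by rewrite !orbF andbT.
Qed.

Lemma delEK V (G : graph V) u v : edge G u v -> addE (delE G u v) u v = G.
Proof.
move=> e; have uv := edge_neq e.
apply: graph_ext => x y; rewrite edge_addE // edge_delE.
case: (boolP ((x == u) && (y == v))) => [/andP[/eqP -> /eqP ->]|_] /=.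
  by rewrite e orbT.
case: (boolP ((x == v) && (y == u))) => [/andP[/eqP -> /eqP ->]|_] /=.
  by rewrite edge_sym e orbT.
by rewrite !orbF andbT.
Qed.

(** These sets are the unions of connected components; most connectivity arguments below exhibit
    such a set instead of handling paths. *)
Definition clo V (G : graph V) (S : {set V}) :=
  [forall x, forall y, (x \in S) && edge G x y ==> (y \in S)].

Lemma cloP V (G : graph V) (S : {set V}) :
  reflect (forall x y, x \in S -> edge G x y -> y \in S) (clo G S).
Proof.
apply: (iffP forallP) => [H x y xS e|H x].
  by move/forallP/(_ y)/implyP: (H x); apply; rewrite xS.
by apply/forallP => y; apply/implyP => /andP[]; exact: H.
Qed.

Lemma clo_edge V (G : graph V) (S : {set V}) x y :
  clo G S -> x \in S -> edge G x y -> y \in S.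
Proof. by move=> /cloP; apply. Qed.

Lemma cloE V (G : graph V) (S : {set V}) x y :
  clo G S -> edge G x y -> (x \in S) = (y \in S).
Proof.
move=> /cloP c e; apply/idP/idP => [/c|/c]; first exact.
by apply; rewrite edge_sym.
Qed.

Lemma conn_sym V (G : graph V) x y : conn G x y = conn G y x.
Proof. exact/sym_connect_sym/edge_sym. Qed.

Lemma conn_trans V (G : graph V) y x z : conn G x y -> conn G y z -> conn G x z.
Proof. exact: connect_trans. Qed.

Lemma connxx V (G : graph V) x : conn G x x.
Proof. exact: connect0. Qed.

Lemma edge_conn V (G : graph V) x y : edge G x y -> conn G x y.
Proof. exact: connect1. Qed.

Lemma clo_conn V (G : graph V) (S : {set V}) x y :
  clo G S -> x \in S -> conn G x y -> y \in S.
Proof.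
move=> /cloP c xS /connectP[p]; elim: p x xS => [|z p IH] x xS /= => [_ ->//|].
by case/andP => e P l; apply: (IH z) => //; apply: c e.
Qed.

Lemma clo_comp V (G : graph V) x : clo G (comp G x).
Proof.
apply/cloP => y z; rewrite !inE => c e; apply: conn_trans c _; exact: edge_conn.
Qed.

Lemma in_comp V (G : graph V) x y : (y \in comp G x) = conn G x y.
Proof. by rewrite inE. Qed.

Lemma comp_id V (G : graph V) x : x \in comp G x.
Proof. by rewrite inE connxx. Qed.

Lemma comp_eq V (G : graph V) x y : conn G x y -> comp G x = comp G y.
Proof.
move=> c; apply/setP => z; rewrite !inE; apply/idP/idP => d.
  by apply: conn_trans d; rewrite conn_sym.
exact: conn_trans d.
Qed.

Lemma comp_sub V (G : graph V) (S : {set V}) x :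
  clo G S -> x \in S -> comp G x \subset S.
Proof. by move=> c xS; apply/fintype.subsetP => y; rewrite inE; exact: clo_conn. Qed.

Lemma clo_compl V (G : graph V) (S : {set V}) : clo G S -> clo G (~: S).
Proof.
move=> c; apply/cloP => x y; rewrite !inE => xS e; apply: contra xS.
by rewrite (cloE c e).
Qed.

Lemma cloU V (G : graph V) (S T : {set V}) : clo G S -> clo G T -> clo G (S :|: T).
Proof.
move=> /cloP a /cloP b; apply/cloP => x y; rewrite !inE => /orP[] h e.
  by rewrite (a x y).
by rewrite (b x y) ?orbT.
Qed.

Lemma conn_mono V (G G' : graph V) x y :
  (forall a b, edge G a b -> edge G' a b) -> conn G x y -> conn G' x y.
Proof.
move=> H; apply: connect_sub => a b e; exact/connect1/H.
Qed.

Lemma conn_pull W V (f : W -> V) (G : graph V) a b :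
  conn (pull f G) a b -> conn G (f a) (f b).
Proof.
move=> /connectP[p]; elim: p a => [|z p IH] a /= => [_ -> |].
  exact: connxx.
case/andP; rewrite edge_pull => e P l; apply: (@conn_trans _ _ (f z)).
  exact: edge_conn.
exact: IH.
Qed.

Lemma clo_pull W V (f : W -> V) (G : graph V) S : injective f ->
  clo G (f @: W) -> clo G (f @: (S : {set W})) = clo (pull f G) S.
Proof.
move=> fi /cloP c; apply/cloP/cloP => h a b.
  move=> aS; rewrite edge_pull => e; have := h (f a) (f b).
  by rewrite !mem_imset //; apply.
move=> /imsetP[a' a'S ->] e.
have /imsetP[b' _ E] : b \in f @: W by apply: c e; rewrite imset_f.
by rewrite E mem_imset //; apply: (h a') => //; rewrite edge_pull -E.
Qed.

Lemma comp_pull W V (f : W -> V) (G : graph V) a : injective f ->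
  clo G (f @: W) -> comp G (f a) = f @: comp (pull f G) a.
Proof.
move=> fi c; apply/eqP; rewrite finset.eqEsubset; apply/andP; split.
  by apply: comp_sub; rewrite ?clo_pull ?clo_comp // mem_imset ?comp_id.
apply/fintype.subsetP => _ /imsetP[b bS ->]; rewrite inE; apply: conn_pull.
by move: bS; rewrite inE.
Qed.

Lemma iso_sym V W (G : graph V) (H : graph W) : iso G H -> iso H G.
Proof.
case=> f [[g fg gf] e]; exists g; split; first by exists f.
by move=> x y; rewrite -e !gf.
Qed.

Lemma iso_refl V (G : graph V) : iso G G.
Proof. by exists id; split=> //; exists id. Qed.

Lemma iso_trans V W U (G : graph V) (H : graph W) (K : graph U) :
  iso G H -> iso H K -> iso G K.
Proof.
case=> f [bf e] [g [bg e']]; exists (g \o f); split; first exact: bij_comp.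
by move=> x y /=; rewrite e' e.
Qed.

Lemma iso_pull W V (f : W -> V) (G : graph V) : bijective f -> iso (pull f G) G.
Proof. by move=> b; exists f; split=> // x y; rewrite edge_pull. Qed.

Lemma iso_pull_im W V (f : W -> V) (G : graph V) (S : {set V}) :
  injective f -> f @: W = S -> iso (pull f G) (induced G S).
Proof.
move=> fi E.
have fS a : f a \in S by rewrite -E imset_f.
exists (fun a => exist _ (f a) (fS a)); split.
  apply: inj_card_bij => [a b /(congr1 val) /= /fi //|].
  by rewrite card_sig -(card_imset _ fi) E.
by move=> a b; rewrite inducedE !edge_pull.
Qed.

Lemma iso_cls (C : gclass) V W (G : graph V) (H : graph W) :
  iso_closed C -> iso G H -> C V G <-> C W H.
Proof. by move=> ic i; split; apply: ic => //; exact: iso_sym. Qed.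

Lemma cls_pull_im (C : gclass) W V (f : W -> V) (G : graph V) (S : {set V}) :
  iso_closed C -> injective f -> f @: W = S ->
  C _ (pull f G) <-> C _ (induced G S).
Proof. by move=> ic fi E; apply: iso_cls => //; exact: iso_pull_im. Qed.

Lemma cls_induced (C : gclass) V (G G' : graph V) (S S' : {set V}) :
  S = S' -> {in S &, forall x y, edge G x y = edge G' x y} ->
  C _ (induced G S) -> C _ (induced G' S').
Proof.
move=> <- h; suff -> : induced G S = induced G' S by [].
by apply: graph_ext => x y; rewrite !inducedE !edge_pull h //; exact: valP.
Qed.

Lemma cls_comp_pull (C : gclass) W V (f : W -> V) (G : graph V) a :
  iso_closed C -> injective f -> clo G (f @: W) ->
  C _ (induced (pull f G) (comp (pull f G) a)) <-> C _ (induced G (comp G (f a))).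
Proof.
move=> ic fi c; rewrite [induced (pull f G) _]inducedE pull_comp.
apply: cls_pull_im => //; first by move=> x y /= /fi /val_inj.
rewrite comp_pull //; apply/setP => y; apply/imsetP/imsetP => -[x xS ->].
  by exists (val x) => //; exact: valP.
by exists (exist _ x xS).
Qed.

Lemma cls_bij_pull (C : gclass) W V (f : W -> V) (G : graph V) :
  iso_closed C -> bijective f -> C _ (pull f G) <-> C _ G.
Proof. by move=> ic b; apply: iso_cls => //; exact: iso_pull. Qed.

Lemma inF_iso (C : gclass) : iso_closed C -> iso_closed (inF C).
Proof.
move=> ic V W G H /iso_sym [f [bf e]] i x.
have E : H = pull f G by apply: graph_ext => a b; rewrite edge_pull e.
have im : f @: W = [set: V].
  apply/setP => y; rewrite inE; have [g _ gf] := bf.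
  by apply/imsetP; exists (g y).
rewrite E cls_comp_pull //; first exact: bij_inj.
by rewrite im; apply/cloP => *; rewrite inE.
Qed.

Definition gset (A : gclass) V : {set graph V} := [set G | `[< A V G >]].

Lemma in_gset (A : gclass) V G : (G \in gset A V) = `[< A V G >].
Proof. by rewrite inE. Qed.

Lemma gsetP (A : gclass) V G : reflect (A V G) (G \in gset A V).
Proof. by rewrite inE; exact: asboolP. Qed.

Lemma cntE (A : gclass) n : cnt A n = #|gset A 'I_n|.
Proof. by rewrite cardsE. Qed.

Lemma leq_card_inj (T U : finType) (X : {set T}) (Y : {set U}) (f : T -> U) :
  {in X &, injective f} -> (forall x, x \in X -> f x \in Y) -> #|X| <= #|Y|.
Proof.
move=> fi h; rewrite -(card_in_imset fi); apply: subset_leq_card.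
by apply/fintype.subsetP => _ /imsetP[x xX ->]; exact: h.
Qed.

Lemma bij_of_card V W : #|V| = #|W| -> exists f : V -> W, bijective f.
Proof.
move=> e; exists (fun x => enum_val (cast_ord e (enum_rank x))).
exists (fun y => enum_val (cast_ord (esym e) (enum_rank y))) => x;
by rewrite enum_valK ?cast_ordK ?cast_ordKV enum_rankK.
Qed.

Lemma pull_inj V W (f : V -> W) : bijective f -> injective (@pull V W f).
Proof.
move=> [g fg gf] G G' e; apply: graph_ext => x y.
by move: (congr1 (fun K => edge K (g x) (g y)) e); rewrite !edge_pull !gf.
Qed.

Lemma card_gset (A : gclass) V : iso_closed A -> #|gset A V| = cnt A #|V|.
Proof.
move=> ic; rewrite cntE; apply/eqP; rewrite eqn_leq; apply/andP; split.
  have [f bf] := @bij_of_card 'I_#|V| V (card_ord _).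
  apply: (@leq_card_inj _ _ _ _ (@pull _ _ f)) => [x y _ _|G]; first exact: pull_inj.
  by move/gsetP => a; apply/gsetP/cls_bij_pull.
have [f bf] := @bij_of_card V 'I_#|V| (esym (card_ord _)).
apply: (@leq_card_inj _ _ _ _ (@pull _ _ f)) => [x y _ _|G]; first exact: pull_inj.
by move/gsetP => a; apply/gsetP/cls_bij_pull.
Qed.

Lemma sum_card_pair (T U : finType) (X : {set T}) (P : T -> pred U) :
  \sum_(a in X) #|[set b | P a b]| =
  #|[set p : T * U | (p.1 \in X) && P p.1 p.2]|.
Proof.
rewrite (eq_bigr (fun a => \sum_(b | P a b) 1)); last first.
  by move=> a _; rewrite sum1dep_card.
by rewrite pair_big_dep sum1dep_card.
Qed.

End GraphBasics.

(** * Bridges *)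

Section Bridges.
Implicit Types (V W U : finType).

Definition isbr V (G : graph V) (p : V * V) :=
  edge G p.1 p.2 && ~~ conn (delE G p.1 p.2) p.1 p.2.

Definition croot V (G : graph V) x := fingraph.root (edge G) x.

Lemma croot_conn V (G : graph V) x : conn G (croot G x) x.
Proof. by rewrite conn_sym; exact: connect_root. Qed.

Lemma croot_eq V (G : graph V) x y : conn G x y -> croot G x = croot G y.
Proof. by move=> c; apply/eqP; rewrite root_connect //; exact/sym_connect_sym/edge_sym. Qed.

(* Bridges oriented away from the root of their component are determined by their
   head, so there are at most [#|V|] of them. *)
Definition far V (G : graph V) (p : V * V) :=
  isbr G p && ~~ conn (delE G p.1 p.2) (croot G p.2) p.2.

Lemma delEC V (G : graph V) u v : delE G u v = delE G v u.
Proof. by apply: graph_ext => x y; rewrite !edge_delE orbC. Qed.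

(** If [u] and [u'] differ, the root still reaches [u] after the deletion of u'v, because its side T
    of the bridge uv avoids [v] and so loses no edge; the edge uv then leads on to [v],
    contradicting [far] for [u']. *)
Lemma far_inj V (G : graph V) u u' v : far G (u, v) -> far G (u', v) -> u = u'.
Proof.
rewrite /far /isbr /= => /andP[/andP[e _] f] /andP[/andP[e' _] f'].
apply/eqP/negPn/negP => uu'; move/negP: f'; apply.
set r := croot G v in f *; set D := delE G u v in f *.
set T := comp D r.
have vT : v \notin T by rewrite inE.
have uT : u \in T.
  apply/negPn/negP => uT; move: (vT); rewrite (@clo_conn _ G T r v) //.
  - apply/cloP => a b aT ab; apply: (clo_edge (clo_comp D r) aT).
    rewrite edge_delE ab /=; apply/negP => /orP[] /andP[/eqP E _]; move: aT;
    by rewrite E ?(negbTE uT) ?(negbTE vT).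
  - exact: comp_id.
  - exact: croot_conn.
set D' := delE G u' v.
have sub : T \subset T :&: comp D' r.
  apply: comp_sub; last by rewrite inE !comp_id.
  apply/cloP => a b; rewrite inE => /andP[aT aC] ab.
  have bT : b \in T by rewrite -(cloE (clo_comp D r) ab).
  rewrite inE bT /=; apply: (clo_edge (clo_comp D' r) aC).
  move: ab; rewrite !edge_delE => /andP[-> _] /=.
  by apply/negP => /orP[] /andP[/eqP E /eqP E']; move: aT bT; rewrite E E' (negbTE vT).
have : u \in comp D' r by move/fintype.subsetP/(_ u uT): sub; rewrite inE => /andP[].
rewrite inE => c; apply: (conn_trans c); apply: edge_conn.
rewrite edge_delE e /= (negbTE uu') /=; apply/negP => /andP[/eqP E _].
by move: e; rewrite E edge_irr.
Qed.

(** If both ends still reached the root, they would be connected without the bridge. *)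
Lemma isbr_far V (G : graph V) p : isbr G p -> far G p || far G (p.2, p.1).
Proof.
case: p => u v; rewrite /far /isbr /= => /andP[e nc].
rewrite e nc /= edge_sym e /= (delEC _ v u) (conn_sym _ v u) nc /=.
rewrite (croot_eq (edge_conn e)) -negb_and; apply: contra nc => /andP[a b].
by apply: conn_trans a; rewrite conn_sym.
Qed.

Lemma card_isbr_far V (G : graph V) :
  #|[set p | isbr G p]| <= 2 * #|[set p | far G p]|.
Proof.
have -> : 2 * #|[set p | far G p]| =
    #|[set p | far G p]| + #|(fun p : V * V => (p.2, p.1)) @: [set p | far G p]|.
  by rewrite card_imset ?mul2n -?addnn // => -[a b] [c d] /= [-> ->].
rewrite -cardsUI; apply: leq_trans (leq_addr _ _); apply: subset_leq_card.
apply/fintype.subsetP => -[u v]; rewrite !inE => /isbr_far /orP[->//|f].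
by apply/orP; right; apply/imsetP; exists (v, u); rewrite ?inE.
Qed.

Lemma card_isbr V (G : graph V) : #|[set p | isbr G p]| <= 2 * #|V|.
Proof.
apply: leq_trans (card_isbr_far G) _; rewrite leq_mul2l /= -(cardsT V).
apply: (@leq_card_inj _ _ _ _ snd) => [[u v] [u' v']|//].
by rewrite !inE /= => f f' E; move: f'; rewrite -E => /(far_inj f) ->.
Qed.

(** The root is the head of no bridge oriented away from it. The 1 saved here is what later produces
    the term subtracted in the quadratic inequality behind the bound 1/2. *)
Lemma card_isbr_conn V (G : graph V) : gconnected G ->
  #|[set p | isbr G p]| <= 2 * #|V|.-1.
Proof.
case=> /card_gt0P[x0 _] gc.
apply: leq_trans (card_isbr_far G) _; rewrite leq_mul2l /=.
rewrite -(cardC1 (croot G x0)) -[X in _ <= X]cardsE.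
apply: (@leq_card_inj _ _ _ _ snd) => [[u v] [u' v']|[u v]]; rewrite !inE /=.
  by move=> f f' E; move: f'; rewrite -E => /(far_inj f) ->.
move=> /andP[_ /=]; apply: contra => /eqP E.
by rewrite (croot_eq (gc v x0)) -E connxx.
Qed.

Lemma isbr_addE V (G : graph V) y x : ~~ conn G y x -> isbr (addE G y x) (y, x).
Proof.
move=> nc; have yx : y != x by apply: contraNneq nc => ->; rewrite connxx.
have ne : ~~ edge G y x by apply: contra nc; exact: edge_conn.
by rewrite /isbr /= addEK // nc andbT edge_addE // !eqxx orbT.
Qed.

(** The closed image makes the copy of [F] a union of components of [G]. *)
Definition cemb W V (F : graph W) (G : graph V) (f : {ffun W -> V}) :=
  [&& injectiveb f, pull f G == F & clo G (f @: W)].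

Lemma cembP W V (F : graph W) (G : graph V) (f : {ffun W -> V}) :
  reflect [/\ injective f, pull f G = F & clo G (f @: W)] (cemb F G f).
Proof.
by apply: (iffP and3P) => -[/injectiveP a /eqP b c].
Qed.

Lemma cemb_eq W V (F : graph W) (G G' : graph V) (f : {ffun W -> V}) :
  (forall a b, edge G (f a) b = edge G' (f a) b) -> cemb F G f = cemb F G' f.
Proof.
move=> h; rewrite /cemb; congr [&& _, _ & _].
  suff -> : pull f G = pull f G' by [].
  by apply: graph_ext => a b; rewrite !edge_pull h.
apply/cloP/cloP => H x y /[dup] xS /imsetP[a _ E] e; apply: (H x) => //.
  by rewrite E h -E.
by rewrite E -h -E.
Qed.

Lemma cemb_addE W V (F : graph W) (G : graph V) (f : {ffun W -> V}) u v :
  u != v -> u \notin f @: W -> v \notin f @: W ->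
  cemb F (addE G u v) f = cemb F G f.
Proof.
move=> uv uS vS; apply: cemb_eq => a b; rewrite edge_addE //.
have -> : (f a == u) = false by apply/eqP => E; move: uS; rewrite -E imset_f.
have -> : (f a == v) = false by apply/eqP => E; move: vS; rewrite -E imset_f.
by rewrite !orbF.
Qed.

Lemma card_pair_ge (T U : finType) (X : {set T}) (P : T -> pred U) k :
  (forall a, a \in X -> k <= #|[set b | P a b]|) ->
  #|X| * k <= #|[set p : T * U | (p.1 \in X) && P p.1 p.2]|.
Proof.
by move=> h; rewrite -sum_card_pair -sum_nat_const; apply: leq_sum.
Qed.

Lemma card_pair_le (T U : finType) (X : {set T}) (P : T -> pred U) k :
  (forall a, a \in X -> #|[set b | P a b]| <= k) ->
  #|[set p : T * U | (p.1 \in X) && P p.1 p.2]| <= #|X| * k.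
Proof.
by move=> h; rewrite -sum_card_pair -sum_nat_const; apply: leq_sum.
Qed.

Definition smallset W V (F : graph W) (G : graph V) (m : nat) :=
  [set t : {ffun W -> V} * V |
    [&& cemb F G t.1, t.2 \notin t.1 @: W & #|comp G t.2| <= m]].

(* Joining a small component to the rest by a new edge creates a bridge, and a
   graph has few bridges. *)
Lemma small_components (A : gclass) W V (F : graph W) m : bridge_addable A ->
  (\sum_(G in gset A V) #|smallset F G m|) * (#|V| - #|W| - m) <=
  (\sum_(G in gset A V) #|[set f | cemb F G f]|) * (2 * #|V|).
Proof.
move=> ba; rewrite !sum_card_pair.
set X := [set p : graph V * _ | _].
set Y := [set p : graph V * {ffun W -> V} | _].
apply: leq_trans (@card_pair_ge _ _ X (fun q x =>
  (x \notin comp q.1 q.2.2) && (x \notin q.2.1 @: W)) _ _) _.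
  move=> [G [f y]]; rewrite inE /= => /and4P[_ cf yf s].
  have -> : [set b | (b \notin comp G y) && (b \notin f @: W)] =
            ~: (comp G y :|: f @: W).
    by apply/setP => z; rewrite !inE negb_or.
  have /injectiveP fi : injectiveb f by case/and3P: cf.
  rewrite cardsCs finset.setCK -subnDA leq_sub2l //.
  apply: leq_trans (leq_card_setU _ _) _; rewrite addnC leq_add //.
  by rewrite card_imset.
apply: leq_trans (@card_pair_le _ _ Y (fun q => isbr q.1) _ _); last first.
  by move=> [G f] _; exact: card_isbr.
pose g (q : (graph V * ({ffun W -> V} * V)) * V) :=
  ((addE q.1.1 q.1.2.2 q.2, q.1.2.1), (q.1.2.2, q.2)).
apply: (@leq_card_inj _ _ _ _ g).
  move=> [[G [f y]] x] [[G' [f' y']] x'] /=.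
  rewrite !inE /= => /andP[_ /andP[c _]] /andP[_ /andP[c' _]] [E -> yy' xx'].
  subst y' x'.
  have yx : y != x by apply: contraNneq c => ->; exact: connxx.
  suff GG : G = G' by rewrite GG.
  have e1 : ~~ edge G y x by apply: contra c; exact: edge_conn.
  have e2 : ~~ edge G' y x by apply: contra c'; exact: edge_conn.
  have E' : addE G y x = addE G' y x by exact: val_inj.
  by rewrite -(addEK yx e1) E' addEK.
move=> [[G [f y]] x]; rewrite !inE /= => /andP[/and4P[a cf yf _] /andP[c xf]].
have yx : y != x by apply: contraNneq c => ->; exact: connxx.
rewrite cemb_addE // cf isbr_addE // !andbT.
by apply/asboolP; apply: ba => //; exact/asboolP.
Qed.

End Bridges.

(** * Pendant embeddings *)

Section Pendant.
Implicit Types (V W U : finType).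

(** Besides the embedding, the outer end [t.2] of the unique leaving edge is recorded. It is
    determined by [t.1], but having it at hand allows the edge to be deleted and restored. *)
Definition pemb W V (H : graph W) (r : W) (G : graph V) (t : {ffun W -> V} * V) :=
  [&& injectiveb t.1, pull t.1 G == H, t.2 \notin t.1 @: W &
    [forall a, forall y, (y \notin t.1 @: W) ==>
      (edge G (t.1 a) y == (a == r) && (y == t.2))]].

Lemma pembP W V (H : graph W) (r : W) (G : graph V) (t : {ffun W -> V} * V) :
  reflect [/\ injective t.1, pull t.1 G = H, t.2 \notin t.1 @: W &
    forall a y, y \notin t.1 @: W -> edge G (t.1 a) y = (a == r) && (y == t.2)]
  (pemb H r G t).
Proof.
apply: (iffP and4P) => -[a b c d]; split=> //.
- exact/injectiveP.
- exact/eqP.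
- by move=> e y yS; move/forallP/(_ e)/forallP/(_ y)/implyP/(_ yS)/eqP: d.
- exact/injectiveP.
- exact/eqP.
- apply/forallP => e; apply/forallP => y; apply/implyP => yS; apply/eqP; exact: d.
Qed.

Definition pset W V (H : graph W) (r : W) (G : graph V) := [set t | pemb H r G t].

Lemma pemb_edge W V (H : graph W) (r : W) (G : graph V) t :
  pemb H r G t -> edge G (t.1 r) t.2.
Proof. by case/pembP => _ _ xS d; rewrite d // !eqxx. Qed.

Lemma pemb_conn W V (H : graph W) (r : W) (G : graph V) t a b :
  gconnected H -> pemb H r G t -> conn G (t.1 a) (t.1 b).
Proof. by case=> _ c /pembP[_ E _ _]; apply: conn_pull; rewrite E. Qed.

Lemma pemb_inj W V (H : graph W) (r : W) (G : graph V) t t' :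
  pemb H r G t -> pemb H r G t' -> t.1 = t'.1 -> t = t'.
Proof.
case: t t' => [f x] [f' x'] p p' /= E; subst f'.
have /= e := pemb_edge p; case/pembP: p => _ _ xS _.
by case/pembP: p' => /= _ _ _ d; move: e; rewrite d // eqxx => /eqP ->.
Qed.

(** Otherwise [t'] never uses the edge that leaves the image of [t]. The part of [H] that [t'] sends
    into this image is then closed, hence all of [H] by connectedness, and equal sizes make the two
    images equal. *)
Lemma pemb_not_subset W V (H : graph W) (r : W) (G : graph V) t t' v :
  gconnected H -> pemb H r G t -> pemb H r G t' ->
  v \in t.1 @: W -> v \in t'.1 @: W -> t.1 @: W != t'.1 @: W ->
  t.2 \in t'.1 @: W.
Proof.
move=> gc p p' vS vS' ne.
have /pembP[fi E xS d] := p; have /pembP[fi' E' xS' d'] := p'.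
apply/negPn/negP => xn.
have cl : clo H [set a | t'.1 a \in t.1 @: W].
  apply/cloP => a b; rewrite !inE => aS; rewrite -E' edge_pull => e.
  apply/negPn/negP => bS; case/imsetP: aS => c _ Ec.
  move: e; rewrite Ec d // => /andP[_ /eqP Eb]; move: xn.
  by rewrite -Eb imset_f.
move/negP: ne; apply; rewrite eq_sym eqEcard !card_imset // leqnn andbT.
apply/fintype.subsetP => _ /imsetP[b _ ->].
case/imsetP: vS' => a _ Ea; have := @clo_conn _ _ _ a b cl.
by rewrite !inE -Ea vS; apply => //; case: gc.
Qed.

(** The only edge that leaves either image ends in the other one, so no edge leaves the union. *)
Lemma pemb_overlap W V (H : graph W) (r : W) (G : graph V) t t' v :
  gconnected H -> pemb H r G t -> pemb H r G t' ->
  v \in t.1 @: W -> v \in t'.1 @: W -> t.1 @: W != t'.1 @: W ->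
  clo G (t.1 @: W :|: t'.1 @: W).
Proof.
move=> gc p p' vS vS' ne.
have xS := pemb_not_subset gc p p' vS vS' ne.
have ne' : t'.1 @: W != t.1 @: W by rewrite eq_sym.
have xS' := pemb_not_subset gc p' p vS' vS ne'.
have /pembP[_ _ _ d] := p; have /pembP[_ _ _ d'] := p'.
apply/cloP => x y; rewrite !inE => h e.
case: (boolP (y \in t.1 @: W)) => //= n1; apply/negPn/negP => n2.
case/orP: h => /imsetP[a _ Ex]; move: e; rewrite Ex.
  by rewrite d // => /andP[_ /eqP Ey]; move: n2; rewrite Ey xS.
by rewrite d' // => /andP[_ /eqP Ey]; move: n1; rewrite Ey xS'.
Qed.

(** All pendant embeddings through a given vertex map into one set of at most 2|W| vertices; this is
    the number of maps into such a set. *)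
Definition hitc W := (2 * #|W|) ^ #|W|.

(** Two different images through [v] have a closed union, which by connectedness contains every
    further image through [v]; if there is only one image, it serves itself. *)
Lemma pemb_hit1 W V (H : graph W) (r : W) (G : graph V) v : gconnected H ->
  #|[set t | pemb H r G t && (v \in t.1 @: W)]| <= hitc W.
Proof.
move=> gc.
have [T [Tc hT]] : exists T : {set V}, #|T| <= 2 * #|W| /\
    forall t, pemb H r G t -> v \in t.1 @: W -> t.1 @: W \subset T.
  case: (pickP [pred t | pemb H r G t && (v \in t.1 @: W)]) => [t0|none]; last first.
    exists finset.set0; rewrite cards0; split=> // t p vS.
    by have := none t; rewrite /= p vS.
  move=> /= /andP[p0 v0].
  have i0 : injective t0.1 by case/pembP: p0.
  case: (pickP [pred t | [&& pemb H r G t, v \in t.1 @: W & t0.1 @: W != t.1 @: W]]).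
    move=> t1 /= /and3P[p1 v1 ne].
    have i1 : injective t1.1 by case/pembP: p1.
    exists (t0.1 @: W :|: t1.1 @: W); split.
      by apply: leq_trans (leq_card_setU _ _) _; rewrite !card_imset // mul2n -addnn.
    move=> t p vS; have cl := pemb_overlap gc p0 p1 v0 v1 ne.
    apply/fintype.subsetP => _ /imsetP[b _ ->]; case/imsetP: vS => a _ Ea.
    apply: (@clo_conn _ G _ (t.1 a) _ cl); first by rewrite -Ea inE v0.
    exact: pemb_conn gc p.
  move=> none; exists (t0.1 @: W); split; first by rewrite card_imset // leq_pmull.
  move=> t p vS; have := none t; rewrite /= p vS /= => /negbFE /eqP ->.
  exact: subxx.
apply: leq_trans (_ : #|[set f : {ffun W -> V} in ffun_on (mem T)]| <= _).
  apply: (@leq_card_inj _ _ _ _ fst) => [t t'|t]; rewrite !inE.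
    by move=> /andP[p _] /andP[p' _]; exact: pemb_inj p p'.
  move=> /andP[p vS]; apply/ffun_onP => a.
  by apply: (fintype.subsetP (hT _ p vS)); rewrite imset_f.
by rewrite cardsE card_ffun_on leq_exp2r //; case: gc.
Qed.

Lemma pemb_hit W V (H : graph W) (r : W) (G : graph V) (X : {set V})
    (P : pred ({ffun W -> V} * V)) (s : {ffun W -> V} * V -> V) : gconnected H ->
  (forall t, P t -> [&& pemb H r G t, s t \in X & s t \in t.1 @: W]) ->
  #|[set t | P t]| <= #|X| * hitc W.
Proof.
move=> gc h; apply: leq_trans (@card_pair_le _ _ X
  (fun v t => pemb H r G t && (v \in t.1 @: W)) _ _); last first.
  by move=> v _; exact: pemb_hit1.
apply: (@leq_card_inj _ _ _ _ (fun t => (s t, t))) => [t t' _ _ [] //|t].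
by rewrite !inE /= => /h /and3P[-> -> ->].
Qed.

Lemma card_pset W V (H : graph W) (r : W) (G : graph V) : gconnected H ->
  #|pset H r G| <= #|V| * hitc W.
Proof.
move=> gc; rewrite -cardsT.
apply: (@pemb_hit _ _ H r G _ _ (fun t => t.1 r) gc) => t ->.
by rewrite inE imset_f.
Qed.

(** For injective [s] this is a section of [pull s]; vertices outside the image of [s] become
    isolated. *)
Definition push V U (s : V -> U) (K : graph V) : graph U :=
  mkgraph (fun x y => [exists a, exists b, [&& s a == x, s b == y & edge K a b]]).

Lemma edge_push V U (s : V -> U) (K : graph V) a b : injective s ->
  edge (push s K) (s a) (s b) = edge K a b.
Proof.
move=> si; have h c d : [exists a, exists b, [&& s a == s c, s b == s d & edge K a b]]
    = edge K c d.
  apply/existsP/idP => [[a' /existsP[b' /and3P[/eqP/si -> /eqP/si -> //]]]|e].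
  by exists c; apply/existsP; exists d; rewrite !eqxx.
rewrite edge_mkgraph !h [edge K b a]edge_sym orbb.
case: (eqVneq a b) => [->|ne]; rewrite ?edge_irr //.
by rewrite (inj_eq si) ne andbT.
Qed.

Lemma pull_push V U (s : V -> U) (K : graph V) : injective s -> pull s (push s K) = K.
Proof. by move=> si; apply: graph_ext => a b; rewrite edge_pull edge_push. Qed.

Lemma card_pset_pull W V U (H : graph W) (r : W) (s : V -> U) (G : graph U) :
  bijective s -> #|pset H r G| <= #|pset H r (pull s G)|.
Proof.
case=> g sg gs.
pose m (t : {ffun W -> U} * U) := ([ffun a => g (t.1 a)], g t.2).
have gi : injective g := can_inj gs.
apply: (@leq_card_inj _ _ _ _ m) => [[f x] [f' x'] _ _ [E /gi ->]|[f x]].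
  congr pair; apply/ffunP => a.
  by move/ffunP/(_ a): E; rewrite !ffunE /= => /gi.
have im y : (y \in (m (f, x)).1 @: W) = (s y \in f @: W).
  apply/imsetP/imsetP => -[a _ E]; exists a => //; first by rewrite E ffunE gs.
  by rewrite ffunE /= -E sg.
rewrite !inE => /pembP /= [fi E xS d]; apply/pembP; split.
- by move=> a b; rewrite !ffunE => /gi /fi.
- by apply: graph_ext => a b; rewrite !edge_pull !ffunE !gs -E edge_pull.
- by rewrite im gs.
- move=> a y; rewrite im => yS; rewrite edge_pull ffunE gs d //=.
  by rewrite -(inj_eq gi) sg.
Qed.

Section AttachEdges.
Variables (V W : finType) (G : graph V) (H : graph W) (r : W) (k : nat) (w : 'I_k -> V).
Let K := attach G H r w.

Lemma attach_ll a b : edge K (inl a) (inl b) = edge G a b.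
Proof.
rewrite edge_mkgraph [edge G b a]edge_sym orbb.
by case: eqVneq => [[->]|]; rewrite ?edge_irr // andbT.
Qed.

Lemma attach_lr a p : edge K (inl a) (inr p) = (p.2 == r) && (w p.1 == a).
Proof. by case: p => i b; rewrite edge_mkgraph /= orbF andbT. Qed.

Lemma attach_rl a p : edge K (inr p) (inl a) = (p.2 == r) && (w p.1 == a).
Proof. by rewrite edge_sym attach_lr. Qed.

Lemma attach_rr p q : edge K (inr p) (inr q) = (p.1 == q.1) && edge H p.2 q.2.
Proof.
case: p q => i a [j b]; rewrite edge_mkgraph /= [edge H b a]edge_sym [j == i]eq_sym orbb.
case: (eqVneq i j) => //= ->; case: (eqVneq a b) => [->|ne]; first by rewrite edge_irr.
rewrite (_ : _ != _) ?andbT //; by apply: contra ne => /eqP[->].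
Qed.

Definition unl (v0 : V) (z : V + 'I_k * W) := if z is inl v then v else v0.

(** An embedding that avoids the attached copies and the attachment points lies in [G], and so does
    its outer end, so it is pendant in [G]. Every other embedding passes through one of k|W| + k
    vertices, each of which meets at most [hitc W] embeddings. *)
Lemma card_pset_attach (v0 : V) : gconnected H ->
  #|pset H r K| <= #|pset H r G| + (k * #|W| + k) * hitc W.
Proof.
move=> gc.
pose X : {set V + 'I_k * W} := inr @: [set: 'I_k * W] :|: [set inl (w i) | i : 'I_k].
have cX : #|X| <= k * #|W| + k.
  apply: leq_trans (leq_card_setU _ _) _; rewrite leq_add //.
    by rewrite card_imset ?cardsT ?card_prod ?card_ord // => a b [].
  by rewrite (leq_trans (leq_imset_card _ _)) // cardE size_enum_ord.
pose P t := pemb H r K t && [exists v in X, v \in t.1 @: W].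
(* The default is irrelevant: [s] is only used for [t] satisfying [P], whose image meets [X]. *)
pose s (t : {ffun W -> V + 'I_k * W} * (V + 'I_k * W)) :=
  odflt (inl v0) [pick v in X | v \in t.1 @: W].
have c1 : #|[set t | P t]| <= #|X| * hitc W.
  apply: (@pemb_hit _ _ H r K X P s gc) => t /andP[-> /existsP[v /andP[vX vS]]] /=.
  rewrite /s; case: pickP => [z /andP[-> ->] //|] /(_ v) /=.
  by rewrite vX vS.
have c2 : #|[set t | pemb H r K t && ~~ P t]| <= #|pset H r G|.
  pose m (t : {ffun W -> V + 'I_k * W} * (V + 'I_k * W)) :=
    ([ffun a => unl v0 (t.1 a)], unl v0 t.2).
  have key t : pemb H r K t && ~~ P t ->
     (forall a, t.1 a = inl (unl v0 (t.1 a))) /\ t.2 = inl (unl v0 t.2).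
    rewrite /P => /andP[p]; rewrite p /= negb_exists => /forallP h.
    have hX z : z \in X -> z \notin t.1 @: W by move=> zX; move: (h z); rewrite zX.
    have fl a : t.1 a = inl (unl v0 (t.1 a)).
      case E : (t.1 a) => [//|q]; have := hX (inr q).
      by rewrite !inE (imset_f inr) ?inE // -E imset_f // => /(_ isT).
    split=> //; have := pemb_edge p; rewrite fl.
    case: (t.2) => [//|q]; rewrite attach_lr => /andP[_ /eqP E].
    have := hX (inl (w q.1)); rewrite !inE [X in _ || X]imset_f ?orbT // E.
    by move=> /(_ isT); rewrite -fl imset_f.
  apply: (@leq_card_inj _ _ _ _ m).
    move=> [f x] [f' x']; rewrite !inE.
    move=> /key[/= a b] /key[/= a' b'] [E E']; rewrite b b' E'; congr pair.
    by apply/ffunP => c; rewrite a a'; move/ffunP/(_ c): E; rewrite !ffunE /= => ->.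
  move=> t; rewrite !inE => /[dup] /key[a b] /andP[/pembP[fi E xS d] _].
  have im y : (y \in (m t).1 @: W) = (inl y \in t.1 @: W).
    apply/imsetP/imsetP => -[c _ Ec]; exists c => //.
      by rewrite a Ec ffunE.
    by rewrite ffunE -Ec.
  apply/pembP; split.
  - by move=> c c'; rewrite !ffunE => Ec; apply: fi; rewrite a Ec -a.
  - apply: graph_ext => c c'; rewrite edge_pull !ffunE -E edge_pull.
    by rewrite [in RHS]a [t.1 c' in RHS]a attach_ll.
  - by rewrite im -b.
  - move=> c y; rewrite im => yS; rewrite ffunE -attach_ll -a d // [in LHS]b.
    by congr (_ && _); apply/eqP/eqP => [[->]|->].
rewrite -(cardsID [set t | P t] (pset H r K)) addnC leq_add //.
  apply: leq_trans c2; apply: subset_leq_card; apply/fintype.subsetP => t.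
  by rewrite !inE andbC.
apply: leq_trans (_ : #|X| * hitc W <= _); last by rewrite leq_mul2r cX orbT.
apply: leq_trans c1; apply: subset_leq_card; apply/fintype.subsetP => t.
by rewrite !inE => /andP[].
Qed.
End AttachEdges.

End Pendant.

(** * Attaching and detaching pendant copies *)

Section AttachDetach.
Implicit Types (V W U : finType).

(** Counts triples of a graph of [X], attachment points [w] and a bijective labelling by [U] of the
    graph with its copies attached. A triple is recovered from the labelled graph in [B], the k
    pendant embeddings of the attached copies, with at most x + (k|W| + k) hitc W choices for each,
    and the bijection from [V] to the remaining vertices, with |V|! choices. *)
Lemma attach_count V W U (X : {set graph V}) (B : gclass) (H : graph W) (r : W) k x :
  gconnected H -> iso_closed B -> 0 < #|V| -> #|U| = #|V| + k * #|W| ->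
  (forall G, G \in X -> forall w : 'I_k -> V, B _ (attach G H r w)) ->
  (forall G, G \in X -> #|pset H r G| <= x) ->
  #|X| * #|V| ^ k * (#|U|)`! <=
  #|gset B U| * (x + (k * #|W| + k) * hitc W) ^ k * (#|V|)`!.
Proof.
move=> gc icB /card_gt0P[v0 _] cU hB hx.
pose T0 : finType := (V + 'I_k * W)%type.
have cT0 : #|T0| = #|U| by rewrite cU card_sum card_prod card_ord.
set M := x + _.
pose X1 := finset.setX X [set: {ffun 'I_k -> V}].
have cX1 : #|X1| = #|X| * #|V| ^ k by rewrite cardsX cardsT card_ffun card_ord.
rewrite -cX1; apply: leq_trans (@card_pair_ge _ _ X1 (fun _ (s : {ffun T0 -> U}) => injectiveb s) _ _) _.
  by move=> q _; rewrite card_inj_ffuns cT0 ffactnn.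
pose R (p : {ffun 'I_k -> {ffun W -> U} * U}) := ~: \bigcup_(j < k) (p j).1 @: W.
pose Y0 := [set K in gset B U | #|pset H r K| <= M].
pose Y1 := [set q : graph U * {ffun 'I_k -> {ffun W -> U} * U} |
  (q.1 \in Y0) && ((q.2 \in ffun_on (mem (pset H r q.1))) && (#|R q.2| == #|V|))].
apply: leq_trans (_ : #|Y1| * (#|V|)`! <= _); last first.
  rewrite leq_mul2r; apply/orP; right.
  apply: leq_trans (@card_pair_le _ _ Y0
    (fun K (p : {ffun 'I_k -> {ffun W -> U} * U}) =>
       (p \in ffun_on (mem (pset H r K))) && (#|R p| == #|V|)) (M ^ k) _) _.
    move=> K; rewrite inE => /andP[_ cK].
    apply: (@leq_trans #|[set p : {ffun 'I_k -> _} in ffun_on (mem (pset H r K))]|).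
      by apply: subset_leq_card; apply/fintype.subsetP => p; rewrite !inE => /andP[].
    rewrite cardsE card_ffun_on card_ord.
    by case: (k) => // k'; rewrite leq_exp2r.
  by rewrite leq_mul2r; apply/orP; right; apply: subset_leq_card;
     apply/fintype.subsetP => K; rewrite inE => /andP[].
apply: leq_trans (@card_pair_le _ _ Y1
   (fun q (i : {ffun V -> U}) => (i \in ffun_on (mem (R q.2))) && injectiveb i) _ _); last first.
  move=> [K p]; rewrite inE => /and3P[_ _ /eqP cR]; rewrite card_inj_ffuns_on.
  by rewrite cR ffactnn.
pose g (q : (graph V * {ffun 'I_k -> V}) * {ffun T0 -> U}) :=
  ((push q.2 (attach q.1.1 H r q.1.2),
   [ffun j : 'I_k => ([ffun a => q.2 (inr (j, a))], q.2 (inl (q.1.2 j)))]),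
   [ffun v => q.2 (inl v)]).
apply: (@leq_card_inj _ _ _ _ g).
  move=> [[G w] s] [[G' w'] s']; rewrite !inE /=.
  move=> /andP[_ /injectiveP si] /andP[_ /injectiveP si'].
  rewrite /g /= => E.
  have Ei v : s (inl v) = s' (inl v).
    by move: (congr1 (fun (z : (graph U * {ffun 'I_k -> {ffun W -> U} * U}) * {ffun V -> U}) => z.2 v) E); rewrite /= !ffunE.
  have Ep j : ([ffun a => s (inr (j, a))], s (inl (w j))) =
              ([ffun a => s' (inr (j, a))], s' (inl (w' j))).
    by move: (congr1 (fun (z : (graph U * {ffun 'I_k -> {ffun W -> U} * U}) * {ffun V -> U}) => z.1.2 j) E); rewrite /= !ffunE.
  have Es : s = s'.
    apply/ffunP => -[v|[j a]]; first exact: Ei.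
    by move: (congr1 (fun z : {ffun W -> U} * U => z.1 a) (Ep j)); rewrite /= !ffunE.
  have Ew : w = w'.
    apply/ffunP => j; have := congr1 snd (Ep j) => /=; rewrite Es.
    by move/si' => -[].
  have EG : G = G'.
    apply: graph_ext => a b; have := congr1 fst (congr1 fst E) => /= EK.
    by rewrite -(attach_ll G H r w) -(edge_push _ _ _ si) EK Es edge_push // attach_ll.
  by rewrite Es Ew EG.
move=> [[G w] s] hq.
have /andP[GwX /injectiveP si] : ((G, w) \in X1) && injectiveb s by move: hq; rewrite inE.
have GX : G \in X by move: GwX; rewrite finset.in_setX => /andP[].
set K := attach G H r w.
have sb : bijective s by apply: inj_card_bij => //; rewrite cT0.
have RE : R (g ((G, w), s)).1.2 = ~: (s @: (inr @: [set: 'I_k * W])).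
  congr (~: _); apply/setP => y; apply/bigcupP/imsetP => /=.
    move=> [j _ /imsetP[a _ ->]]; exists (inr (j, a)); last by rewrite ffunE /= ffunE.
    by rewrite imset_f // inE.
  move=> [z /imsetP[[j a] _ ->] ->]; exists j => //.
  by apply/imsetP; exists a => //; rewrite !ffunE.
have inR y : (y \in R (g ((G, w), s)).1.2) = [forall p, y != s (inr p)].
  rewrite RE inE; apply/negP/forallP => [h p|h /imsetP[z /imsetP[p _ ->] E]].
    by apply/negP => /eqP E; apply: h; rewrite E imset_f // imset_f.
  by move: (h p); rewrite E eqxx.
have inY : (g ((G, w), s)).1 \in Y1.
  rewrite inE; apply/andP; split; first (rewrite inE; apply/andP; split).
  - by apply/gsetP/(@cls_bij_pull B _ _ s) => //=; rewrite pull_push //; exact: hB.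
  - apply: leq_trans (card_pset_pull H r (push s K) sb) _; rewrite pull_push //.
    by apply: leq_trans (card_pset_attach G r w v0 gc) _; rewrite leq_add2r hx.
  apply/andP; split; last first.
    rewrite RE cardsCs finset.setCK card_imset // card_imset ?cardsT; last by move=> a b [].
    by rewrite card_prod card_ord cU addnK.
  apply/ffun_onP => j; rewrite inE ffunE; apply/pembP => /=.
  have im y : (s y \in [ffun a => s (inr (j, a))] @: W) =
              (if y is inr p then p.1 == j else false).
    apply/imsetP/idP => [[a _]|]; first by rewrite ffunE => /si ->; rewrite eqxx.
    by case: y => [//|[i a] /= /eqP ->]; exists a => //; rewrite ffunE.
  split.
  - by move=> a b; rewrite !ffunE => /si [].
  - apply: graph_ext => a b; rewrite edge_pull !ffunE edge_push // attach_rr /=.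
    by rewrite eqxx.
  - by rewrite im.
  - move=> a y; have [z ->] : exists z, y = s z by case: sb => h _ hK; exists (h y).
    rewrite im ffunE edge_push // (inj_eq si); case: z => [v _|[i b] /= ij].
      by rewrite attach_rl /= eq_sym; congr (_ && _); apply/eqP/eqP => [->|[->]].
    by rewrite attach_rr /= eq_sym (negbTE ij) /= andbF.
rewrite inE inY /=; apply/andP; split; last first.
  by apply/injectiveP => a b; rewrite !ffunE => /si [].
apply/ffun_onP => v; rewrite [_ \in _]inR ffunE; apply/forallP => p.
by rewrite (inj_eq si).
Qed.

(** Greedy choice: each earlier entry rules out at most [d] elements, so every entry retains at
    least x - d k choices. *)
Lemma indep_tuples (T : finType) (P : pred T) (R : rel T) d x :
  (forall t, P t -> #|[set t' | P t' && R t t']| <= d) -> x <= #|[set t | P t]| ->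
  forall k, (x - d * k) ^ k <= #|[set p : {ffun 'I_k -> T} |
    [forall i, P (p i)] && [forall i : 'I_k, forall j : 'I_k, (i < j) ==> ~~ R (p i) (p j)]]|.
Proof.
move=> hd hx; elim=> [|k IH].
  rewrite expn0 card_gt0; apply/set0Pn.
  exists (finfun (fun i : 'I_0 => match i with Ordinal _ h =>
    match notF h with end end)).
  by rewrite inE; apply/andP; split; apply/forallP => -[].
set Xk := [set p | _] in IH; set Xk1 := [set p | _].
apply: (@leq_trans (#|Xk| * (x - d * k))).
  rewrite expnSr; apply: leq_mul; last by apply: leq_sub2l; rewrite leq_mul2l leqnSn orbT.
  apply: leq_trans IH; case: (k) => // k'; rewrite leq_exp2r //.
  by apply: leq_sub2l; rewrite leq_mul2l leqnSn orbT.
apply: leq_trans (@card_pair_ge _ _ Xk (fun p t => P t && [forall i, ~~ R (p i) t]) _ _) _.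
  move=> p; rewrite inE => /andP[/forallP hP _].
  have sub : [set t | P t] \subset [set t | P t && [forall i, ~~ R (p i) t]] :|:
      \bigcup_(i < k) [set t' | P t' && R (p i) t'].
    apply/fintype.subsetP => t; rewrite !inE => Pt; rewrite Pt /=.
    case: (boolP [forall i, _]) => //=; rewrite negb_forall => /existsP[i].
    by rewrite negbK => h; apply/bigcupP; exists i => //; rewrite inE Pt.
  rewrite leq_subLR addnC; apply: leq_trans hx _; apply: leq_trans (subset_leq_card sub) _.
  apply: leq_trans (leq_card_setU _ _) _; rewrite leq_add2l.
  apply: leq_trans (_ : \sum_(i < k) d <= _); last by rewrite sum_nat_const card_ord mulnC.
  apply: leq_trans (_ : \sum_(i < k) #|[set t' | P t' && R (p i) t']| <= _).
    elim/big_ind2: _ => [|m1 s1 m2 s2 h1 h2|i _]; rewrite ?cards0 //.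
    by apply: leq_trans (leq_card_setU _ _) _; apply: leq_add.
  by apply: leq_sum => i _; apply: hd.
pose g (q : {ffun 'I_k -> T} * T) : {ffun 'I_k.+1 -> T} :=
  [ffun i => if unlift ord_max i is Some j then q.1 j else q.2].
have gl q j : g q (lift ord_max j) = q.1 j by rewrite ffunE liftK.
have gm q : g q ord_max = q.2 by rewrite ffunE unlift_none.
apply: (@leq_card_inj _ _ _ _ g).
  move=> [p t] [p' t'] _ _ E; congr pair; last by have := gm (p, t); rewrite E gm.
  by apply/ffunP => j; have := gl (p, t) j; rewrite E gl.
move=> [p t]; rewrite !inE /= => /andP[/andP[/forallP hP /forallP hR] /andP[Pt /forallP ht]].
apply/andP; split; apply/forallP => i.
  by case: (unliftP ord_max i) => [j ->|->]; rewrite ?gl ?gm.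
apply/forallP => j; apply/implyP.
case: (unliftP ord_max i) => [i' ->|->]; last first.
  by move=> h; have := ltn_ord j; rewrite ltnS leqNgt h.
case: (unliftP ord_max j) => [j' ->|->]; rewrite ?gl ?gm ?lift_max // => h.
by move/forallP/(_ j')/implyP: (hR i'); apply.
Qed.

Lemma pemb_pendant_app V W (H : graph W) (r : W) (G : graph V) t :
  pemb H r G t -> pendant_app H r G (t.1 @: W).
Proof.
move=> /[dup] p /pembP[fi E xS d]; split.
  apply/eqP/cards1P; exists (t.1 r, t.2); apply/setP => -[a b]; rewrite !inE /=.
  apply/and3P/eqP => [[/imsetP[c _ ->] bS]|[-> ->]].
    by rewrite d // => /andP[/eqP -> /eqP ->].
  by split=> //; [rewrite imset_f | exact: pemb_edge p].
exists t.1; split=> //.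
- by move=> a b; rewrite -E edge_pull.
- by move=> x y /imsetP[a _ ->] yS; rewrite d // => /andP[/eqP -> _].
Qed.

(** A graph with k disjoint pendant embeddings is determined by the injective placement of the k|W|
    vertices of the copies, their k outer ends, and the graph induced on the rest, which lies in [B]
    after relabelling. On the left, a copy meets at most |W| hitc W others, so many disjoint
    families exist. *)
Lemma detach_count V W (X : {set graph V}) (B : gclass) (H : graph W) (r : W) k x :
  gconnected H -> iso_closed B -> 0 < #|V| ->
  (forall G, G \in X -> forall S : 'I_k -> {set V}, (forall i, pendant_app H r G (S i)) ->
     (forall i j, i != j -> [disjoint S i & S j]) ->
     B _ (induced G (~: \bigcup_(i < k) S i))) ->
  (forall G, G \in X -> x <= #|pset H r G|) ->
  #|X| * (x - #|W| * hitc W * k) ^ k <=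
  #|V| ^_ (k * #|W|) * #|V| ^ k * cnt B (#|V| - k * #|W|).
Proof.
move=> gc icB /card_gt0P[v0 _] hB hx.
pose T : finType := ({ffun W -> V} * V)%type.
pose cf (t t' : T) := ~~ [disjoint t.1 @: W & t'.1 @: W].
pose ind G (p : {ffun 'I_k -> T}) := [forall i, pemb H r G (p i)] &&
  [forall i : 'I_k, forall j : 'I_k, (i < j) ==> ~~ cf (p i) (p j)].
apply: leq_trans (@card_pair_ge _ _ X ind _ _) _.
  move=> G GX; apply: indep_tuples (hx _ GX) _ => t pt.
  have fi : injective t.1 by case/pembP: pt.
  rewrite -(card_imset _ fi).
  apply: (@pemb_hit _ _ H r G _ _ (fun t' : T =>
     odflt v0 [pick v in t.1 @: W | v \in t'.1 @: W]) gc) => t' /andP[-> /=].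
  rewrite /cf -setI_eq0 => /set0Pn[v]; rewrite inE => /andP[v1 v2].
  case: pickP => [z /andP[-> ->]//|/(_ v) /=]; by rewrite v1 v2.
pose m := #|V| - k * #|W|.
(* Enumerates the vertices outside the image of [f]. For injective [f] there are exactly m of them,
   so the default [v0] never occurs. *)
pose e (f : {ffun 'I_k * W -> V}) (i : 'I_m) := nth v0 (enum (~: (f @: [set: 'I_k * W]))) i.
pose fl (p : {ffun 'I_k -> T}) : {ffun 'I_k * W -> V} := [ffun q => (p q.1).1 q.2].
pose Y := finset.setX (finset.setX [set f : {ffun 'I_k * W -> V} | injectiveb f]
   [set: {ffun 'I_k -> V}]) (gset B 'I_m).
apply: leq_trans (_ : #|Y| <= _); last first.
  by rewrite !cardsX cardsT card_ffun card_inj_ffuns card_prod !card_ord -cntE.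
have ind_pemb G p i : ind G p -> pemb H r G (p i) by case/andP => /forallP/(_ i).
have ind_dis G p i j : ind G p -> i != j -> [disjoint (p i).1 @: W & (p j).1 @: W].
  move=> /andP[_ /forallP h]; rewrite -val_eqE /= neq_ltn => /orP[] ij.
    by move/forallP/(_ j)/implyP/(_ ij): (h i); rewrite negbK.
  by move/forallP/(_ i)/implyP/(_ ij): (h j); rewrite negbK disjoint_sym.
have flE p q : fl p q = (p q.1).1 q.2 by rewrite ffunE.
have fl_inj G p : ind G p -> injective (fl p).
  move=> ip [i a] [j b]; rewrite !flE /= => E.
  case: (eqVneq i j) => [ij|ne].
    subst j; have /pembP[fi _ _ _] := ind_pemb _ _ i ip.
    by rewrite (fi _ _ E).
  have := ind_dis _ _ _ _ ip ne; rewrite -setI_eq0 => /eqP/setP/(_ ((p i).1 a)).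
  by rewrite !inE imset_f // E imset_f.
have eP (f : {ffun 'I_k * W -> V}) : injective f -> injective (e f) /\ e f @: 'I_m = ~: (f @: [set: 'I_k * W]).
  move=> fi; have sz : size (enum (~: (f @: [set: 'I_k * W]))) = m.
    by rewrite -cardE cardsCs finset.setCK card_imset // cardsT card_prod card_ord.
  split.
    move=> i j /eqP; rewrite nth_uniq ?sz ?enum_uniq //; by move/eqP/val_inj.
  apply/setP => y; rewrite -[RHS]mem_enum; apply/imsetP/idP => [[i _ ->]|yS].
    by rewrite mem_nth // sz.
  have h : index y (enum (~: (f @: [set: 'I_k * W]))) < m by rewrite -sz index_mem.
  by exists (Ordinal h) => //; rewrite /e /= nth_index.
pose g (q : graph V * {ffun 'I_k -> T}) :=
  ((fl q.2, [ffun i => (q.2 i).2]), pull (e (fl q.2)) q.1).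
have imfl p : fl p @: [set: 'I_k * W] = \bigcup_(i < k) (p i).1 @: W.
  apply/setP => y; apply/imsetP/bigcupP => [[[i a] _ ->]|[i _ /imsetP[a _ ->]]].
    by exists i => //; rewrite flE imset_f.
  by exists (i, a) => //; rewrite flE.
apply: (@leq_card_inj _ _ _ _ g).
  move=> [G p] [G' p']; rewrite !inE /= => /andP[_ ip] /andP[_ ip'] E.
  have Ef : fl p = fl p' := congr1 (fun z => z.1.1) E.
  have Ep : p = p'.
    apply/ffunP => i; have := congr1 (fun z : ({ffun 'I_k * W -> V} * {ffun 'I_k -> V}) * graph 'I_m => z.1.2 i) E; rewrite /= !ffunE => E2.
    rewrite [p i]surjective_pairing [p' i]surjective_pairing E2; congr pair.
    by apply/ffunP => a; have := congr1 (fun h : {ffun _ -> _} => h (i, a)) Ef; rewrite !flE.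
  subst p'; have Eg : pull (e (fl p)) G = pull (e (fl p)) G' := congr1 snd E.
  have [ei eim] := eP _ (fl_inj _ _ ip).
  suff EG : G = G' by rewrite EG.
  (* An edge with an end in a detached copy is dictated by [H] or by the outer end of that copy. *)
  have half u v i a : u = (p i).1 a -> edge G u v = edge G' u v.
    move=> ->; have /pembP[_ h1 _ d1] := ind_pemb _ _ i ip.
    have /pembP[_ h2 _ d2] := ind_pemb _ _ i ip'.
    case: (boolP (v \in (p i).1 @: W)) => [/imsetP[b _ ->]|vS]; last by rewrite d1 // d2.
    by rewrite -!edge_pull h1 h2.
  have cov u : (exists i a, u = (p i).1 a) \/ exists i, u = e (fl p) i.
    case: (boolP (u \in fl p @: [set: 'I_k * W])) => [/imsetP[[i a] _ ->]|uS].
      by left; exists i, a; rewrite flE.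
    right; have : u \in e (fl p) @: 'I_m by rewrite eim inE.
    by case/imsetP => i _ ->; exists i.
  apply: graph_ext => u v.
  case: (cov u) => [[i [a E1]]|[i E1]]; first exact: half E1.
  case: (cov v) => [[j [b E2]]|[j E2]]; last by rewrite E1 E2 -!edge_pull Eg.
  by rewrite edge_sym [RHS]edge_sym; exact: half E2.
move=> [G p]; rewrite !inE /= andbT => /andP[GX ip].
have [ei eim] := eP _ (fl_inj _ _ ip).
apply/andP; split; first exact/injectiveP/(fl_inj _ _ ip).
apply/asboolP/(cls_pull_im _ icB ei eim).
rewrite imfl; apply: hB => // [i|i j ij]; last exact: ind_dis ip ij.
exact/pemb_pendant_app/ind_pemb.
Qed.

End AttachDetach.

(** * Bridging and cutting off one component *)

Section Transfer.
Implicit Types (V W U : finType).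

Definition sumg W0 W (F : graph W0) (H : graph W) : graph (W0 + W)%type :=
  mkgraph (fun x y : (W0 + W)%type => match x, y with
    | inl a, inl b => edge F a b
    | inr a, inr b => edge H a b
    | _, _ => false end).

Lemma sumg_ll W0 W (F : graph W0) (H : graph W) a b :
  edge (sumg F H) (inl a) (inl b) = edge F a b.
Proof.
rewrite edge_mkgraph [edge F b a]edge_sym orbb.
by case: eqVneq => [[->]|]; rewrite ?edge_irr // andbT.
Qed.

Lemma sumg_rr W0 W (F : graph W0) (H : graph W) a b :
  edge (sumg F H) (inr a) (inr b) = edge H a b.
Proof.
rewrite edge_mkgraph [edge H b a]edge_sym orbb.
by case: eqVneq => [[->]|]; rewrite ?edge_irr // andbT.
Qed.

Lemma sumg_lr W0 W (F : graph W0) (H : graph W) a b :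
  edge (sumg F H) (inl a) (inr b) = false.
Proof. by rewrite edge_mkgraph. Qed.

Definition ffl W0 W V (f : {ffun W0 + W -> V}) : {ffun W0 -> V} := [ffun a => f (inl a)].
Definition ffr W0 W V (f : {ffun W0 + W -> V}) : {ffun W -> V} := [ffun a => f (inr a)].
Definition ffs W0 W V (f : {ffun W0 -> V}) (g : {ffun W -> V}) : {ffun W0 + W -> V} :=
  [ffun z => match z with inl a => f a | inr b => g b end].

Lemma im_ffs W0 W V (f : {ffun W0 + W -> V}) y :
  (y \in f @: {: W0 + W}) = (y \in ffl f @: W0) || (y \in ffr f @: W).
Proof.
apply/imsetP/orP => [[[a|b] _ ->]|[/imsetP[a _ ->]|/imsetP[b _ ->]]].
- by left; apply/imsetP; exists a; rewrite ?ffunE.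
- by right; apply/imsetP; exists b; rewrite ?ffunE.
- by exists (inl a); rewrite ?ffunE.
- by exists (inr b); rewrite ?ffunE.
Qed.

Lemma cemb_sum W0 W V (F : graph W0) (H : graph W) (G : graph V) f :
  cemb (sumg F H) G f ->
  [/\ cemb F G (ffl f), cemb H G (ffr f) & forall a b, f (inl a) != f (inr b)].
Proof.
case/cembP => fi E /cloP c; split.
- apply/cembP; split; first by move=> a b; rewrite !ffunE => /fi[].
    by apply: graph_ext => a b; rewrite edge_pull !ffunE -(sumg_ll F H) -E edge_pull.
  apply/cloP => x y /imsetP[a _ ->]; rewrite ffunE => e.
  have /imsetP[[b|b] _ Ey] : y \in f @: {: W0 + W} by apply: c e; rewrite imset_f.
    by rewrite Ey; apply/imsetP; exists b; rewrite ?ffunE.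
  by move: e; rewrite Ey -edge_pull E sumg_lr.
- apply/cembP; split; first by move=> a b; rewrite !ffunE => /fi[].
    by apply: graph_ext => a b; rewrite edge_pull !ffunE -(sumg_rr F H) -E edge_pull.
  apply/cloP => x y /imsetP[a _ ->]; rewrite ffunE => e.
  have /imsetP[[b|b] _ Ey] : y \in f @: {: W0 + W} by apply: c e; rewrite imset_f.
    by move: e; rewrite Ey edge_sym -edge_pull E sumg_lr.
  by rewrite Ey; apply/imsetP; exists b; rewrite ?ffunE.
- by move=> a b; apply/eqP => /fi.
Qed.

Definition Dcond (D : gclass) V (G : graph V) (S : {set V}) : bool :=
  `[< forall x, x \notin S -> ~ D _ (induced G (comp G x)) >].

(** The condition makes the embedded copy of [F] exhaust the components in [D]. When the components
    of [F] are themselves in [D], these are the labellings by [F] of the union of all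
    [D]-components. *)
Definition uset (D : gclass) W V (F : graph W) (G : graph V) :=
  [set f : {ffun W -> V} | cemb F G f && Dcond D G (f @: W)].

Lemma comp_addE V (G : graph V) u x y : u != x -> x \notin comp (addE G u x) y ->
  comp (addE G u x) y = comp G y.
Proof.
move=> ux xT; set G' := addE G u x in xT *.
have uT : u \notin comp G' y.
  apply: contra xT => uT; apply: (clo_edge (clo_comp G' y) uT).
  by rewrite edge_addE // !eqxx orbT.
have sub : comp G y \subset comp G' y.
  apply/fintype.subsetP => z; rewrite !inE; apply: conn_mono => a b e.
  by rewrite edge_addE // e.
apply/eqP; rewrite finset.eqEsubset sub andbT; apply: comp_sub; last exact: comp_id.
apply/cloP => a b aC; rewrite edge_addE // => /orP[/orP[e|/andP[/eqP E _]]|/andP[/eqP E _]].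
- exact: clo_edge (clo_comp G y) aC e.
- by move/fintype.subsetP/(_ _ aC): sub; rewrite E (negbTE uT).
- by move/fintype.subsetP/(_ _ aC): sub; rewrite E (negbTE xT).
Qed.

Lemma cls_comp_addE (D : gclass) V (G : graph V) u x y :
  u != x -> x \notin comp (addE G u x) y ->
  D _ (induced (addE G u x) (comp (addE G u x) y)) <-> D _ (induced G (comp G y)).
Proof.
move=> ux xT; have E := comp_addE ux xT.
have h : {in comp G y &, forall a b, edge (addE G u x) a b = edge G a b}.
  rewrite -E => a b aT bT; rewrite edge_addE //.
  have -> : (b == x) = false by apply/eqP => e; move: bT; rewrite e (negbTE xT).
  have -> : (a == x) = false by apply/eqP => e; move: aT; rewrite e (negbTE xT).
  by rewrite andbF !orbF.
by split; apply: cls_induced => //; rewrite ?E // => a b aT bT; rewrite h.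
Qed.

Definition sizes_le (D : gclass) K := forall V (G : graph V), D V G -> #|V| <= K.

Lemma Dsize (D : gclass) K V (G : graph V) (S : {set V}) :
  sizes_le D K -> D _ (induced G S) -> #|S| <= K.
Proof. by move=> h /h; rewrite card_sig. Qed.

(** A bridge from the root of the copy of [H] to an outside vertex x makes the copy pendant, and
    deleting it undoes the move. If the component of x has more than K vertices, the merged
    component is too large for [D] and the others are unchanged, so the embedding of [F] stays
    exhaustive. The remaining choices of x form the [smallset] term. *)
Lemma step_upper (A D : gclass) K V W0 W (F : graph W0) (H : graph W) (r : W) :
  bridge_addable A -> sizes_le D K -> gconnected H ->
  (\sum_(G in gset A V) #|uset D (sumg F H) G|) * (#|V| - #|W0| - #|W|) <=
  \sum_(G in gset A V) (#|uset D F G| * #|pset H r G|) +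
  \sum_(G in gset A V) #|smallset (sumg F H) G K|.
Proof.
move=> ba sD gc; rewrite sum_card_pair.
set X := [set p : graph V * _ | _].
apply: leq_trans (@card_pair_ge _ _ X (fun q x => x \notin q.2 @: {: W0 + W}) _ _) _.
  move=> [G f]; rewrite inE /= => /and3P[_ /cembP[fi _ _] _].
  have -> : [set b | b \notin f @: {: W0 + W}] = ~: (f @: {: W0 + W}).
    by apply/setP => z; rewrite !inE.
  by rewrite cardsCs finset.setCK card_imset // card_sum subnDA.
set L := [set p | _].
pose sm := [set p : (graph V * {ffun W0 + W -> V}) * V | #|comp p.1.1 p.2| <= K].
rewrite -(cardsID sm L) addnC leq_add //; last first.
  rewrite sum_card_pair.
  apply: (@leq_card_inj _ _ _ _ (fun q => (q.1.1, (q.1.2, q.2)))).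
    by move=> [[G f] x] [[G' f'] x'] _ _ [-> -> ->].
  by move=> [[G f] x]; rewrite !inE /= => /andP[/andP[/and3P[-> -> _] ->] ->].
under eq_bigr do rewrite -cardsX.
rewrite sum_card_pair.
pose g (q : (graph V * {ffun W0 + W -> V}) * V) :=
  (addE q.1.1 (q.1.2 (inr r)) q.2, (ffl q.1.2, (ffr q.1.2, q.2))).
have ff f f' : ffl f = ffl f' -> ffr f = ffr f' -> f = f' :> {ffun W0 + W -> V}.
  move=> e e'; apply/ffunP => -[a|b].
    by move/ffunP/(_ a): e; rewrite !ffunE.
  by move/ffunP/(_ b): e'; rewrite !ffunE.
have sep (G : graph V) (f : {ffun W0 + W -> V}) x : cemb (sumg F H) G f ->
    x \notin f @: {: W0 + W} -> ~~ conn G (f (inr r)) x.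
  case/cemb_sum => _ /cembP[_ _ c] _; rewrite im_ffs negb_or => /andP[_]; apply: contra.
  by apply: clo_conn c _; apply/imsetP; exists r; rewrite ?ffunE.
apply: (@leq_card_inj _ _ _ _ g).
  move=> [[G f] x] [[G' f'] x']; rewrite !inE /=.
  move=> /andP[_ /andP[/and3P[_ c _] xS]] /andP[_ /andP[/and3P[_ c' _] xS']] E.
  have E1 := congr1 fst E; have E2 := congr1 (fun z => z.2.1) E.
  have E3 := congr1 (fun z => z.2.2.1) E; have E4 := congr1 (fun z => z.2.2.2) E.
  move: E1 E2 E3 E4 => /= E1 E2 E3 E4; have Ef := ff _ _ E2 E3; subst f' x'.
  have n1 := sep _ _ _ c xS; have n2 := sep _ _ _ c' xS'.
  have ux : f (inr r) != x by apply: contraNneq n1 => ->; exact: connxx.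
  have e1 : ~~ edge G (f (inr r)) x by apply: contra n1; exact: edge_conn.
  have e2 : ~~ edge G' (f (inr r)) x by apply: contra n2; exact: edge_conn.
  suff GG : G = G' by rewrite GG.
  by rewrite -(addEK ux e1) E1 addEK.
move=> [[G f] x]; rewrite [in X in X -> _]inE => /andP[nsm]; rewrite inE /= => /andP[].
rewrite inE /= => /andP[/gsetP AG]; rewrite inE => /andP[c /asboolP Dc] xS.
have big : K < #|comp G x| by move: nsm; rewrite inE /= -ltnNge.
have n1 := sep _ _ _ c xS; set u := f (inr r) in n1.
have ux : u != x by apply: contraNneq n1 => ->; exact: connxx.
have [c0 c1 ne] := cemb_sum c.
have /andP[xS0 xS1] : (x \notin ffl f @: W0) && (x \notin ffr f @: W).
  by rewrite -negb_or -im_ffs.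
have uS0 : u \notin ffl f @: W0.
  by apply/imsetP => -[a _]; rewrite ffunE => e; move: (ne a r); rewrite -e eqxx.
have /cembP[fi1 E1 /cloP cl1] := c1.
have fu a : (ffr f a == u) = (a == r).
  apply/eqP/eqP => [e|->]; last by rewrite ffunE.
  by apply: fi1; rewrite e ffunE.
have fx a : (ffr f a == x) = false.
  by apply/eqP => e; move: xS1; rewrite -e imset_f.
apply/andP; split; first by apply/gsetP; apply: ba.
apply/andP; split; rewrite inE /=.
  rewrite cemb_addE // c0 /=; apply/asboolP => y yS0 Dy.
  case: (boolP (x \in comp (addE G u x) y)) => [xC|xC].
    have := Dsize sD Dy; rewrite leqNgt => /negP; apply.
    apply: leq_trans big _; apply: subset_leq_card.
    rewrite (@comp_eq _ _ y x); last by move: xC; rewrite inE.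
    apply/fintype.subsetP => z; rewrite !inE; apply: conn_mono => a b e.
    by rewrite edge_addE // e.
  have yS1 : y \notin ffr f @: W.
    apply: contra xC => /imsetP[a _ ->]; rewrite inE.
    apply: (@conn_trans _ _ u); last by apply: edge_conn; rewrite edge_addE // !eqxx orbT.
    apply: (@conn_mono _ G); first by move=> a' b' e; rewrite edge_addE // e.
    have -> : u = ffr f r by rewrite ffunE.
    by apply: conn_pull; rewrite E1; case: gc.
  apply: (Dc y); first by rewrite im_ffs negb_or yS0.
  exact/(cls_comp_addE D ux xC).
apply/pembP; split=> //=.
- apply: graph_ext => a b; rewrite edge_pull edge_addE // !fx andbF !orbF.
  by rewrite -edge_pull E1.
- move=> a y yS; rewrite edge_addE // fx fu orbF.
  case: (boolP (edge G _ _)) => //= e.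
  by move: yS; rewrite (cl1 (ffr f a)) ?imset_f.
Qed.

(** The reverse move deletes the bridge of a pendant copy. As the component had more than K + |W|
    vertices, more than K remain after the copy is cut off, so the remainder does not become a
    component in [D]. A root outside the closed image of [f] keeps the whole copy disjoint from
    it. *)
Lemma step_lower0 (A D : gclass) K V W0 W (F : graph W0) (H : graph W) (r : W) :
  bridge_deletable H A -> sizes_le D K -> gconnected H ->
  \sum_(G in gset A V) #|[set q : {ffun W0 -> V} * ({ffun W -> V} * V) |
     [&& q.1 \in uset D F G, q.2 \in pset H r G, q.2.1 r \notin q.1 @: W0 &
         K + #|W| < #|comp G (q.2.1 r)|]]| <=
  (\sum_(G in gset A V) #|uset D (sumg F H) G|) * (#|V| - #|W0| - #|W|).
Proof.
move=> bd sD gc; rewrite [X in X * _]sum_card_pair.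
set X := [set p : graph V * {ffun W0 + W -> V} | _].
apply: leq_trans (@card_pair_le _ _ X (fun q x => x \notin q.2 @: {: W0 + W}) _ _); last first.
  move=> [G f]; rewrite inE /= => /and3P[_ /cembP[fi _ _] _].
  have -> : [set b | b \notin f @: {: W0 + W}] = ~: (f @: {: W0 + W}).
    by apply/setP => z; rewrite !inE.
  by rewrite cardsCs finset.setCK card_imset // card_sum subnDA.
rewrite sum_card_pair.
pose g (q : graph V * ({ffun W0 -> V} * ({ffun W -> V} * V))) :=
  ((delE q.1 (q.2.2.1 r) q.2.2.2, ffs q.2.1 q.2.2.1), q.2.2.2).
have lK f f1 : ffl (@ffs W0 W V f f1) = f by apply/ffunP => a; rewrite !ffunE.
have rK f f1 : ffr (@ffs W0 W V f f1) = f1 by apply/ffunP => a; rewrite !ffunE.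
apply: (@leq_card_inj _ _ _ _ g).
  move=> [G [f t]] [G' [f' t']]; rewrite !inE /=.
  move=> /andP[_ /and4P[_ p _ _]] /andP[_ /and4P[_ p' _ _]] E.
  have E1 := congr1 (fun z => z.1.1) E; have E2 := congr1 (fun z => z.1.2) E.
  have E3 := congr1 snd E; move: E1 E2 E3 => /= E1 E2 E3.
  have ef : f = f' by rewrite -(lK f t.1) E2 lK.
  have et : t = t'.
    by rewrite [t]surjective_pairing [t']surjective_pairing E3 -(rK f t.1) E2 rK.
  subst f' t'; suff GG : G = G' by rewrite GG.
  by rewrite -(delEK (pemb_edge p)) E1 delEK // (pemb_edge p').
move=> [G' [f t]] hq.
have /andP[/gsetP AG' /and4P[fu0 tp uS0 big]] : (G' \in gset A V) &&
    [&& f \in uset D F G', t \in pset H r G', t.1 r \notin f @: W0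
      & K + #|W| < #|comp G' (t.1 r)|] by move: hq; rewrite inE.
have /andP[c0 /asboolP Dc] : cemb F G' f && Dcond D G' (f @: W0) by move: fu0; rewrite inE.
have p : pemb H r G' t by move: tp; rewrite inE.
rewrite /g /=; set u := t.1 r in uS0 big *; set x := t.2; set G := delE G' u x.
have e := pemb_edge p; rewrite -/u -/x in e.
have ux := edge_neq e; have GE : addE G u x = G' by exact: delEK.
have /pembP[fi1 E1 xS1 d1] := p; rewrite -/u -/x in xS1 d1.
have /cembP[fi0 E0 cl0] := c0.
have xS0 : x \notin f @: W0 by rewrite -(cloE cl0 e).
have tS0 a : t.1 a \notin f @: W0.
  apply: contra uS0 => h; apply: clo_conn cl0 h _; exact: pemb_conn gc p.
have tu a : (t.1 a == u) = (a == r) by rewrite (inj_eq fi1).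
have tx a : (t.1 a == x) = false by apply/eqP => h; move: xS1; rewrite -h imset_f.
have fu a : (f a == u) = false by apply/eqP => h; move: uS0; rewrite -h imset_f.
have fx a : (f a == x) = false by apply/eqP => h; move: xS0; rewrite -h imset_f.
have clG1 : clo G (t.1 @: W).
  apply/cloP => _ y /imsetP[a _ ->]; rewrite edge_delE tu tx orbF => /andP[h].
  by apply: contraR => yS; move: h; rewrite d1.
have E1' : pull t.1 G = H.
  apply: graph_ext => a b; rewrite edge_pull edge_delE !tx andbF /= andbT.
  by rewrite -edge_pull E1.
have nc : ~~ conn G u x.
  apply: contra xS1; apply: clo_conn clG1 _; exact: imset_f.
have cu : comp G u = t.1 @: W.
  apply/eqP; rewrite finset.eqEsubset comp_sub ?imset_f //=.
  apply/fintype.subsetP => _ /imsetP[a _ ->]; rewrite inE; apply: conn_pull.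
  by rewrite E1'; case: gc.
have AG : A _ G.
  apply: bd => //; rewrite -/G cu -[H in iso _ H]E1'; apply: iso_sym.
  exact: iso_pull_im.
have c0' : cemb F G f.
  by rewrite -(@cemb_addE _ _ F G f u x) // GE.
have /cembP[_ E0' clG0] := c0'.
have xSf : x \notin ffs f t.1 @: {: W0 + W} by rewrite im_ffs lK rK negb_or xS0.
rewrite inE; apply/andP; split; last exact: xSf.
rewrite inE; apply/andP; split; first exact/gsetP.
apply/andP; split.
  apply/cembP; split.
  - move=> [a|a] [b|b]; rewrite !ffunE.
    + by move/fi0 => ->.
    + by move=> h; move: (tS0 b); rewrite -h imset_f.
    + by move=> h; move: (tS0 a); rewrite h imset_f.
    + by move/fi1 => ->.
  - apply: graph_ext => -[a|a] [b|b]; rewrite edge_pull !ffunE ?sumg_ll ?sumg_rr.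
    + by rewrite -edge_pull E0'.
    + rewrite sumg_lr; apply/negP => h; move: (tS0 b).
      by rewrite -(cloE clG0 h) imset_f.
    + rewrite edge_sym [RHS]edge_sym sumg_lr; apply/negP => h; move: (tS0 a).
      by rewrite -(cloE clG0 h) imset_f.
    + by rewrite -edge_pull E1'.
  - have -> : ffs f t.1 @: {: W0 + W} = f @: W0 :|: t.1 @: W.
      by apply/setP => y; rewrite im_ffs lK rK inE.
    exact: cloU.
apply/asboolP => y; rewrite im_ffs lK rK negb_or => /andP[yS0 yS1] Dy.
have xC' : x \in comp (addE G u x) y -> K < #|comp G y|.
  rewrite GE inE conn_sym => xy.
  have sub : comp G' u \subset t.1 @: W :|: comp G x.
    apply: comp_sub; last by rewrite inE imset_f.
    apply/cloP => a b; rewrite -GE edge_addE // => h.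
    case/orP => [/orP[ab|/andP[_ /eqP ->]]|/andP[_ /eqP ->]].
    - by rewrite -(cloE (cloU clG1 (clo_comp G x)) ab).
    - by rewrite !inE connxx orbT.
    - by rewrite inE imset_f.
  have yx : conn G x y.
    have : y \in comp G' u by rewrite inE; apply: conn_trans xy; exact: edge_conn.
    by move/(fintype.subsetP sub); rewrite inE (negbTE yS1) /= inE.
  rewrite -(comp_eq yx); move: (subset_leq_card sub) => sub'.
  have := leq_trans (leq_trans big sub') (leq_card_setU _ _).
  by rewrite card_imset // addnC -addnS leq_add2l.
case: (boolP (x \in comp (addE G u x) y)) => [/xC'|xC].
  by rewrite ltnNge (Dsize sD Dy).
by apply: (Dc y) => //; rewrite -GE; apply/(cls_comp_addE D ux xC).
Qed.

(** The pairs excluded from the reverse move have the root of the pendant copy either among the |W0|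
    vertices of the image of [F] or in a component of at most K + |W| vertices; each such vertex
    meets at most [hitc W] pendant embeddings. *)
Lemma step_lower (A D : gclass) K V W0 W (F : graph W0) (H : graph W) (r : W) :
  bridge_deletable H A -> sizes_le D K -> gconnected H ->
  \sum_(G in gset A V) (#|uset D F G| * #|pset H r G|) <=
  (\sum_(G in gset A V) #|uset D (sumg F H) G|) * (#|V| - #|W0| - #|W|) +
  ((\sum_(G in gset A V) #|[set f | cemb F G f]|) * (#|W0| * hitc W) +
   (\sum_(G in gset A V) #|smallset F G (K + #|W|)|) * hitc W).
Proof.
move=> bd sD gc; have h0 := @step_lower0 A D K V W0 W F H r bd sD gc.
apply: leq_trans (leq_add h0 (leqnn _)).
rewrite !big_distrl -!big_split /=; apply: leq_sum => G _.
rewrite -cardsX; set Q := finset.setX _ _; set Q1 := [set q | _].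
pose Q2 := [set q : {ffun W0 -> V} * ({ffun W -> V} * V) | (q.1 \in [set f | cemb F G f]) &&
  (pemb H r G q.2 && (q.2.1 r \in q.1 @: W0))].
pose Q3 := [set q : ({ffun W0 -> V} * V) * ({ffun W -> V} * V) |
  (q.1 \in smallset F G (K + #|W|)) && (pemb H r G q.2 && (q.2.1 r == q.1.2))].
have c2 : #|Q2| <= #|[set f | cemb F G f]| * (#|W0| * hitc W).
  apply: (@card_pair_le _ _ _ (fun (f : {ffun W0 -> V}) (t : {ffun W -> V} * V) =>
    pemb H r G t && (t.1 r \in f @: W0))) => f; rewrite inE => /cembP[fi _ _].
  rewrite -(card_imset _ fi).
  apply: (@pemb_hit _ _ H r G _ _ (fun t => t.1 r) gc) => t /andP[-> ->].
  by rewrite imset_f.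
have c3 : #|Q3| <= #|smallset F G (K + #|W|)| * hitc W.
  apply: (@card_pair_le _ _ _ (fun (q : {ffun W0 -> V} * V) (t : {ffun W -> V} * V) =>
    pemb H r G t && (t.1 r == q.2))) => q _; rewrite -[hitc W]mul1n -(cards1 q.2).
  apply: (@pemb_hit _ _ H r G _ _ (fun t => t.1 r) gc) => t /andP[-> /eqP <-].
  by rewrite inE eqxx imset_f.
apply: leq_trans (leq_add (leqnn _) (leq_add c2 c3)).
have sub : Q \subset Q1 :|: (Q2 :|: (Q :&: ~: Q1 :&: ~: Q2)).
  apply/fintype.subsetP => q qQ; rewrite !finset.in_setU !finset.in_setI !finset.in_setC qQ.
  by case: (q \in Q1); case: (q \in Q2).
apply: leq_trans (subset_leq_card sub) _.
apply: leq_trans (leq_card_setU _ _) _; rewrite leq_add2l.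
apply: leq_trans (leq_card_setU _ _) _; rewrite leq_add2l.
apply: (@leq_card_inj _ _ _ _ (fun q : {ffun W0 -> V} * ({ffun W -> V} * V) =>
   ((q.1, q.2.1 r), q.2))).
  by move=> [f t] [f' t'] _ _ [-> _ ->].
move=> [f t]; rewrite !finset.in_setI !finset.in_setC => /andP[/andP[]].
rewrite finset.in_setX => /andP[fu tp]; rewrite inE /= fu tp /=.
have cf : cemb F G f by move: fu; rewrite inE => /andP[].
have pt : pemb H r G t by move: tp; rewrite inE.
rewrite inE /= inE cf pt /= => h1 h2; rewrite inE /= inE /= cf h2 pt eqxx !andbT /=.
by move: h1; rewrite h2 /= -leqNgt.
Qed.

End Transfer.

(** * Growth constants *)

Section Growth.
Variable R : realType.
Local Open Scope ring_scope.
Implicit Types (A B : gclass) (gamma c : R).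

Lemma growth_pow A n : (0 < n)%N ->
  growth_seq R A n ^+ n = (cnt A n)%:R / (n`!)%:R.
Proof.
move=> n0; rewrite /growth_seq -powR_mulrn ?powR_ge0 // -powRrM mulVf ?powRr1 //.
by rewrite pnatr_eq0 -lt0n.
Qed.

Lemma rho_cls_growth A gamma : has_growth_constant A gamma ->
  rho_cls R A = (gamma^-1)%:E.
Proof.
case=> g0 cv; rewrite /rho_cls.
have -> : limn_esup (fun n => (growth_seq R A n)%:E) = gamma%:E.
  have h : ((growth_seq R A n)%:E @[n --> \oo] --> gamma%:E)%classic.
    by apply: cvg_EFin => //; exact: nearW.
  by have [_ ->] := cvg_limn_einf_sup h.
by rewrite eqe gt_eqF.
Qed.

Lemma esup_lt_near (u : nat -> R) c : (limn_esup (fun n => (u n)%:E) < c%:E)%E ->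
  exists N, forall n, (N <= n)%N -> u n < c.
Proof.
move=> /ereal_inf_lt[_ [X [N _ hN] <-] hX]; exists N => n Nn.
rewrite -lte_fin; apply: le_lt_trans hX; apply: ereal_sup_ubound.
by exists n => //; apply: hN.
Qed.

Lemma esup_rho B gamma : 0 < gamma -> rho_cls R B = (gamma^-1)%:E ->
  limn_esup (fun n => (growth_seq R B n)%:E) = gamma%:E.
Proof.
move=> g0; rewrite /rho_cls; set L := limn_esup _.
case: eqP => // _; case: eqP => [_ [/esym/eqP]|].
  by rewrite invr_eq0 gt_eqF.
case: L => [l _ [] /invr_inj ->//|//|_ [] /esym/eqP].
by rewrite /= invr0 invr_eq0 gt_eqF.
Qed.

Lemma cnt_upper B gamma c : 0 < gamma -> rho_cls R B = (gamma^-1)%:E -> gamma < c ->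
  exists N, forall n, (N <= n)%N -> (cnt B n)%:R <= (n`!)%:R * c ^+ n.
Proof.
move=> g0 hB gc; have : (limn_esup (fun n => (growth_seq R B n)%:E) < c%:E)%E.
  by rewrite (esup_rho g0 hB) lte_fin.
case/esup_lt_near => N hN; exists N.+1 => n Nn.
have n0 : (0 < n)%N by lia.
rewrite mulrC -ler_pdivrMr ?ltr0n ?fact_gt0 // -growth_pow //.
rewrite ler_pXn2r ?nnegrE ?powR_ge0 //; last by lra.
by apply/ltW/hN; lia.
Qed.

Lemma cnt_lower A gamma c : has_growth_constant A gamma -> 0 <= c -> c < gamma ->
  exists N, forall n, (N <= n)%N -> (n`!)%:R * c ^+ n <= (cnt A n)%:R.
Proof.
case=> g0 /cvgrPdist_lt cv c0 cg.
have /cv[N _ hN] : 0 < gamma - c by rewrite subr_gt0.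
exists N.+1 => n Nn; have n0 : (0 < n)%N by lia.
rewrite mulrC -ler_pdivlMr ?ltr0n ?fact_gt0 // -growth_pow //.
rewrite ler_pXn2r ?nnegrE ?powR_ge0 //.
have := hN n; rewrite /= => /(_ _); rewrite ltr_norml => /(_ ltac:(lia)) /andP[].
by lra.
Qed.

(** From (1 + x)^D <= 1 + 3^D x on [0, 1], with x so small that 3^D x <= (a - 1) / 2. *)
Lemma pow_near1 (D : nat) (a : R) : 1 < a -> exists2 L : R, 1 < L & L ^+ D < a.
Proof.
move=> a1.
have key (x : R) : 0 <= x -> x <= 1 -> (1 + x) ^+ D <= 1 + (3 ^+ D) * x.
  move=> x0 x1; elim: D => [|D IH]; first by rewrite !expr0; lra.
  rewrite [(1 + x) ^+ _]exprS [3 ^+ _]exprS.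
  have : (1 + x) * (1 + x) ^+ D <= (1 + x) * (1 + 3 ^+ D * x).
    by rewrite ler_wpM2l //; lra.
  have t1 : 1 <= 3 ^+ D :> R by rewrite exprn_ege1 //; lra.
  have h1 : 0 <= 3 ^+ D * (x * (1 - x)) by rewrite mulr_ge0 ?mulr_ge0 //; lra.
  have h2 : 0 <= (3 ^+ D - 1) * x by rewrite mulr_ge0 //; lra.
  by lra.
have p3 : 0 < 3 ^+ D :> R by rewrite exprn_gt0 //; lra.
pose x := Num.min 1 ((a - 1) / (2 * 3 ^+ D)).
have x0 : 0 < x by rewrite lt_min ltr01 /= divr_gt0 //; lra.
have x1 : x <= 1 by rewrite ge_min lexx.
have xa : x <= (a - 1) / (2 * 3 ^+ D) by rewrite ge_min lexx orbT.
exists (1 + x); first by lra.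
apply: le_lt_trans (key x (ltW x0) x1) _.
have : 3 ^+ D * x <= (a - 1) / 2.
  have -> : (a - 1) / 2 = 3 ^+ D * ((a - 1) / (2 * 3 ^+ D)).
    by field; rewrite gt_eqF.
  by rewrite ler_pM2l.
by lra.
Qed.

Lemma nat_le_pow (L : R) : 1 < L -> forall n : nat, n%:R * (L - 1) <= L ^+ n.
Proof.
move=> L1; elim=> [|n IH]; first by rewrite mul0r expr0 ler01.
rewrite exprS -natr1 mulrDl mul1r.
have : 1 <= L ^+ n by rewrite exprn_ege1 // ltW.
nra.
Qed.

(** The bound n <= M^n / (M - 1) is raised to the power s, with M > 1 chosen such that M^s < L. *)
Lemma poly_le_pow (L : R) (s : nat) : 1 < L ->
  exists2 K : R, 0 < K & forall n : nat, n%:R ^+ s <= K * L ^+ n.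
Proof.
move=> L1; have [M M1 Ms] := pow_near1 s L1.
exists ((M - 1)^-1 ^+ s); first by rewrite exprn_gt0 // invr_gt0; lra.
move=> n; have hM : 0 < M - 1 by lra.
have h : n%:R <= (M - 1)^-1 * M ^+ n.
  by rewrite mulrC ler_pdivlMr //; exact: nat_le_pow.
apply: le_trans (_ : ((M - 1)^-1 * M ^+ n) ^+ s <= _).
  by rewrite lerXn2r ?nnegrE // mulr_ge0 ?exprn_ge0 ?invr_ge0 //; lra.
rewrite exprMn; apply: ler_wpM2l; first by rewrite exprn_ge0 // invr_ge0; lra.
rewrite -exprM mulnC exprM; apply: lerXn2r; rewrite ?nnegrE ?exprn_ge0 //; lra.
Qed.

Lemma geom_small (q e : R) : 0 < q -> q < 1 -> 0 < e ->
  exists N, forall k, (N <= k)%N -> q ^+ k <= e.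
Proof.
move=> q0 q1 e0; have := @cvg_geometric _ 1 q.
rewrite ger0_norm ?ltW // => /(_ q1) /cvgrPdist_le /(_ _ e0)[N _ hN].
exists N => k Nk; have := hN k Nk.
by rewrite /geometric /= sub0r normrN mul1r ger0_norm // exprn_ge0 // ltW.
Qed.

(** L is taken so near to 1 that L^((D+1) d) q < 1: over d consecutive values of n, one factor q
    outweighs all factors L. The one extra power L^n absorbs n^s. *)
Lemma geom_decay (q : R) (d D s : nat) : 0 < q -> q < 1 -> (0 < d)%N ->
  exists2 L : R, 1 < L & forall e, 0 < e -> exists N, forall n, (N <= n)%N ->
    n%:R ^+ s * (L ^+ (D * n) * q ^+ (n %/ d)) <= e.
Proof.
move=> q0 q1 d0.
have [L L1 hL] := @pow_near1 (D.+1 * d) q^-1 ltac:(by rewrite invf_gt1).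
exists L => // e e0; have [K K0 hK] := poly_le_pow s L1.
pose th := L ^+ (D.+1 * d) * q.
have L0 : 0 < L by lra.
have Lp m : 0 <= L ^+ m by rewrite exprn_ge0 // ltW.
have qp m : 0 <= q ^+ m by rewrite exprn_ge0 // ltW.
have th1 : th < 1 by rewrite /th -ltr_pdivlMr // mul1r.
have th0 : 0 < th by rewrite mulr_gt0 // exprn_gt0.
have M0 : 0 < K * L ^+ (D.+1 * d) by rewrite mulr_gt0 // exprn_gt0.
have [N hN] := geom_small th0 th1 (divr_gt0 e0 M0).
exists (N * d)%N => n Nn; set k := (n %/ d)%N.
have Nk : (N <= k)%N by rewrite leq_divRL.
have nk : (n <= d * k.+1)%N by rewrite mulnC ltnW // ltn_ceil.
apply: (@le_trans _ _ (K * L ^+ (D.+1 * n) * q ^+ k)).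
  rewrite mulSn exprD !mulrA; apply: ler_wpM2r => //.
  exact: ler_wpM2r.
apply: (@le_trans _ _ (K * L ^+ (D.+1 * (d * k.+1)) * q ^+ k)).
  apply: ler_wpM2r => //; apply: ler_wpM2l; first exact: ltW.
  by apply: ler_weXn2l; [exact: ltW | rewrite leq_mul2l nk].
have -> : K * L ^+ (D.+1 * (d * k.+1)) * q ^+ k = K * L ^+ (D.+1 * d) * th ^+ k.
  rewrite /th exprMn mulnA; move: (D.+1 * d)%N => a.
  by rewrite mulnS exprD exprM !mulrA.
by rewrite mulrC -ler_pdivlMr // hN.
Qed.

Lemma archi_nat (x : R) : exists2 d : nat, (0 < d)%N & x <= d%:R.
Proof.
exists (Num.truncn x).+1 => //; apply/ltW; exact: truncnS_gt.
Qed.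

End Growth.

(** * Concentration of the number of pendant embeddings *)

Section Tails.
Variable R : realType.
Local Open Scope ring_scope.

(** Attaching k = n/d copies bounds the number of bad graphs by n! (gamma L)^(n + kh) (kap -
    eps/2)^k, while |A_n| is at least n! (gamma/L)^n. Since gamma^h kap = 1, the quotient is a power
    of L with exponent O(n) times q^k, where q = gamma^h (kap - eps/2) < 1. *)
Lemma tail_low (A : gclass) (gamma : R) (W : finType) (H : graph W) (r : W)
    (eps : R) (s : nat) :
  has_growth_constant A gamma -> gconnected H -> weakly_attachable R H A ->
  0 < eps -> eps < gamma^-1 ^+ #|W| ->
  forall e : R, 0 < e -> exists N, forall n, (N <= n)%N ->
  n%:R ^+ s * #|[set G in gset A 'I_n |
      (#|pset H r G|)%:R <= (gamma^-1 ^+ #|W| - eps) * n%:R]|%:R <= e * (cnt A n)%:R.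
Proof.
move=> gA gc wa eps0 epsk e e0.
have g0 : 0 < gamma by case: gA.
have [delta [B [d0 icB rB [N0 hB]]]] := wa r.
have {}rB : rho_cls R B = (gamma^-1)%:E by rewrite rB (rho_cls_growth gA).
set h := #|W| in epsk *; set kap := gamma^-1 ^+ h in epsk *.
have gk : gamma ^+ h * kap = 1 by rewrite /kap exprVn mulfV // expf_neq0 // gt_eqF.
have gh0 : 0 < gamma ^+ h by rewrite exprn_gt0.
pose c : R := ((h + 1) * hitc W)%:R.
(* With k = n/d this gives k <= delta n, and the appearances created by the attachments use up at
   most half of the deviation eps n. *)
have [d dpos hd] := archi_nat (delta^-1 + 2 * c / eps).
have c0 : 0 <= c by rewrite ler0n.
have di0 : 0 < delta^-1 by rewrite invr_gt0.
have ce0 : 0 <= 2 * c / eps by apply: divr_ge0; [exact: mulr_ge0 | exact: ltW].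
have dR : 0 < d%:R :> R by rewrite ltr0n.
pose q := 1 - gamma ^+ h * eps / 2.
have ge1 : gamma ^+ h * eps < 1 by rewrite -gk ltr_pM2l.
have ge0 : 0 < gamma ^+ h * eps by rewrite mulr_gt0.
have q0 : 0 < q by rewrite /q; lra.
have q1 : q < 1 by rewrite /q; lra.
(* The exponent h + 2 covers the n + n + kh factors L coming from the upper bound for [B] and the
   lower bound for [A]. *)
have [L L1 hL] := geom_decay (h + 2) s q0 q1 dpos.
have L0 : 0 < L by lra.
have [N1 hN1] := @cnt_upper R B gamma (gamma * L) g0 rB ltac:(by rewrite ltr_pMr).
have [N2 hN2] := @cnt_lower R A gamma (gamma / L) gA
  ltac:(by rewrite divr_ge0 // ltW) ltac:(by rewrite ltr_pdivrMr // ltr_pMr).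
have [N3 hN3] := hL e e0.
exists (N0 + N1 + N2 + N3)%N.+1 => n nN.
have [n0 nN0 nN1 nN2 nN3] : [/\ 0 < n, N0 <= n, N1 <= n, N2 <= n & N3 <= n]%N.
  by clear -nN; split; lia.
have nR : 0 < n%:R :> R by rewrite ltr0n.
set bad := [set G in _ | _]; set a := (cnt A n)%:R.
have a0 : 0 <= a by rewrite ler0n.
case: (posnP #|bad|) => [->|bad0]; first by rewrite mulr0 mulr_ge0 // ltW.
pose k := (n %/ d)%N.
have kn : (k <= n)%N by exact: leq_div.
have kdn : k%:R * d%:R <= n%:R :> R by rewrite -natrM ler_nat leq_trunc_div.
have kd : k%:R <= delta * n%:R.
  have : k%:R * delta^-1 <= n%:R.
    by apply: le_trans kdn; apply: ler_wpM2l; rewrite ?ler0n //; lra.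
  by rewrite -ler_pdivlMr ?invr_gt0 // invrK mulrC.
have kc : k%:R * c <= eps / 2 * n%:R.
  have : k%:R * (2 * c / eps) <= n%:R.
    by apply: le_trans kdn; apply: ler_wpM2l; rewrite ?ler0n //; lra.
  have -> : k%:R * (2 * c / eps) = (k%:R * c) * (2 / eps) by field; rewrite gt_eqF.
  have e2 : 0 < 2 / eps by rewrite divr_gt0 //; lra.
  rewrite -ler_pdivlMr // => /le_trans; apply.
  by rewrite le_eqVlt; apply/orP; left; apply/eqP; field; rewrite gt_eqF.
pose x := (\max_(G in bad) #|pset H r G|)%N.
have hx : x%:R <= (kap - eps) * n%:R.
  have [G0 G0b xE] := @eq_bigmax_cond _ (mem bad) (fun G => #|pset H r G|) bad0.
  have -> : x = #|pset H r G0| by exact: xE.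
  have : G0 \in bad by exact: G0b.
  by rewrite finset.in_set => /andP[].
have badA G : G \in bad -> A _ G.
  by rewrite finset.in_set => /andP[/gsetP].
have key := @attach_count _ W 'I_(n + k * h) bad B H r k x gc icB.
rewrite !card_ord in key.
have {}key := key n0 erefl
  (fun G Gb w => hB n nN0 G (badA G Gb) k w kd)
  (fun G Gb => @leq_bigmax_cond _ (mem bad) (fun G => #|pset H r G|) G Gb).
rewrite -cntE -/h in key.
have hBn := hN1 (n + k * h)%N (leq_trans nN1 (leq_addr _ _)).
have hAn := hN2 n nN2.
set b := #|bad|%:R.
pose X : R := (x + (k * h + k) * hitc W)%:R.
have hX : X <= (kap - eps / 2) * n%:R.
  have -> : X = x%:R + k%:R * c by rewrite /X /c; ring.
  by lra.
have X0 : 0 <= X by rewrite ler0n.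
have ke0 : 0 < kap - eps / 2 by lra.
have F0 : 0 < ((n + k * h)`!)%:R :> R by rewrite ltr0n fact_gt0.
have f0 : 0 < (n`!)%:R :> R by rewrite ltr0n fact_gt0.
have b0 : 0 <= b by rewrite ler0n.
have s1 : b <= (n`!)%:R * ((gamma * L) ^+ (n + k * h) * (kap - eps / 2) ^+ k).
  have nk0 : 0 < n%:R ^+ k :> R by rewrite exprn_gt0.
  rewrite -(ler_pM2r (mulr_gt0 nk0 F0)).
  have : b * (n%:R ^+ k * ((n + k * h)`!)%:R) <=
         (cnt B (n + k * h))%:R * X ^+ k * (n`!)%:R.
    by rewrite mulrA -!natrX -!natrM ler_nat.
  move/le_trans; apply.
  have -> : (n`!)%:R * ((gamma * L) ^+ (n + k * h) * (kap - eps / 2) ^+ k) *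
      (n%:R ^+ k * ((n + k * h)`!)%:R) =
      (((n + k * h)`!)%:R * (gamma * L) ^+ (n + k * h)) *
      ((kap - eps / 2) * n%:R) ^+ k * (n`!)%:R.
    have gen (f1 g1 k1 n1 F1 : R) :
      f1 * (g1 * k1) * (n1 * F1) = F1 * g1 * (k1 * n1) * f1 by ring.
    by rewrite [((kap - eps / 2) * n%:R) ^+ k]exprMn gen.
  apply: ler_wpM2r; first exact: ltW.
  by apply: ler_pM; rewrite ?ler0n ?exprn_ge0 //; apply: lerXn2r; rewrite ?nnegrE //;
     apply: le_trans hX.
have gn0 : 0 < gamma ^+ n by rewrite exprn_gt0.
have Ln0 m : 0 < L ^+ m by rewrite exprn_gt0.
have s2 : b <= a * (L ^+ ((h + 2) * n) * q ^+ k).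
  apply: (@le_trans _ _ (a * (L ^+ (n + n + k * h) * q ^+ k))); last first.
    apply: ler_wpM2l => //; apply: ler_wpM2r; first by rewrite exprn_ge0 // ltW.
    apply: ler_weXn2l; [exact: ltW|].
    by rewrite mulnDl mul2n addnC -addnn leq_add2r mulnC leq_mul2l kn orbT.
  rewrite -(ler_pM2r (divr_gt0 gn0 (Ln0 n))) -expr_div_n.
  apply: (@le_trans _ _ (((n`!)%:R * (gamma / L) ^+ n) *
      ((gamma * L) ^+ (n + k * h) * (kap - eps / 2) ^+ k))).
    rewrite [X in _ <= X]mulrAC; apply: ler_wpM2r => //.
    by rewrite exprn_ge0 // divr_ge0 // ltW.
  apply: (@le_trans _ _ (a * ((gamma * L) ^+ (n + k * h) * (kap - eps / 2) ^+ k))).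
    by apply: ler_wpM2r hAn; apply: mulr_ge0; apply: exprn_ge0; apply: ltW => //;
       exact: mulr_gt0.
  rewrite -mulrA; apply: ler_wpM2l => //; rewrite le_eqVlt; apply/orP; left; apply/eqP.
  have -> : q = gamma ^+ h * (kap - eps / 2) by rewrite mulrBr gk /q; ring.
  rewrite !exprMn exprVn !exprD -!exprM [(h * k)%N]mulnC.
  have gen (g1 l1 g2 l2 k1 l1' : R) : l1 * l1' = 1 ->
    g1 * g2 * (l1 * l2) * k1 = l1 * l1 * l2 * (g2 * k1) * (g1 * l1').
    move=> h1; have -> : l1 * l1 * l2 * (g2 * k1) * (g1 * l1') =
      (l1 * l1') * (g1 * g2 * (l1 * l2) * k1) by ring.
    by rewrite h1 mul1r.
  by apply: gen; rewrite divff // gt_eqF.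
apply: (@le_trans _ _ (n%:R ^+ s * (a * (L ^+ ((h + 2) * n) * q ^+ k)))).
  by apply: ler_wpM2l => //; rewrite exprn_ge0 // ltW.
by rewrite mulrCA mulrC; apply: ler_wpM2r => //; apply: hN3.
Qed.

(** Here detaching yields |bad| (kap + eps/2)^k <= n! (gamma L)^(n - kh), so that each detached copy
    gains the factor q = 1 / (gamma^h (kap + eps/2)) < 1. *)
Lemma tail_up (A : gclass) (gamma : R) (W : finType) (H : graph W) (r : W)
    (eps : R) (s : nat) :
  has_growth_constant A gamma -> gconnected H -> weakly_detachable R H A ->
  0 < eps ->
  forall e : R, 0 < e -> exists N, forall n, (N <= n)%N ->
  n%:R ^+ s * #|[set G in gset A 'I_n |
      (gamma^-1 ^+ #|W| + eps) * n%:R <= (#|pset H r G|)%:R]|%:R <= e * (cnt A n)%:R.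
Proof.
move=> gA gc wd eps0 e e0.
have g0 : 0 < gamma by case: gA.
have [delta [B [d0 icB rB [N0 hB]]]] := wd r.
have {}rB : rho_cls R B = (gamma^-1)%:E by rewrite rB (rho_cls_growth gA).
set h := #|W|; set kap := gamma^-1 ^+ h.
have gk : gamma ^+ h * kap = 1 by rewrite /kap exprVn mulfV // expf_neq0 // gt_eqF.
have gh0 : 0 < gamma ^+ h by rewrite exprn_gt0.
have kap0 : 0 < kap by rewrite exprn_gt0 // invr_gt0.
pose c : R := (h * hitc W)%:R.
(* A quarter of eps pays for conflicts between copies, and another quarter for the rounding in
   [x]. *)
have [d1 _ hd] := archi_nat (delta^-1 + 4 * c / eps).
(* The summand 2h leaves at least half of the vertices after detaching, so n - kh is large enough
   for the growth bound on [B]. *)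
pose d := (d1 + 2 * h)%N.+1.
have dpos : (0 < d)%N by [].
have c0 : 0 <= c by rewrite ler0n.
have di0 : 0 < delta^-1 by rewrite invr_gt0.
have ce0 : 0 <= 4 * c / eps by apply: divr_ge0; [exact: mulr_ge0 | exact: ltW].
have dR : d1%:R <= d%:R :> R by rewrite ler_nat /d; clear; lia.
pose q := (1 + gamma ^+ h * eps / 2)^-1.
have ge0 : 0 < gamma ^+ h * eps by rewrite mulr_gt0.
have qi0 : 0 < 1 + gamma ^+ h * eps / 2 by lra.
have q0 : 0 < q by rewrite invr_gt0.
have q1 : q < 1 by rewrite invf_lt1 //; lra.
have [L L1 hL] := geom_decay 2 s q0 q1 dpos.
have L0 : 0 < L by lra.
have [N1 hN1] := @cnt_upper R B gamma (gamma * L) g0 rB ltac:(by rewrite ltr_pMr).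
have [N2 hN2] := @cnt_lower R A gamma (gamma / L) gA
  ltac:(by rewrite divr_ge0 // ltW) ltac:(by rewrite ltr_pdivrMr // ltr_pMr).
have [N3 hN3] := hL e e0.
have [N4 _ hN4] := archi_nat (4 / eps).
exists (N0 + 2 * N1 + N2 + N3 + N4)%N.+1 => n nN.
have [[n0 nN0 nN1] [nN2 nN3 nN4]] : [/\ 0 < n, N0 <= n & 2 * N1 <= n]%N /\
    [/\ N2 <= n, N3 <= n & N4 <= n]%N by clear -nN; split; split; lia.
have nR : 0 < n%:R :> R by rewrite ltr0n.
set bad := [set G in _ | _]; set a := (cnt A n)%:R.
have a0 : 0 <= a by rewrite ler0n.
pose k := (n %/ d)%N.
have kn : (k <= n)%N by exact: leq_div.
have kdn' : (k * d <= n)%N by exact: leq_trunc_div.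
have khn : (2 * (k * h) <= n)%N.
  apply: leq_trans kdn'; rewrite mulnCA leq_mul2l /d; apply/orP; right; clear; lia.
have kdn : k%:R * d%:R <= n%:R :> R by rewrite -natrM ler_nat.
have kd : k%:R <= delta * n%:R.
  have : k%:R * delta^-1 <= n%:R.
    by apply: le_trans kdn; apply: ler_wpM2l; rewrite ?ler0n //; lra.
  by rewrite -ler_pdivlMr ?invr_gt0 // invrK mulrC.
have kc : k%:R * c <= eps / 4 * n%:R.
  have : k%:R * (4 * c / eps) <= n%:R.
    by apply: le_trans kdn; apply: ler_wpM2l; rewrite ?ler0n //; lra.
  have -> : k%:R * (4 * c / eps) = (k%:R * c) * (4 / eps) by field; rewrite gt_eqF.
  have e2 : 0 < 4 / eps by rewrite divr_gt0 //; lra.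
  rewrite -ler_pdivlMr // => /le_trans; apply.
  by rewrite le_eqVlt; apply/orP; left; apply/eqP; field; rewrite gt_eqF.
have n4 : 1 <= eps / 4 * n%:R.
  have : 4 / eps <= n%:R by apply: le_trans hN4 _; rewrite ler_nat.
  rewrite ler_pdivrMr // => ?; lra.
pose x := Num.truncn ((kap + eps) * n%:R).
have hx : (kap + eps) * n%:R - 1 <= x%:R.
  by have := truncnS_gt ((kap + eps) * n%:R); rewrite -/x -natr1; lra.
have xle G : G \in bad -> (x <= #|pset H r G|)%N.
  rewrite finset.in_set => /andP[_ hG]; rewrite -(ler_nat R); apply: le_trans hG.
  rewrite /x truncn_le // mulr_ge0 ?ler0n //; lra.
have badA G : G \in bad -> A _ G.
  by rewrite finset.in_set => /andP[/gsetP].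
have key := @detach_count _ W bad B H r k x gc icB.
rewrite !card_ord in key.
have {}key := key n0 (fun G Gb S => hB n nN0 G (badA G Gb) k S kd) xle.
rewrite -/h in key.
have hBn := hN1 (n - k * h)%N ltac:(clear -khn nN1; lia).
have hAn := hN2 n nN2.
set b := #|bad|%:R.
pose Y := (x - h * hitc W * k)%N.
have hY : (kap + eps / 2) * n%:R <= Y%:R.
  have : x%:R <= Y%:R + k%:R * c.
    by rewrite /c -natrM -natrD ler_nat /Y mulnC addnC -leq_subLR.
  by lra.
have ke0 : 0 < kap + eps / 2 by lra.
have F0 : 0 < ((n - k * h)`!)%:R :> R by rewrite ltr0n fact_gt0.
have f0 : 0 < (n`!)%:R :> R by rewrite ltr0n fact_gt0.
have b0 : 0 <= b by rewrite ler0n.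
have s1 : b * (kap + eps / 2) ^+ k <= (n`!)%:R * (gamma * L) ^+ (n - k * h).
  have nk0 : 0 < n%:R ^+ k :> R by rewrite exprn_gt0.
  rewrite -(ler_pM2r nk0) -mulrA -exprMn.
  apply: (@le_trans _ _ (b * Y%:R ^+ k)).
    apply: ler_wpM2l => //; apply: lerXn2r => //; rewrite nnegrE ?ler0n //.
    by rewrite mulr_ge0 ?ler0n // ltW.
  apply: (@le_trans _ _ ((n ^_ (k * h))%:R * n%:R ^+ k * (cnt B (n - k * h))%:R)).
    by rewrite -!natrX -!natrM ler_nat.
  have ff : (n ^_ (k * h))%:R * ((n - k * h)`!)%:R = (n`!)%:R :> R.
    by rewrite -natrM ffact_fact //; clear -khn; lia.
  have gen (p f1 g1 n1 : R) : p * f1 * g1 * n1 = p * n1 * (f1 * g1) by ring.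
  rewrite -ff gen; apply: ler_wpM2l; last exact: hBn.
  by rewrite mulr_ge0.
have gn0 : 0 < gamma ^+ n by rewrite exprn_gt0.
have Ln0 m : 0 < L ^+ m by rewrite exprn_gt0.
have s2 : b <= a * (L ^+ (2 * n) * q ^+ k).
  apply: (@le_trans _ _ (a * (L ^+ (n + (n - k * h)) * q ^+ k))); last first.
    apply: ler_wpM2l => //; apply: ler_wpM2r; first by rewrite exprn_ge0 // ltW.
    apply: ler_weXn2l; [exact: ltW|clear; lia].
  have kek : 0 < (kap + eps / 2) ^+ k by rewrite exprn_gt0.
  rewrite -(ler_pM2r kek) -(ler_pM2r (divr_gt0 gn0 (Ln0 n))) -expr_div_n.
  apply: (@le_trans _ _ (((n`!)%:R * (gamma / L) ^+ n) * (gamma * L) ^+ (n - k * h))).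
    rewrite [X in _ <= X]mulrAC; apply: ler_wpM2r => //.
    by rewrite exprn_ge0 // divr_ge0 // ltW.
  apply: (@le_trans _ _ (a * (gamma * L) ^+ (n - k * h))).
    by apply: ler_wpM2r hAn; rewrite exprn_ge0 // mulr_ge0 // ltW.
  rewrite -!mulrA; apply: ler_wpM2l => //; rewrite le_eqVlt; apply/orP; left; apply/eqP.
  have qk : q * (gamma ^+ h * (kap + eps / 2)) = 1.
    by rewrite mulrDr gk mulrA /q mulVf // gt_eqF.
  have qk' : q ^+ k * ((kap + eps / 2) ^+ k * gamma ^+ (k * h)) = 1.
    by rewrite mulnC exprM -!exprMn [_ * gamma ^+ h]mulrC qk expr1n.
  have gs : gamma ^+ n = gamma ^+ (n - k * h) * gamma ^+ (k * h).
    by rewrite -exprD subnK //; clear -khn; lia.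
  rewrite expr_div_n gs exprD exprMn.
  have gen (l1 l2 qq k1 gg g2 l3 : R) :
     l1 * l2 * (qq * (k1 * (gg * g2 * l3))) = (qq * (k1 * g2)) * (l2 * gg) * (l1 * l3).
    by ring.
  by rewrite gen qk' divff ?gt_eqF // mul1r mulr1 mulrC.
apply: (@le_trans _ _ (n%:R ^+ s * (a * (L ^+ (2 * n) * q ^+ k)))).
  by apply: ler_wpM2l => //; rewrite exprn_ge0 // ltW.
by rewrite mulrCA mulrC; apply: ler_wpM2r => //; apply: hN3.
Qed.

End Tails.

(** * Asymptotic number of component embeddings *)

Section USets.
Implicit Types (V W U : finType).

Lemma uset_iso_le (D : gclass) W W' V (F : graph W) (F' : graph W') (G : graph V) :
  iso F F' -> #|uset D F' G| <= #|uset D F G|.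
Proof.
case=> f [bf e]; have EF : F = pull f F' by apply: graph_ext => a b; rewrite edge_pull e.
have [g fg gf] := bf.
pose m (p : {ffun W' -> V}) : {ffun W -> V} := [ffun a => p (f a)].
have im p : m p @: W = p @: W'.
  apply/setP => y; apply/imsetP/imsetP => -[a _ ->].
    by exists (f a) => //; rewrite ffunE.
  by exists (g a) => //; rewrite ffunE gf.
apply: (@leq_card_inj _ _ _ _ m) => [p p' _ _ E|p].
  by apply/ffunP => a; move/ffunP/(_ (g a)): E; rewrite !ffunE gf.
rewrite !finset.in_set im => /andP[/cembP[pi E c] ->]; rewrite andbT.
apply/cembP; split; last by rewrite im.
  by move=> a b; rewrite !ffunE => /pi /(can_inj fg).
by rewrite EF -E pull_comp; apply: eq_pull => a; rewrite ffunE.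
Qed.

Lemma uset_iso (D : gclass) W W' V (F : graph W) (F' : graph W') (G : graph V) :
  iso F F' -> #|uset D F G| = #|uset D F' G|.
Proof.
by move=> i; apply/eqP; rewrite eqn_leq !uset_iso_le //; exact: iso_sym.
Qed.

Lemma sumg_induced_iso W (F : graph W) (S : {set W}) : clo F S ->
  iso (sumg (induced F (~: S)) (induced F S)) F.
Proof.
move=> c; pose f (z : {x | x \in ~: S} + {x | x \in S}) :=
  match z with inl x => val x | inr x => val x end.
exists f; split.
  apply: inj_card_bij; last by rewrite card_sum !card_sig addnC cardsC.
  move=> [x|x] [y|y] /= E; first by rewrite (val_inj E).
  - by case: x y E => [x xS] [y yS] /= E; exfalso; move: (xS); rewrite E inE yS.
  - by case: x y E => [x xS] [y yS] /= E; exfalso; move: (yS); rewrite -E inE xS.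
  - by rewrite (val_inj E).
have cr x y : x \in ~: S -> y \in S -> edge F x y = false.
  rewrite inE => xS yS; apply/negP => e; move: xS.
  by rewrite (cloE c e) yS.
move=> [x|x] [y|y] /=; rewrite ?sumg_ll ?sumg_rr ?sumg_lr ?inducedE ?edge_pull //.
- by rewrite cr //; exact: valP.
- by rewrite edge_sym [RHS]edge_sym sumg_lr cr //; exact: valP.
Qed.

Lemma uset_sub (D : gclass) W V (F : graph W) (G : graph V) :
  #|uset D F G| <= #|[set f | cemb F G f]|.
Proof.
by apply: subset_leq_card; apply/fintype.subsetP => f; rewrite !finset.in_set => /andP[].
Qed.

Lemma uset_le (D : gclass) W V (F : graph W) (G : graph V) :
  #|uset D F G| <= #|V| ^ #|W|.
Proof. by rewrite -card_ffun; apply: max_card. Qed.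

(** With the empty class [uset] imposes no exhaustion condition, so statements about all embeddings
    are instances of those about [uset]. *)
Definition D0 : gclass := fun _ _ => False.

Lemma uset0 W V (F : graph W) (G : graph V) : uset D0 F G = [set f | cemb F G f].
Proof.
apply/setP => f; rewrite !finset.in_set; apply: andb_idr => _.
by apply/asboolP => x _ [].
Qed.

Lemma smallset0 W V (F : graph W) (G : graph V) : smallset F G 0 = finset.set0.
Proof.
apply/setP => t; rewrite !finset.in_set leqn0 cards_eq0; apply/negP => /and3P[_ _ /eqP E].
by have := comp_id G t.2; rewrite E inE.
Qed.

Lemma uset_void (D : gclass) W V (F : graph W) (G : graph V) : #|W| = 0 ->
  #|uset D F G| = Dcond D G finset.set0.
Proof.
move=> W0; have emp (x : W) : False by have := fintype0 x; rewrite W0 => /(_ erefl).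
have im (f : {ffun W -> V}) : f @: W = finset.set0.
  by apply/setP => y; rewrite inE; apply/imsetP => -[a]; case: (emp a).
have cf f : cemb F G f.
  apply/cembP; split; first by move=> a; case: (emp a).
    by apply: graph_ext => a; case: (emp a).
  by rewrite im; apply/cloP => x y; rewrite inE.
case: (boolP (Dcond _ _ _)) => Dc.
  rewrite (_ : uset D F G = [set: {ffun W -> V}]) ?cardsT ?card_ffun ?W0 //.
  by apply/setP => f; rewrite !finset.in_set cf im Dc.
apply/eqP; rewrite cards_eq0; apply/eqP/setP => f.
by rewrite !finset.in_set cf im (negbTE Dc).
Qed.
End USets.

(** * Limits of the embedding counts *)

Section Asymptotics.
Variable R : realType.
Local Open Scope ring_scope.
Variables (A C : gclass) (gamma : R).
Hypotheses (ba : bridge_addable A) (gA : has_growth_constant A gamma).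
Hypothesis icC : iso_closed C.
Hypothesis hC : forall (V : finType) (H : graph V), @C V H ->
     [/\ gconnected H, bridge_deletable H A,
         weakly_attachable R H A & weakly_detachable R H A].

Let a n : R := (cnt A n)%:R.
Let rho := gamma^-1.

Definition Usum D (W : finType) (F : graph W) n : nat :=
  (\sum_(G in gset A 'I_n) #|uset D F G|)%N.
Definition Esum (W : finType) (F : graph W) n : nat :=
  (\sum_(G in gset A 'I_n) #|[set f | cemb F G f]|)%N.
Definition Ssum (W : finType) (F : graph W) m n : nat :=
  (\sum_(G in gset A 'I_n) #|smallset F G m|)%N.

Lemma Usum_le D (W : finType) (F : graph W) n : (Usum D F n <= Esum F n)%N.
Proof. by apply: leq_sum => G _; exact: uset_sub. Qed.

Lemma Usum_iso D (W W' : finType) (F : graph W) (F' : graph W') n : iso F F' ->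
  Usum D F n = Usum D F' n.
Proof. by move=> i; apply: eq_bigr => G _; exact: uset_iso. Qed.

Lemma Esum_D0 (W : finType) (F : graph W) n : Esum F n = Usum D0 F n.
Proof. by apply: eq_bigr => G _; rewrite uset0. Qed.

(** The quotient 2n / (n - |W| - m) is at most 4 once n > 2 (|W| + m). *)
Lemma Ssum_le (W : finType) (F : graph W) m n : (2 * (#|W| + m) < n)%N ->
  (Ssum F m n <= 4 * Esum F n)%N.
Proof.
move=> hn; have := @small_components A W 'I_n F m ba; rewrite card_ord -/(Ssum F m n).
rewrite -/(Esum F n); set S := Ssum F m n; set E := Esum F n => h.
have h2 : (S * n <= 2 * (S * (n - #|W| - m)))%N.
  by rewrite mulnCA leq_mul2l; apply/orP; right; clear -hn; lia.
have h3 : (S * n <= 4 * E * n)%N.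
  apply: leq_trans h2 _; rewrite (_ : 4 * E * n = 2 * (E * (2 * n)))%N ?leq_mul2l //.
  by clear; lia.
by move: h3; rewrite leq_mul2r; clear -hn; lia.
Qed.

(** [step_upper] for the empty class with K = 0 has no small-component term, and the crude linear
    bound on pendant embeddings is enough for boundedness. *)
Lemma Esum_step (W0 W : finType) (F : graph W0) (H : graph W) n :
  gconnected H -> (2 * (#|W0| + #|W|) < n)%N ->
  (Esum (sumg F H) n <= 2 * hitc W * Esum F n)%N.
Proof.
move=> gc hn; have [/card_gt0P[r _] _] := gc.
have sD : sizes_le D0 0 by [].
have := @step_upper A D0 0 'I_n W0 W F H r ba sD gc.
rewrite card_ord -/(Usum D0 (sumg F H) n) -Esum_D0.
rewrite [X in (_ <= _ + X)%N]big1 ?addn0; last by move=> G _; rewrite smallset0 cards0.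
set E := Esum (sumg F H) n => h.
have h1 : (E * (n - #|W0| - #|W|) <= Esum F n * (n * hitc W))%N.
  apply: leq_trans h _; rewrite Esum_D0 big_distrl; apply: leq_sum => G _ /=.
  by rewrite leq_mul2l; apply/orP; right; have := card_pset r G gc; rewrite card_ord.
have h2 : (E * n <= 2 * (E * (n - #|W0| - #|W|)))%N.
  by rewrite mulnCA leq_mul2l; apply/orP; right; clear -hn; lia.
have h3 : (E * n <= 2 * hitc W * Esum F n * n)%N.
  apply: leq_trans h2 _.
  rewrite (_ : 2 * hitc W * Esum F n * n = 2 * (Esum F n * (n * hitc W)))%N ?leq_mul2l //.
  by clear; lia.
by move: h3; rewrite leq_mul2r; clear -hn; lia.
Qed.

Definition devi (W : finType) (H : graph W) (r : W) n (G : graph 'I_n) : R :=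
  `|(#|pset H r G|)%:R - rho ^+ #|W| * n%:R|.

Lemma rho_gt0 : 0 < rho.
Proof. by rewrite invr_gt0; case: gA. Qed.

(** Where the deviation is at most eps n, the average bound M on [f] applies. Elsewhere only [f] <=
    n^s is available, and the two tails are small even after multiplication by n^s. *)
Lemma pset_L1 (W : finType) (H : graph W) (r : W) (f : forall n, graph 'I_n -> nat)
    (s : nat) (M : R) : @C W H -> 0 <= M ->
  (forall n G, (f n G <= n ^ s)%N) ->
  (exists N, forall n, (N <= n)%N ->
     (\sum_(G in gset A 'I_n) f n G)%:R <= M * a n) ->
  forall e, 0 < e -> exists N, forall n, (N <= n)%N ->
  \sum_(G in gset A 'I_n) (f n G)%:R * devi H r G <= e * n%:R * a n.
Proof.
move=> CH M0 fs [N0 hN0] e e0; have [gc _ wa wd] := hC CH.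
set kap := rho ^+ #|W|; have kap0 : 0 < kap by rewrite exprn_gt0 // rho_gt0.
(* The first term keeps eps below kap, as the lower tail requires; the second gives eps M <= e/2. *)
pose eps := Num.min (kap / 2) (e / (2 * (M + 1))).
have eps0 : 0 < eps.
  rewrite lt_min; apply/andP; split; first by lra.
  by apply: divr_gt0 => //; lra.
have epsk : eps < kap.
  by apply: le_lt_trans (_ : kap / 2 < _); [rewrite ge_min lexx|lra].
have epsM : eps * M <= e / 2.
  apply: (@le_trans _ _ (e / (2 * (M + 1)) * (M + 1))).
    apply: ler_pM => //; [exact: ltW| |lra].
    by rewrite ge_min lexx orbT.
  by rewrite le_eqVlt; apply/orP; left; apply/eqP; field; rewrite gt_eqF //; lra.
pose c : R := (hitc W)%:R + kap.
have c0 : 0 < c by rewrite ltr_wpDl ?ler0n.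
pose e1 := e / (4 * c); have e10 : 0 < e1 by apply: divr_gt0 => //; lra.
have [N1 hN1] := @tail_low R A gamma W H r eps s gA gc wa eps0 epsk e1 e10.
have [N2 hN2] := @tail_up R A gamma W H r eps s gA gc wd eps0 e1 e10.
exists (N0 + N1 + N2)%N => n nN.
have [n0 n1 n2] : [/\ N0 <= n, N1 <= n & N2 <= n]%N by clear -nN; split; lia.
move: (hN1 n n1) (hN2 n n2) (hN0 n n0) => {hN0 hN1 hN2}.
set B1 := [set G in _ | _]; set B2 := [set G in _ | _] => h1 h2 h0.
have nR : 0 <= n%:R :> R by rewrite ler0n.
have dev_le (G : graph 'I_n) : devi H r G <= c * n%:R.
  have p1 : (#|pset H r G|)%:R <= (hitc W)%:R * n%:R :> R.
    by rewrite -natrM ler_nat mulnC; have := card_pset r G gc; rewrite card_ord.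
  have p0 : 0 <= (#|pset H r G|)%:R :> R by rewrite ler0n.
  have kn : 0 <= kap * n%:R by rewrite mulr_ge0 // ltW.
  by rewrite /devi -/kap ler_norml /c; apply/andP; split; lra.
have dev0 (G : graph 'I_n) : 0 <= devi H r G by exact: normr_ge0.
have point (G : graph 'I_n) : G \in gset A 'I_n ->
   (f n G)%:R * devi H r G <= (f n G)%:R * (eps * n%:R) +
     n%:R ^+ s * (c * n%:R) * ((G \in B1)%:R + (G \in B2)%:R).
  move=> GA; have fn0 : 0 <= (f n G)%:R :> R by rewrite ler0n.
  have cn0 : 0 <= c * n%:R by rewrite mulr_ge0 // ltW.
  have [dl|dg] := leP (devi H r G) (eps * n%:R).
    rewrite -[X in X <= _]addr0; apply: lerD; first exact: ler_wpM2l.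
    apply: mulr_ge0; last by apply: addr_ge0; exact: ler0n.
    by apply: mulr_ge0 => //; exact: exprn_ge0.
  have hB : 1 <= (G \in B1)%:R + (G \in B2)%:R :> R.
    have -> : (G \in B1) = ((#|pset H r G|)%:R <= (kap - eps) * n%:R).
      by rewrite finset.in_set GA.
    have -> : (G \in B2) = ((kap + eps) * n%:R <= (#|pset H r G|)%:R).
      by rewrite finset.in_set GA.
    move: dg; rewrite /devi -/kap ltNge ler_norml negb_and -!ltNge => /orP[] h.
      have -> : (#|pset H r G|)%:R <= (kap - eps) * n%:R by lra.
      by rewrite lerDl ler0n.
    have -> : (kap + eps) * n%:R <= (#|pset H r G|)%:R by lra.
    by rewrite lerDr ler0n.
  rewrite -[X in X <= _]add0r; apply: lerD.
    by rewrite mulr_ge0 // mulr_ge0 // ltW.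
  apply: (@le_trans _ _ (n%:R ^+ s * (c * n%:R) * 1)).
    rewrite mulr1; apply: ler_pM => //.
    by rewrite -natrX ler_nat.
  by apply: ler_wpM2l hB; rewrite mulr_ge0 // exprn_ge0.
apply: le_trans (ler_sum _ point) _.
rewrite big_split /= -mulr_suml -mulr_sumr big_split /=.
have cardB (B : {set graph 'I_n}) : B \subset gset A 'I_n ->
    \sum_(G in gset A 'I_n) (G \in B)%:R = #|B|%:R :> R.
  move=> sB; rewrite -natr_sum; congr _%:R; rewrite -sum1_card big_mkcond /=.
  rewrite [RHS]big_mkcond; apply: eq_bigr => G _.
  case: (boolP (G \in B)) => [/(fintype.subsetP sB) ->//|_]; by case: ifP.
rewrite !cardB; last 2 first.
- by apply/fintype.subsetP => G; rewrite finset.in_set => /andP[].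
- by apply/fintype.subsetP => G; rewrite finset.in_set => /andP[].
rewrite -natr_sum; set F := (\sum_(G in _) _)%:R in h0 *.
have t1 : F * (eps * n%:R) <= e / 2 * n%:R * a n.
  apply: (@le_trans _ _ (M * a n * (eps * n%:R))).
    by apply: ler_wpM2r h0; rewrite mulr_ge0 // ltW.
  have -> : M * a n * (eps * n%:R) = eps * M * (n%:R * a n) by ring.
  rewrite -[X in _ <= X]mulrA; apply: ler_wpM2r => //.
  exact: mulr_ge0.
have t2 : n%:R ^+ s * (c * n%:R) * (#|B1|%:R + #|B2|%:R) <= e / 2 * n%:R * a n.
  have -> : n%:R ^+ s * (c * n%:R) * (#|B1|%:R + #|B2|%:R) =
    (c * n%:R) * (n%:R ^+ s * #|B1|%:R + n%:R ^+ s * #|B2|%:R) by ring.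
  apply: (@le_trans _ _ (c * n%:R * (e1 * a n + e1 * a n))).
    by apply: ler_wpM2l; [rewrite mulr_ge0 // ltW | exact: lerD].
  rewrite le_eqVlt; apply/orP; left; apply/eqP; rewrite /e1; field.
  by rewrite gt_eqF.
have -> : e * n%:R * a n = e / 2 * n%:R * a n + e / 2 * n%:R * a n by field.
exact: lerD.
Qed.

(** Induction on the number of vertices, splitting off the component of one vertex. The third
    premise transports along isomorphisms, a graph being only isomorphic to the disjoint sum of its
    two parts. *)
Lemma inF_ind (P : forall W : finType, graph W -> Prop) :
  (forall (W : finType) (F : graph W), #|W| = 0%N -> P W F) ->
  (forall (W0 W : finType) (F : graph W0) (H : graph W),
     inF C F -> @C W H -> inF C (sumg F H) -> P W0 F -> P _ (sumg F H)) ->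
  (forall (W W' : finType) (F : graph W) (F' : graph W'), iso F F' -> P W F -> P W' F') ->
  forall (W : finType) (F : graph W), inF C F -> P W F.
Proof.
move=> P0 PS Pi W F; have [m] := ubnP #|W|; elim: m W F => // m IH W F hm iF.
case: (posnP #|W|) => [/P0//|/card_gt0P[x0 _]].
have cl := clo_comp F x0.
apply: (Pi _ _ _ _ (sumg_induced_iso cl)).
have iF0 : inF C (induced F (~: comp F x0)).
  move=> y; rewrite inducedE.
  have im : (fun z : {x | x \in ~: comp F x0} => val z) @: {: {x | x \in ~: comp F x0}} =
            ~: comp F x0.
    apply/setP => z; apply/imsetP/idP => [[w _ ->]|zS]; first exact: valP.
    by exists (exist _ z zS).
  apply/(cls_comp_pull _ icC (val_inj (sT := _))); last exact: iF.
  by rewrite im; exact: clo_compl.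
apply: PS => //; first exact: inF_iso (iso_sym (sumg_induced_iso cl)) iF.
apply: IH => //; rewrite card_sig.
rewrite -ltnS; apply: leq_trans hm; rewrite ltnS -(cardsC (comp F x0)).
rewrite -[X in (X < _)%N]add0n ltn_add2r card_gt0; apply/set0Pn.
by exists x0; exact: comp_id.
Qed.

Lemma Esum_bounded (W : finType) (F : graph W) : inF C F ->
  exists2 M : R, 0 <= M & exists N, forall n, (N <= n)%N -> (Esum F n)%:R <= M * a n.
Proof.
move: W F; apply: inF_ind.
- move=> W F W0; exists 1 => //; exists 0%N => n _; rewrite mul1r ler_nat cntE.
  rewrite /Esum -sum1_card; apply: leq_sum => G _; rewrite -uset0 uset_void //.
  by case: (Dcond _ _ _).
- move=> W0 W F H _ CH _ [M M0 [N hN]]; have [gc _ _ _] := hC CH.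
  exists ((2 * hitc W)%:R * M); first by rewrite mulr_ge0.
  exists (N + (2 * (#|W0| + #|W|)).+1)%N => n nN.
  apply: (@le_trans _ _ ((2 * hitc W * Esum F n)%:R)).
    by rewrite ler_nat; apply: Esum_step => //; clear -nN; lia.
  rewrite natrM -mulrA; apply: ler_wpM2l => //; apply: hN; clear -nN; lia.
- move=> W W' F F' i [M M0 [N hN]]; exists M => //; exists N => n nN.
  by rewrite Esum_D0 -(Usum_iso _ _ i) -Esum_D0 hN.
Qed.

Lemma sum_devi (W : finType) (H : graph W) (r : W) n (f : graph 'I_n -> nat) :
  `|(\sum_(G in gset A 'I_n) (f G * #|pset H r G|)%N)%:R -
    rho ^+ #|W| * n%:R * (\sum_(G in gset A 'I_n) f G)%:R| <=
  \sum_(G in gset A 'I_n) (f G)%:R * devi H r G.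
Proof.
rewrite !natr_sum mulr_sumr -sumrB; apply: le_trans (ler_norm_sum _ _ _) _.
apply: ler_sum => G _; rewrite natrM [X in _ - X]mulrC -mulrBr normrM.
by rewrite [`|(f G)%:R|]ger0_norm.
Qed.

(* One component at a time: moving a component [H] to a pendant position and back
   multiplies the count by the typical number [rho ^ |H| n] of pendant positions. *)
Lemma Usum_step (D : gclass) (K : nat) (W0 W : finType) (F : graph W0) (H : graph W) :
  sizes_le D K -> inF C F -> inF C (sumg F H) -> @C W H ->
  forall e, 0 < e -> exists N, forall n, (N <= n)%N ->
  `|(Usum D (sumg F H) n)%:R - rho ^+ #|W| * (Usum D F n)%:R| <= e * a n.
Proof.
move=> sD iF iFH CH e e0; have [gc bd _ _] := hC CH.
have [/card_gt0P[r _] _] := gc.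
have [M M0 [N1 hN1]] := Esum_bounded iF.
have [M' M'0 [N2 hN2]] := Esum_bounded iFH.
have e20 : 0 < e / 2 by lra.
have [N3 hN3] : exists N, forall n, (N <= n)%N ->
  \sum_(G in gset A 'I_n) (#|uset D F G|)%:R * devi H r G <= e / 2 * n%:R * a n.
  apply: (@pset_L1 W H r (fun n G => #|uset D F G|) #|W0| M CH M0) => //.
    by move=> n G; have := uset_le D F G; rewrite card_ord.
  exists N1 => n /hN1; apply: le_trans; rewrite ler_nat; exact: Usum_le.
pose s := (#|W0| + #|W|)%N.
pose c1 : R := (#|W0| * hitc W)%:R; pose c2 : R := (4 * hitc W)%:R.
(* Collects all errors of order |A_n|: small components in both directions, pendant copies rooted in
   the image of [F], and the s lost in n - s. Division by n makes them negligible. *)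
pose Q : R := (4 + s%:R) * M' + (c1 + c2) * M.
have Q0 : 0 <= Q by rewrite addr_ge0 // mulr_ge0 // addr_ge0.
have [N4 _ hN4] := archi_nat (2 * Q / e).
exists (N1 + N2 + N3 + N4 + (4 * (s + K + #|W|)).+1)%N => n nN.
have [n1 n2 n3 n4 [n5 n6 n7]] : [/\ N1 <= n, N2 <= n, N3 <= n, N4 <= n &
    [/\ 0 < n, 2 * (s + K) < n & 2 * (#|W0| + (K + #|W|)) < n]]%N.
  by clear -nN; rewrite /s in nN *; split; [lia..|split; lia].
have nR : 0 < n%:R :> R by rewrite ltr0n.
move: (hN1 _ n1) (hN2 _ n2) (hN3 _ n3) => {hN1 hN2 hN3} E0 E1 L1.
have an0 : 0 <= a n by rewrite ler0n.
set U := (Usum D (sumg F H) n)%:R; set U0 := (Usum D F n)%:R.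
pose T := (\sum_(G in gset A 'I_n) (#|uset D F G| * #|pset H r G|)%N)%:R : R.
have cW : #|{: W0 + W}| = s by rewrite card_sum.
have sn : (s <= n)%N by clear -n6; lia.
have S1 : (Ssum (sumg F H) K n)%:R <= 4 * (Esum (sumg F H) n)%:R :> R.
  by rewrite -natrM ler_nat; apply: Ssum_le; rewrite cW.
have S0 : (Ssum F (K + #|W|) n)%:R <= 4 * (Esum F n)%:R :> R.
  by rewrite -natrM ler_nat; apply: Ssum_le.
have UE : U <= M' * a n.
  by apply: le_trans E1; rewrite ler_nat; exact: Usum_le.
have U00 : 0 <= U by rewrite ler0n.
have up : U * (n%:R - s%:R) <= T + 4 * (M' * a n).
  have := @step_upper A D K 'I_n W0 W F H r ba sD gc.
  rewrite card_ord -subnDA -/s -(ler_nat R) natrM natrD natrB //.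
  move=> /le_trans; apply; apply: lerD => //; apply: le_trans S1 _.
  by apply: ler_wpM2l.
have low : T <= U * (n%:R - s%:R) + (c1 + c2) * (M * a n).
  have := @step_lower A D K 'I_n W0 W F H r bd sD gc.
  rewrite card_ord -subnDA -/s -(ler_nat R) natrD natrM natrB // natrD.
  move=> /le_trans; apply; rewrite lerD2l mulrDl; apply: lerD.
    by rewrite natrM mulrC; apply: ler_wpM2l.
  rewrite natrM mulrC /c2 natrM -[X in _ <= X * _]mulrC -mulrA; apply: ler_wpM2l => //.
  by apply: le_trans S0 _; apply: ler_wpM2l.
have dv : `|T - rho ^+ #|W| * n%:R * U0| <= e / 2 * n%:R * a n.
  exact: le_trans (sum_devi H r (fun G => #|uset D F G|)) L1.
have sU : s%:R * U <= s%:R * (M' * a n) by apply: ler_wpM2l.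
have sU0 : 0 <= s%:R * U by rewrite mulr_ge0.
have main : `|n%:R * (U - rho ^+ #|W| * U0)| <= Q * a n + e / 2 * n%:R * a n.
  have -> : n%:R * (U - rho ^+ #|W| * U0) =
    (U * (n%:R - s%:R) - T + s%:R * U) + (T - rho ^+ #|W| * n%:R * U0) by ring.
  apply: le_trans (ler_normD _ _) _; apply: lerD dv.
  have QE : Q * a n = 4 * (M' * a n) + s%:R * (M' * a n) + (c1 + c2) * (M * a n).
    by rewrite /Q; ring.
  have p1 : 0 <= (c1 + c2) * (M * a n) by rewrite mulr_ge0 ?mulr_ge0 // addr_ge0.
  have p2 : 0 <= M' * a n by rewrite mulr_ge0.
  rewrite QE ler_norml; move: up low sU sU0 p1 p2; clear.
  move: (U * _) ((c1 + c2) * _) (M' * a n) (s%:R * U) => x y z w.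
  move: (s%:R * z) => zz; move=> *; apply/andP; split; lra.
rewrite normrM ger0_norm ?ler0n // in main.
rewrite -(ler_pM2l nR); apply: le_trans main _.
have hQ : Q <= e / 2 * n%:R.
  have : 2 * Q / e <= n%:R by apply: le_trans hN4 _; rewrite ler_nat.
  by rewrite ler_pdivrMr // => ?; lra.
have -> : n%:R * (e * a n) = e / 2 * n%:R * a n + e / 2 * n%:R * a n by field.
by apply: lerD => //; apply: ler_wpM2r.
Qed.

(** Each component contributes a factor rho^|H|. The induction starts at the empty graph, whose only
    embedding is counted exactly when no component lies in [D]. *)
Theorem Usum_asymp (D : gclass) (K : nat) : sizes_le D K ->
  forall (W : finType) (F : graph W), inF C F ->
  forall e, 0 < e -> exists N, forall n, (N <= n)%N ->
  `|(Usum D F n)%:R - rho ^+ #|W| * (#|[set G in gset A 'I_n | Dcond D G finset.set0]|)%:R|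
    <= e * a n.
Proof.
move=> sD W F iF; pose P (W : finType) (F : graph W) := inF C F /\
  forall e : R, 0 < e -> exists N, forall n, (N <= n)%N ->
  `|(Usum D F n)%:R - rho ^+ #|W| * (#|[set G in gset A 'I_n | Dcond D G finset.set0]|)%:R|
    <= e * a n.
suff [//] : P W F; move: W F iF; apply: inF_ind.
- move=> W F W0; split.
    by move=> x; have := fintype0 x; rewrite W0 => /(_ erefl).
  move=> e e0; exists 0%N => n _; rewrite W0 expr0 mul1r.
  have -> : Usum D F n = #|[set G in gset A 'I_n | Dcond D G finset.set0]|.
    rewrite /Usum -sum1_card [LHS]big_mkcond [RHS]big_mkcond; apply: eq_bigr => G _.
    rewrite (uset_void D F G W0) [in RHS]finset.in_set.
    by case: (G \in _) => //; case: (Dcond _ _ _).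
  by rewrite subrr normr0 mulr_ge0 ?ler0n // ltW.
- move=> W0 W F H iF CH iFH [_ IH].
  split=> // e e0; have k0 : 0 < rho ^+ #|W| by rewrite exprn_gt0 // rho_gt0.
  have e20 : 0 < e / 2 by lra.
  have [N1 hN1] := Usum_step sD iF iFH CH e20.
  have [N2 hN2] := IH (e / 2 / rho ^+ #|W|) ltac:(by rewrite divr_gt0).
  exists (N1 + N2)%N => n nN.
  have [n1 n2] : (N1 <= n /\ N2 <= n)%N by clear -nN; split; lia.
  move: (hN1 n n1) (hN2 n n2); rewrite card_sum addnC exprD.
  set u := (Usum _ _ _)%:R; set u0 := (Usum _ _ _)%:R; set p := (#|_|)%:R => h1 h2.
  have -> : u - rho ^+ #|W| * rho ^+ #|W0| * p =
    (u - rho ^+ #|W| * u0) + rho ^+ #|W| * (u0 - rho ^+ #|W0| * p) by ring.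
  apply: le_trans (ler_normD _ _) _.
  have -> : e * a n = e / 2 * a n + rho ^+ #|W| * (e / 2 / rho ^+ #|W| * a n).
    by field; rewrite gt_eqF.
  by apply: lerD => //; rewrite normrM (gtr0_norm k0) ler_pM2l.
- move=> W W' F F' i [iF IH]; split; first exact: inF_iso i iF.
  move=> e /IH[N hN]; exists N => n nN.
  rewrite -(Usum_iso _ _ i) (_ : #|W'| = #|W|) ?hN //.
  by case: i => f [bf _]; rewrite (bij_eq_card bf).
Qed.

End Asymptotics.

(** * Exponential recurrence and bridge-closed classes *)

Section Splitting.
Implicit Types (V W U : finType).

Lemma val_im V (S : {set V}) :
  (fun x : {x : V | x \in S} => val x) @: {: {x : V | x \in S}} = S.
Proof.
apply/setP => z; apply/imsetP/idP => [[w _ ->]|zS]; first exact: valP.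
by exists (exist _ z zS).
Qed.

Lemma card_sigset V (S : {set V}) : #|{: {x : V | x \in S}}| = #|S|.
Proof. by rewrite card_sig; apply: eq_card. Qed.

Lemma sval_inj V (S : {set V}) : injective (fun x : {x : V | x \in S} => val x).
Proof. exact: val_inj. Qed.

Lemma edge_push_out V U (s : V -> U) (K : graph V) x y :
  x \notin s @: V -> edge (push s K) x y = false.
Proof.
move=> xS; rewrite edge_mkgraph; apply/negP => /andP[/orP[]] /existsP[a /existsP[b]] /and3P[] /eqP E1 /eqP E2 _.
  by move: xS; rewrite -E1 imset_f.
by move: xS; rewrite -E2 imset_f.
Qed.

Definition splitset (P Q : gclass) V (S : {set V}) : {set graph V} :=
  [set G | [&& clo G S, `[< P _ (induced G S) >] & `[< Q _ (induced G (~: S)) >]]].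

Lemma card_splitset (P Q : gclass) V (S : {set V}) : iso_closed P -> iso_closed Q ->
  #|splitset P Q S| = cnt P #|S| * cnt Q (#|V| - #|S|).
Proof.
move=> iP iQ.
have <- : #|gset P {x | x \in S}| = cnt P #|S| by rewrite card_gset // card_sigset.
have <- : #|gset Q {x | x \in ~: S}| = cnt Q (#|V| - #|S|).
  by rewrite card_gset // card_sigset cardsCs finset.setCK.
rewrite -cardsX; apply/eqP; rewrite eqn_leq; apply/andP; split.
  apply: (@leq_card_inj _ _ _ _ (fun G => (induced G S, induced G (~: S)))).
    move=> G G'; rewrite !finset.in_set => /and3P[c _ _] /and3P[c' _ _] E.
    have E1 := congr1 fst E; have E2 := congr1 snd E; move: E1 E2 => /= E1 E2.
    apply: graph_ext => x y.
    have h (T : {set V}) : induced G T = induced G' T -> x \in T -> y \in T ->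
        edge G x y = edge G' x y.
      move=> ET xT yT; have := congr1 (fun K => edge K (exist _ x xT) (exist _ y yT)) ET.
      by rewrite !inducedE !edge_pull.
    case: (boolP (x \in S)) => xS; case: (boolP (y \in S)) => yS.
    - exact: h E1 xS yS.
    - have n1 : edge G x y = false.
        by apply/negP => e; move: xS; rewrite (cloE c e) (negbTE yS).
      have n2 : edge G' x y = false.
        by apply/negP => e; move: xS; rewrite (cloE c' e) (negbTE yS).
      by rewrite n1 n2.
    - have n1 : edge G x y = false.
        by apply/negP => e; move: yS; rewrite -(cloE c e) (negbTE xS).
      have n2 : edge G' x y = false.
        by apply/negP => e; move: yS; rewrite -(cloE c' e) (negbTE xS).
      by rewrite n1 n2.
    - by apply: (h (~: S) E2); rewrite inE.
  move=> G; rewrite finset.in_set => /and3P[_ p q].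
  by rewrite finset.in_setX !in_gset p q.
pose gl (q : graph {x | x \in S} * graph {x | x \in ~: S}) : graph V :=
  mkgraph (fun x y => edge (push (fun x => val x) q.1) x y || edge (push (fun x => val x) q.2) x y).
have glE q x y : edge (gl q) x y =
    edge (push (fun x => val x) q.1) x y || edge (push (fun x => val x) q.2) x y.
  rewrite edge_mkgraph [edge (push _ q.1) y x]edge_sym [edge (push _ q.2) y x]edge_sym orbb.
  by case: (eqVneq x y) => [->|_]; rewrite ?edge_irr // andbT.
have gl1 q : induced (gl q) S = q.1.
  apply: graph_ext => x y; rewrite inducedE edge_pull glE edge_push; last exact: val_inj.
  by rewrite edge_push_out ?orbF // val_im inE negbK; exact: valP.
have gl2 q : induced (gl q) (~: S) = q.2.
  apply: graph_ext => x y; rewrite inducedE edge_pull glE [X in _ || X]edge_push; last exact: val_inj.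
  by rewrite edge_push_out //= val_im; have := valP x; rewrite inE.
apply: (@leq_card_inj _ _ _ _ gl).
  move=> q q' _ _ E; rewrite [q]surjective_pairing [q']surjective_pairing.
  by rewrite -(gl1 q) -(gl2 q) E gl1 gl2.
move=> [q1 q2]; rewrite finset.in_setX !in_gset => /andP[p1 p2].
rewrite finset.in_set gl1 gl2 p1 p2 !andbT; apply/cloP => x y xS; rewrite glE.
case/orP => e; last by move: e; rewrite edge_push_out // val_im inE negbK.
apply/negPn/negP => yS; move: e; by rewrite edge_sym edge_push_out // val_im.
Qed.

Lemma sum_by_card V (g : nat -> nat) :
  \sum_(S : {set V}) g #|S| = \sum_(k < #|V|.+1) 'C(#|V|, k) * g k.
Proof.
rewrite (partition_big (fun S : {set V} => inord #|S| : 'I_#|V|.+1) xpredT) //=.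
apply: eq_bigr => k _; rewrite -card_draws -sum_nat_const.
have kE (S : {set V}) : (inord #|S| == k) = (#|S| == k).
  by rewrite -val_eqE /= inordK // ltnS max_card.
apply: eq_big => [S|S]; first by rewrite kE finset.in_set.
by rewrite kE => /eqP ->.
Qed.

Lemma inF_split (C : gclass) V (G : graph V) x (S : {set V}) : iso_closed C ->
  (forall W (H : graph W), C W H -> gconnected H) -> x \in S ->
  (`[< inF C G >] && (comp G x == S)) = (G \in splitset C (inF C) S).
Proof.
move=> icC cC xS; rewrite finset.in_set; apply/idP/idP.
  case/andP => /asboolP iF /eqP E; have c : clo G S by rewrite -E; exact: clo_comp.
  apply/and3P; split=> //; apply/asboolP; first by rewrite -E; exact: iF.
  move=> y; rewrite [induced G _]inducedE.
  apply/(@cls_comp_pull C _ _ _ G y icC (@sval_inj _ (~: S))); last exact: iF.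
  by rewrite val_im; exact: clo_compl.
case/and3P => c /asboolP CS /asboolP iF.
have E : comp G x = S.
  apply/eqP; rewrite finset.eqEsubset comp_sub //=; apply/fintype.subsetP => y yS.
  have [_ /(_ (exist _ x xS) (exist _ y yS))] := cC _ _ CS.
  by rewrite inducedE => /conn_pull /=; rewrite inE.
rewrite E eqxx andbT; apply/asboolP => y.
case: (boolP (y \in S)) => yS.
  have -> : comp G y = S by rewrite -E; apply/esym/comp_eq; rewrite -in_comp E.
  exact: CS.
have yS' : y \in ~: S by rewrite inE.
apply/(@cls_comp_pull C _ _ _ G (exist _ y yS') icC (@sval_inj _ (~: S))).
  by rewrite val_im; exact: clo_compl.
exact: iF (exist _ y yS').
Qed.

(** Marks a vertex and splits off its component: the coefficient form of x F' = x C' F. *)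
Lemma inF_recurrence (C : gclass) n : iso_closed C ->
  (forall W (H : graph W), C W H -> gconnected H) ->
  n * cnt (inF C) n =
  \sum_(k < n.+1) 'C(n, k) * (k * (cnt C k * cnt (inF C) (n - k))).
Proof.
move=> icC cC; have iFc := inF_iso icC.
have := @sum_by_card 'I_n (fun k => k * (cnt C k * cnt (inF C) (n - k))).
rewrite card_ord => <-.
pose X := [set p : graph 'I_n * 'I_n | (p.1 \in gset (inF C) 'I_n)].
have -> : n * cnt (inF C) n = #|X|.
  rewrite (_ : X = finset.setX (gset (inF C) 'I_n) [set: 'I_n]).
    by rewrite cardsX cardsT card_ord cntE mulnC.
  by apply/setP => p; rewrite !finset.in_set andbT.
rewrite -sum1_card (partition_big (fun p : graph 'I_n * 'I_n => comp p.1 p.2) xpredT) //=.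
apply: eq_bigr => S _; rewrite sum1dep_card.
have -> : #|[set p : graph 'I_n * 'I_n | (p \in X) && (comp p.1 p.2 == S)]| =
    #|finset.setX (splitset C (inF C) S) S|.
  congr #|pred_of_set _|; apply/setP => -[G x]; rewrite finset.in_set finset.in_setX.
  rewrite [(G, x) \in X]finset.in_set /= in_gset.
  case: (boolP (x \in S)) => xS; first by rewrite andbT inF_split.
  rewrite andbF; apply/negP => /andP[_ /eqP E]; move: xS; rewrite -E comp_id //.
by rewrite cardsX card_splitset // card_ord mulnC.
Qed.

(** * Graphs obtained by adding bridges *)

Inductive reach V (F : graph V) : graph V -> Prop :=
| reach_refl : reach F F
| reach_step G u v : reach F G -> ~~ conn G u v -> reach F (addE G u v).

Lemma reach_trans V (F G H : graph V) : reach F G -> reach G H -> reach F H.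
Proof. by move=> a; elim=> // K u v _ b c; apply: reach_step. Qed.

(* Unlike [C], this class is closed under joining two members by a bridge. *)
Definition Cst (C : gclass) : gclass := fun V H =>
  gconnected H /\ exists F : graph V, inF C F /\ reach F H.

Lemma conn_pull_bij V W (f : V -> W) (G : graph W) a b : bijective f ->
  conn (pull f G) a b = conn G (f a) (f b).
Proof.
move=> bf; apply/idP/idP; first exact: conn_pull.
have fi := bij_inj bf; rewrite -!in_comp.
rewrite comp_pull //; first by rewrite mem_imset.
apply/cloP => x y _ _; have [g _ gf] := bf; apply/imsetP; by exists (g y).
Qed.

Lemma pull_addE V W (f : V -> W) (G : graph W) u v : bijective f -> u != v ->
  pull f (addE G (f u) (f v)) = addE (pull f G) u v.
Proof.
move=> bf uv; have fi := bij_inj bf; apply: graph_ext => x y.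
rewrite edge_pull !edge_addE ?edge_pull ?(inj_eq fi) //.
Qed.

Lemma reach_pull V W (f : V -> W) (F G : graph W) : bijective f ->
  reach F G -> reach (pull f F) (pull f G).
Proof.
move=> bf; elim=> [|K u v _ IH nc]; first exact: reach_refl.
have [g fg gf] := bf.
have uv : g u != g v.
  by apply: contraNneq nc => E; rewrite -(gf u) -(gf v) E; exact: connxx.
rewrite -(gf u) -(gf v) pull_addE //; apply: reach_step => //.
by rewrite conn_pull_bij // !gf.
Qed.

Lemma Cst_iso (C : gclass) : iso_closed C -> iso_closed (Cst C).
Proof.
move=> icC V W G H /iso_sym [f [bf e]] [[c0 c] [F [iF rF]]].
have E : H = pull f G by apply: graph_ext => a b; rewrite edge_pull e.
have bf' := bf; have [g fg gf] := bf'.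
split.
  split; first by rewrite (bij_eq_card bf).
  by move=> x y; rewrite E conn_pull_bij.
exists (pull f F); split; last by rewrite E; exact: reach_pull.
exact: (inF_iso icC (iso_sym (iso_pull F bf)) iF).
Qed.

Lemma sub_Cst (C : gclass) V (H : graph V) : iso_closed C ->
  (forall W (H : graph W), C W H -> gconnected H) -> C V H -> Cst C H.
Proof.
move=> icC cC CH; split; first exact: cC CH.
exists H; split; last exact: reach_refl.
move=> x; have [_ c] := cC _ _ CH.
have E : comp H x = id @: V.
  by apply/setP => y; rewrite inE c; apply/esym/imsetP; exists y.
rewrite -(@cls_pull_im C _ _ id H (comp H x)) //.
by rewrite (_ : pull id H = H) //; apply: graph_ext => a b; rewrite edge_pull.
Qed.

(** The bridges added on the way from [F] to [H] are deleted inside [G] in reverse order. As the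
    image of [s] is closed, each of them is a bridge of the current large graph too, and edges at
    outside vertices never change. *)
Lemma reach_lift V W (s : W -> V) (F H : graph W) : injective s -> reach F H ->
  forall G : graph V, clo G (s @: W) -> pull s G = H ->
  exists G0, [/\ clo G0 (s @: W), pull s G0 = F,
    forall x y, x \notin s @: W -> edge G0 x y = edge G x y & reach G0 G].
Proof.
move=> si; elim=> [|K u v _ IH nc] G c E.
  by exists G; split=> //; exact: reach_refl.
have uv : u != v by apply: contraNneq nc => ->; exact: connxx.
have eK : ~~ edge K u v by apply: contra nc; exact: edge_conn.
have eG : edge G (s u) (s v) by rewrite -edge_pull E edge_addE // !eqxx orbT.
pose G' := delE G (s u) (s v).
have c' : clo G' (s @: W).
  apply/cloP => x y xS; rewrite edge_delE => /andP[e _]; exact: clo_edge c xS e.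
have E' : pull s G' = K.
  rewrite -(addEK uv eK) -E; apply: graph_ext => a b.
  by rewrite edge_pull !edge_delE edge_pull !(inj_eq si).
have [G0 [c0 E0 o0 r0]] := IH G' c' E'; exists G0; split=> //.
  move=> x y xS; rewrite o0 // edge_delE.
  have -> : (x == s u) = false by apply/eqP => h; move: xS; rewrite h imset_f.
  have -> : (x == s v) = false by apply/eqP => h; move: xS; rewrite h imset_f.
  by rewrite andbT.
rewrite -(delEK eG); apply: reach_step => //.
apply: contra nc => h; rewrite -E' -in_comp -(mem_imset _ _ si) -comp_pull // ?in_comp //.
Qed.

(** Lifting the bridge deletions from both sides gives a graph with all components in [C], from
    which [G] is reached by adding bridges; uv is one bridge more. *)
Lemma Cst_join (C : gclass) V (G : graph V) (S : {set V}) u v : iso_closed C ->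
  G \in splitset (Cst C) (Cst C) S -> u \in S -> v \notin S -> Cst C (addE G u v).
Proof.
move=> icC; rewrite finset.in_set => /and3P[c /asboolP [c1 [F1 [iF1 r1]]] /asboolP [c2 [F2 [iF2 r2]]]] uS vS.
have uv : u != v by apply: contraNneq vS => <-.
have cc := clo_compl c.
have sub x y : conn G x y -> conn (addE G u v) x y.
  by apply: conn_mono => a b e; rewrite edge_addE // e.
split.
  split; first by apply/card_gt0P; exists u.
  have inS x y : x \in S -> y \in S -> conn (addE G u v) x y.
    move=> xS yS; apply: sub; have [_ /(_ (exist _ x xS) (exist _ y yS))] := c1.
    by rewrite inducedE => /conn_pull.
  have outS x y : x \notin S -> y \notin S -> conn (addE G u v) x y.
    rewrite -!finset.in_setC => xS yS; apply: sub.
    have [_ /(_ (exist _ x xS) (exist _ y yS))] := c2.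
    by rewrite inducedE => /conn_pull.
  have uvc : conn (addE G u v) u v by apply: edge_conn; rewrite edge_addE // !eqxx orbT.
  have cr x y : x \in S -> y \notin S -> conn (addE G u v) x y.
    move=> xS yS; apply: conn_trans (inS _ _ xS uS) _; apply: conn_trans uvc _.
    exact: outS.
  move=> x y; case: (boolP (x \in S)) => xS; case: (boolP (y \in S)) => yS.
  - exact: inS.
  - exact: cr.
  - by rewrite conn_sym; exact: cr.
  - exact: outS.
have [|G1 [cG1 E1 o1 R1]] := reach_lift (@sval_inj _ S) r1 _ (erefl : pull _ G = _).
  by rewrite val_im.
rewrite val_im in cG1 o1.
have E2 : pull (fun z : {z | z \in ~: S} => val z) G1 = induced G (~: S).
  apply: graph_ext => a b; rewrite inducedE !edge_pull o1 //.
  by have := valP a; rewrite inE.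
have [|G2 [cG2 E3 o2 R2]] := reach_lift (@sval_inj _ (~: S)) r2 _ E2.
  by rewrite val_im; exact: clo_compl.
rewrite val_im in cG2 o2.
have cG2S : clo G2 S by rewrite -[S]finset.setCK; exact: clo_compl.
have E4 : pull (fun z : {z | z \in S} => val z) G2 = F1.
  rewrite -E1; apply: graph_ext => a b; rewrite !edge_pull o2 //.
  by rewrite inE negbK; exact: valP.
exists G2; split; last first.
  apply: reach_step; first exact: reach_trans R2 R1.
  by apply: contra vS; exact: clo_conn.
move=> y; case: (boolP (y \in S)) => yS.
  apply/(@cls_comp_pull C _ _ _ G2 (exist _ y yS) icC (@sval_inj _ S)); first by rewrite val_im.
  by rewrite E4; exact: iF1.
rewrite -finset.in_setC in yS.
apply/(@cls_comp_pull C _ _ _ G2 (exist _ y yS) icC (@sval_inj _ (~: S))); first by rewrite val_im.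
by rewrite E3; exact: iF2.
Qed.

(** A split graph with a chosen vertex on either side is mapped to the joined graph with an oriented
    bridge. The set S returns as the component of the first end once the bridge is deleted, so the
    map is injective, and a connected graph has at most 2(n - 1) oriented bridges. *)
Lemma Cst_superadd (C : gclass) n : iso_closed C ->
  \sum_(k < n.+1) 'C(n, k) * (k * (n - k) * (cnt (Cst C) k * cnt (Cst C) (n - k))) <=
  2 * n.-1 * cnt (Cst C) n.
Proof.
move=> icC; have icS := Cst_iso icC.
have := @sum_by_card 'I_n (fun k => k * (n - k) * (cnt (Cst C) k * cnt (Cst C) (n - k))).
rewrite card_ord => <-.
pose ss S := finset.setX (splitset (Cst C) (Cst C) S) (finset.setX S (~: S)) : {set graph 'I_n * ('I_n * 'I_n)}.
have -> : \sum_(S : {set 'I_n}) #|S| * (n - #|S|) *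
    (cnt (Cst C) #|S| * cnt (Cst C) (n - #|S|)) = \sum_(S in [set: {set 'I_n}]) #|[set b | b \in ss S]|.
  apply: eq_big => [S|S _]; first by rewrite inE.
  rewrite (_ : [set b | b \in ss S] = ss S); last by apply/setP => b; rewrite finset.in_set.
  rewrite !cardsX card_splitset // card_ord.
  by rewrite [#|~: S|]cardsCs finset.setCK card_ord mulnC.
rewrite sum_card_pair.
apply: leq_trans (_ : #|[set p : graph 'I_n * ('I_n * 'I_n) |
   (p.1 \in gset (Cst C) 'I_n) && isbr p.1 p.2]| <= _); last first.
  rewrite mulnC cntE; apply: card_pair_le => G /gsetP[gc _].
  by have := card_isbr_conn gc; rewrite card_ord.
pose g (q : {set 'I_n} * (graph 'I_n * ('I_n * 'I_n))) :=
  (addE q.2.1 q.2.2.1 q.2.2.2, q.2.2).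
have key S G u v : (G, (u, v)) \in ss S ->
  [/\ G \in splitset (Cst C) (Cst C) S, u \in S, v \notin S, ~~ conn G u v & comp G u = S].
  rewrite finset.in_setX finset.in_setX finset.in_setC => /and3P[sp uS vS].
  move: (sp); rewrite [in X in X -> _]finset.in_set => /and3P[c /asboolP [[_ c1] _] _].
  split; [exact: sp|exact: uS|exact: vS|by apply: contra vS; exact: clo_conn|].
  apply/eqP; rewrite finset.eqEsubset comp_sub //=; apply/fintype.subsetP => y yS.
  have := c1 (exist _ u uS) (exist _ y yS).
  by rewrite inducedE => /conn_pull /=; rewrite inE.
apply: (@leq_card_inj _ _ _ _ g).
  move=> [S [G [u v]]] [S' [G' [u' v']]] hq hq' E.
  have /key[_ _ _ nc cS] : (G, (u, v)) \in ss S.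
    by move: hq; rewrite finset.in_set => /andP[].
  have /key[_ _ _ nc' cS'] : (G', (u', v')) \in ss S'.
    by move: hq'; rewrite finset.in_set => /andP[].
  have E1 := congr1 fst E; have [E2 E3] := congr1 snd E; move: E1 => /= E1.
  rewrite -E2 -E3 in E1 nc' cS'.
  have uv : u != v by apply: contraNneq nc => ->; exact: connxx.
  have e1 : ~~ edge G u v by apply: contra nc; exact: edge_conn.
  have e2 : ~~ edge G' u v by apply: contra nc'; exact: edge_conn.
  have GG : G = G' by rewrite -(addEK uv e1) E1 addEK.
  by rewrite -E2 -E3 -GG -cS -cS' GG.
move=> [S [G [u v]]] hq.
have /key[sp uS vS nc _] : (G, (u, v)) \in ss S.
  by move: hq; rewrite finset.in_set => /andP[].
rewrite finset.in_set /=; apply/andP; split; last exact: isbr_addE.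
by apply/gsetP; apply: Cst_join sp uS vS.
Qed.

(** Adding the images of the bridges to the host graph turns an embedding of [F] into one of [H].
    Asymptotics known for graphs with components in [C] thereby become lower bounds for [Cst C]. *)
Lemma Esum_reach (A : gclass) W (F H : graph W) n : bridge_addable A -> reach F H ->
  Esum A F n <= Esum A H n.
Proof.
move=> ba; elim=> [|K u v _ IH nc]; first exact: leqnn.
apply: leq_trans IH _.
have uv : u != v by apply: contraNneq nc => ->; exact: connxx.
rewrite /Esum !sum_card_pair.
pose g (q : graph 'I_n * {ffun W -> 'I_n}) := (addE q.1 (q.2 u) (q.2 v), q.2).
have key (G : graph 'I_n) (f : {ffun W -> 'I_n}) : cemb K G f -> f u != f v /\ ~~ conn G (f u) (f v).
  case/cembP => fi E c; split; first by rewrite (inj_eq fi).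
  by apply: contra nc => h; rewrite -E -in_comp -(mem_imset _ _ fi) -comp_pull // in_comp.
apply: (@leq_card_inj _ _ _ _ g).
  move=> [G f] [G' f']; rewrite !finset.in_set /= => /andP[_ /key[uv1 c1]] /andP[_ /key[_ c2]] E.
  have E1 := congr1 fst E; have E2 := congr1 snd E; move: E1 E2 => /= E1 E2; subst f'.
  have e1 : ~~ edge G (f u) (f v) by apply: contra c1; exact: edge_conn.
  have e2 : ~~ edge G' (f u) (f v) by apply: contra c2; exact: edge_conn.
  suff GG : G = G' by rewrite GG.
  by rewrite -(addEK uv1 e1) E1 addEK.
move=> [G f]; rewrite [in X in X -> _]finset.in_set /= => /andP[/gsetP AG /[dup] /key[uv1 c1] /cembP[fi E c]].
rewrite finset.in_set /=; apply/andP; split; first by apply/gsetP; apply: ba.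
apply/cembP; split=> //.
  by apply: graph_ext => a b; rewrite edge_pull !edge_addE // !(inj_eq fi) -edge_pull E.
apply/cloP => x y xS; rewrite edge_addE // => /orP[/orP[e|/andP[_ /eqP ->]]|/andP[_ /eqP ->]].
- exact: clo_edge c xS e.
- by rewrite imset_f.
- by rewrite imset_f.
Qed.

End Splitting.

(** * Series *)

Section Series.
Variable R : realType.
Local Open Scope ring_scope.
Implicit Types (u c f m : nat -> R).

Definition psum u n : R := \sum_(k < n) u k.

Lemma psum_mono u : (forall k, 0 <= u k) -> {homo psum u : a b / (a <= b)%N >-> a <= b}.
Proof.
move=> u0 a b ab; rewrite /psum -!(big_mkord xpredT u).
rewrite [X in _ <= X](big_cat_nat (n := a)) //= lerDl; exact: sumr_ge0.
Qed.

Lemma psum_cvg u M : (forall k, 0 <= u k) -> (forall n, psum u n <= M) ->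
  exists S : R, (psum u n @[n --> \oo] --> S)%classic /\ (forall n, psum u n <= S) /\
    forall e, 0 < e -> exists N, forall n, (N <= n)%N -> S - e <= psum u n.
Proof.
move=> u0 uM; have mono := psum_mono u0.
have cv : cvgn (psum u).
  apply: nondecreasing_is_cvgn => //.
  by exists M => _ [n _ <-].
exists (limn (psum u)); split=> //; split.
  exact: nondecreasing_cvgn_le.
move=> e e0; have /cvgrPdist_le /(_ e e0)[N _ hN] := cv.
exists N => n nN; have := hN n nN; rewrite ler_norml => /andP[_]; lra.
Qed.

Lemma eseries_psum u S : (psum u n @[n --> \oo] --> S)%classic ->
  (\sum_(0 <= n <oo) (u n)%:E)%E = S%:E.
Proof.
move=> cv; apply/cvg_lim => //.
rewrite (_ : (fun n => _) = fun n => (psum u n)%:E); last first.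
  by apply/funext => n; rewrite /psum -(big_mkord xpredT u) sumEFin.
by apply: cvg_EFin => //; exact: nearW.
Qed.

Lemma eseries1_psum u S : u 0%N = 0 -> (psum u n @[n --> \oo] --> S)%classic ->
  (\sum_(1 <= n <oo) (u n)%:E)%E = S%:E.
Proof.
move=> u0 cv; apply/cvg_lim => //.
rewrite (_ : (fun n => _) = fun n => (psum u n)%:E); last first.
  apply/funext => -[|n]; first by rewrite /psum big_ord0 big_geq.
  by rewrite /psum -(big_mkord xpredT u) sumEFin [in RHS]big_ltn // u0 add0r.
by apply: cvg_EFin => //; exact: nearW.
Qed.

Lemma coef_le_horner1 (p : {poly R}) n : (forall i, 0 <= p`_i) ->
  \sum_(i < n) p`_i <= p.[1].
Proof.
move=> p0; rewrite (@horner_coef_wide _ (maxn n (size p))) ?leq_maxr //.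
apply: (@le_trans _ _ (\sum_(i < maxn n (size p)) p`_i)).
  by apply: (@psum_mono (fun i => p`_i)); rewrite ?leq_maxl.
by apply: ler_sum => i _; rewrite expr1n mulr1.
Qed.

(** Finite Cauchy product: the square of the truncated generating polynomial evaluated at 1. *)
Lemma psum_square m K : (forall k, 0 <= m k) ->
  psum m K.+1 ^+ 2 <= \sum_(n < (2 * K).+1) \sum_(k < n.+1) m k * m (n - k)%N.
Proof.
move=> m0; pose p := \poly_(k < K.+1) m k.
have p1 : p.[1] = psum m K.+1.
  rewrite (@horner_coef_wide _ K.+1) ?size_poly //; apply: eq_bigr => i _.
  by rewrite expr1n mulr1 coef_poly ltn_ord.
rewrite -p1 expr2 -hornerM.
have sz : (size (p * p)%R <= (2 * K).+1)%N.
  apply: leq_trans (size_polyMleq _ _) _; have := size_poly K.+1 m.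
  rewrite -/p; move: (size p) => s; clear; lia.
rewrite (@horner_coef_wide _ (2 * K).+1) //; apply: ler_sum => n _.
rewrite expr1n mulr1 coefM; apply: ler_sum => k _.
rewrite !coef_poly; case: ifP => _; case: ifP => _; rewrite ?mul0r ?mulr0 ?mulr_ge0 //.
Qed.

(* With [P] and [M] the sums of [m] and [c], the hypothesis sums to
   [P^2 <= 2 (P - M)], and [P - P^2 / 2 <= 1/2]. *)
Lemma half_bound m c B : (forall k, 0 <= m k) -> (forall k, 0 <= c k) ->
  (forall n, psum m n <= B) ->
  (forall n, \sum_(k < n.+1) m k * m (n - k)%N <= 2 * (m n - c n)) ->
  forall n, psum c n <= 2^-1.
Proof.
move=> m0 c0 mB h n; apply/ler_addgt0Pr => e e0.
have [S [_ [mS hS]]] := psum_cvg m0 mB; have [N hN] := hS e e0.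
pose K := (N + n)%N.
have sq := psum_square K m0.
have : psum m K.+1 ^+ 2 <= 2 * (psum m (2 * K).+1 - psum c (2 * K).+1).
  apply: le_trans sq _; rewrite /psum -sumrB mulr_sumr; exact: ler_sum.
have h1 := hN K.+1 ltac:(rewrite /K; clear; lia).
have h2 := mS (2 * K).+1.
have h3 : psum c n <= psum c (2 * K).+1.
  by apply: psum_mono => //; rewrite /K; clear; lia.
move: h1 h2 h3; move: (psum m K.+1) (psum m (2 * K).+1) (psum c (2 * K).+1) (psum c n).
(* As y <= x + e, the inequality x^2 <= 2 (y - z) gives w <= z <= x + e - x^2 / 2 <= 1/2 + e. *)
move=> x y z w h1 h2 h3 h4; have : 0 <= (x - 1) ^+ 2 by exact: sqr_ge0.
rewrite !expr2 in h4 *; lra.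
Qed.

(** * The exponential formula for power series with non-negative coefficients *)

Section Exponential.
Variables (c f : nat -> R).
Hypotheses (c0 : forall k, 0 <= c k) (c00 : c 0%N = 0) (f0 : forall n, 0 <= f n)
  (f00 : f 0%N = 1)
  (rec : forall n, n%:R * f n = \sum_(k < n.+1) k%:R * c k * f (n - k)%N).

Lemma exp_rec n : n.+1%:R * f n.+1 = \sum_(i < n.+1) i.+1%:R * c i.+1 * f (n - i)%N.
Proof. by rewrite rec big_ord_recl /= mul0r mul0r add0r. Qed.

Let p N := \poly_(k < N.+1) c k.
(** Truncated exponential series of the truncated polynomial [p N]. Its derivative satisfies P' = p'
    P with J lowered by one, the counterpart of the recurrence for [f]; this identifies the low
    coefficients with [f] and bounds all others by [f]. *)
Let P N J : {poly R} := \sum_(j < J.+1) (j`!%:R^-1) *: p N ^+ j.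

Lemma p_coef N i : (p N)`_i <= c i.
Proof. by rewrite coef_poly; case: ifP. Qed.

Lemma p_coef0 N i : 0 <= (p N)`_i.
Proof. by rewrite coef_poly; case: ifP. Qed.

Lemma derivP N J : (P N J.+1)^`() = (p N)^`() * P N J.
Proof.
rewrite /P big_ord_recl /= derivD expr0 derivZ derivC scaler0 add0r.
rewrite raddf_sum mulr_sumr; apply: eq_bigr => j _ /=.
rewrite derivZ deriv_exp /bump /= add1n /= -scalerAr -scalerMnr -scaler_nat scalerA.
congr (_ *: _); rewrite factS natrM invfM mulrA mulfV ?mul1r //.
Qed.

Lemma P_rec N J n : n.+1%:R * (P N J.+1)`_n.+1 =
  \sum_(i < n.+1) i.+1%:R * (p N)`_i.+1 * (P N J)`_(n - i).
Proof.
have := congr1 (fun q : {poly R} => q`_n) (derivP N J); rewrite coef_deriv coefM.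
rewrite mulr_natl => ->; apply: eq_bigr => i _.
by rewrite coef_deriv mulr_natl.
Qed.

Lemma P_0 N J : (P N J)`_0 = 1.
Proof.
rewrite -horner_coef0 /P horner_sum big_ord_recl /= hornerZ expr0 hornerC.
rewrite big1 ?addr0 ?invr1 ?mul1r // => j _.
rewrite hornerZ horner_exp horner_coef0 coef_poly /= c00 /bump /= add1n.
by rewrite expr0n /= mulr0.
Qed.

Lemma P_eq N n : forall J, (n <= J)%N -> (n <= N)%N -> (P N J)`_n = f n.
Proof.
have [k] := ubnP n; elim: k n => // k IH [|n] hn J nJ nN; first by rewrite P_0 f00.
case: J nJ => // J nJ.
have nz : n.+1%:R != 0 :> R by rewrite pnatr_eq0.
apply: (mulfI nz); rewrite P_rec exp_rec; apply: eq_bigr => i _.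
have iN : (i.+1 < N.+1)%N by rewrite ltnS; apply: leq_trans (ltn_ord i) nN.
rewrite coef_poly iN.
rewrite IH //; have := ltn_ord i; move: (nat_of_ord i) => j; clear -hn nJ nN; lia.
Qed.

Lemma P_ge0 N J n : 0 <= (P N J)`_n.
Proof.
have pw j i : 0 <= (p N ^+ j)`_i.
  elim: j i => [|j IH] i; first by rewrite expr0 coef1 ler0n.
  rewrite exprS coefM; apply: sumr_ge0 => k _; apply: mulr_ge0 => //.
  exact: p_coef0.
rewrite /P coef_sum; apply: sumr_ge0 => j _; rewrite coefZ mulr_ge0 // invr_ge0 ler0n //.
Qed.

Lemma P_le N n : forall J, (P N J)`_n <= f n.
Proof.
have [k] := ubnP n; elim: k n => // k IH [|n] hn J; first by rewrite P_0 f00.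
case: J => [|J].
  by rewrite /P big_ord_recl big_ord0 addr0 expr0 coefZ coef1 mulr0.
have nz : 0 < n.+1%:R :> R by rewrite ltr0n.
rewrite -(ler_pM2l nz) P_rec exp_rec; apply: ler_sum => i _.
apply: ler_pM.
- by rewrite mulr_ge0 ?ler0n // p_coef0.
- exact: P_ge0.
- by apply: ler_wpM2l; rewrite ?ler0n // p_coef.
- apply: IH; move: (nat_of_ord i) => j; clear -hn; lia.
Qed.

Lemma P_1 N J : (P N J).[1] = psum (fun j => j`!%:R^-1 * psum c N.+1 ^+ j) J.+1.
Proof.
have p1 : (p N).[1] = psum c N.+1.
  rewrite (@horner_coef_wide _ N.+1) ?size_poly //; apply: eq_bigr => i _.
  by rewrite expr1n mulr1 coef_poly ltn_ord.
by rewrite /P horner_sum; apply: eq_bigr => j _; rewrite hornerZ horner_exp p1.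
Qed.

Lemma expR_partial x J : 0 <= x -> psum (fun j => j`!%:R^-1 * x ^+ j) J <= expR x.
Proof.
move=> x0; have -> : psum (fun j => j`!%:R^-1 * x ^+ j) J = series (exp_coeff x) J.
  rewrite /psum /series /= big_mkord; apply: eq_bigr => j _.
  by rewrite /exp_coeff /= mulrC.
apply: nondecreasing_cvgn_le; last exact: is_cvg_series_exp_coeff.
apply/nondecreasing_seqP => n; rewrite !seriesEord /= big_ord_recr /= lerDl.
exact: exp_coeff_ge0.
Qed.

Lemma psum_f_le N : psum f N.+1 <= expR (psum c N.+1).
Proof.
have cs0 : 0 <= psum c N.+1 by apply: sumr_ge0.
apply: le_trans (expR_partial N.+1 cs0); rewrite -P_1.
apply: le_trans (coef_le_horner1 N.+1 (P_ge0 N N)); rewrite le_eqVlt; apply/orP; left.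
by apply/eqP/eq_bigr => i _; rewrite P_eq // -ltnS.
Qed.

(** The low coefficients of [P N N] equal those of [f], which bounds the partial sums by exp S.
    Conversely all coefficients of [P N J] are at most those of [f], while its value at 1 can be
    made close to exp S. *)
Lemma exp_formula S : (psum c n @[n --> \oo] --> S)%classic ->
  (forall n, psum c n <= S) -> (psum f n @[n --> \oo] --> expR S)%classic.
Proof.
move=> cv cS.
have up n : psum f n <= expR S.
  apply: (@le_trans _ _ (psum f n.+1)); first by apply: psum_mono.
  by apply: le_trans (psum_f_le n) _; rewrite ler_expR.
apply/cvgrPdist_le => e e0; have e20 : 0 < e / 2 by lra.
have cvE : (expR (psum c n) @[n --> \oo] --> expR S)%classic.
  by apply: continuous_cvg cv; exact: continuous_expR.
have /cvgrPdist_le /(_ _ e20)[N _ hN] := cvE.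
have := hN N.+1 (leqnSn N); rewrite ler_norml => /andP[_ h1].
have cs0 : 0 <= psum c N.+1 by apply: sumr_ge0.
have cvx : (series (exp_coeff (psum c N.+1)) n @[n --> \oo] --> expR (psum c N.+1))%classic.
  exact: is_cvg_series_exp_coeff.
have /cvgrPdist_le /(_ _ e20)[J _ hJ] := cvx.
have := hJ J.+1 (leqnSn J); rewrite ler_norml => /andP[_ h2].
have PE : (P N J).[1] = series (exp_coeff (psum c N.+1)) J.+1.
  rewrite P_1 /psum /series /= big_mkord; apply: eq_bigr => j _.
  by rewrite /exp_coeff /= mulrC.
(* From here on the partial sum of [f] covers every coefficient of the polynomial. *)
exists (size (P N J)) => // n /= hn.
have low : expR S - e <= psum f n.
  apply: (@le_trans _ _ (P N J).[1]); first by rewrite PE; lra.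
  rewrite (@horner_coef_wide _ n) //; apply: ler_sum => i _.
  by rewrite expr1n mulr1 P_le.
have hu := up n; rewrite ler_norml; apply/andP; split; lra.
Qed.
End Exponential.

End Series.

(** * Masses and unlabelled graphs *)

Section Labelled.
Implicit Types (V W : finType).

Lemma common_N (T : finType) (P : T -> nat -> Prop) :
  (forall x, exists N, forall n, N <= n -> P x n) ->
  exists N, forall n, N <= n -> forall x, P x n.
Proof.
move=> /choice[f hf]; exists (\max_x f x) => n hn x; apply: hf.
by apply: leq_trans hn; exact: leq_bigmax.
Qed.

(** Marks a vertex i of [H]. The pair of f i and f determines i, and [H] is the pullback of [G]; the
    component of f i has h vertices and admits at most h! injections from [h]. *)
Lemma comp_count (P : gclass) V (G : graph V) h :
  (forall W (H : graph W), P W H -> gconnected H) ->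
  (\sum_(H in gset P 'I_h) #|[set f | cemb H G f]|) * h <=
  h`! * #|[set y | #|comp G y| == h]|.
Proof.
move=> cP; rewrite sum_card_pair; set X := [set p : graph 'I_h * {ffun 'I_h -> V} | _].
rewrite (_ : #|X| * h = #|finset.setX X [set: 'I_h]|); last first.
  by rewrite cardsX cardsT card_ord.
rewrite mulnC; apply: leq_trans (@card_pair_le _ _ [set y | #|comp G y| == h]
  (fun y (f : {ffun 'I_h -> V}) => (f \in ffun_on (mem (comp G y))) && injectiveb f) _ _);
  last first.
  move=> y; rewrite finset.in_set => /eqP cy; rewrite card_inj_ffuns_on cy card_ord ffactnn.
  exact: leqnn.
pose g (q : (graph 'I_h * {ffun 'I_h -> V}) * 'I_h) := (q.1.2 q.2, q.1.2).
have key q : q \in finset.setX X [set: 'I_h] -> gconnected q.1.1 /\ cemb q.1.1 G q.1.2.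
  case: q => [[H f] i]; rewrite finset.in_setX => /andP[XX _]; move: XX.
  by rewrite finset.in_set /= => /andP[/gsetP /cP gc c]; split.
apply: (@leq_card_inj _ _ _ _ g).
  move=> [[H f] i] [[H' f'] i'] /key /= [_ /cembP[fi E _]] /key /= [_ /cembP[_ E' _]] [E1 E2].
  by subst f'; rewrite (fi _ _ E1) -E -E'.
move=> [[H f] i] /key /= [[_ gc] /cembP[fi E c]].
have im : comp G (f i) = f @: 'I_h.
  rewrite comp_pull // E; apply/setP => y; apply/imsetP/imsetP => -[b _ ->]; exists b => //.
  by rewrite inE gc.
rewrite /g finset.in_set /= finset.in_set im card_imset // card_ord eqxx /=.
apply/andP; split; last exact/injectiveP.
by apply/ffun_onP => b; rewrite imset_f.
Qed.

(** Orbit-stabilizer count for the relabellings of [K]. *)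
Lemma card_iso_aut n (K : graph 'I_n) :
  #|[set G : graph 'I_n | `[< iso K G >]]| * aut K = n`!.
Proof.
have <- : #|[set: {perm 'I_n}]| = n`! by rewrite cardsT card_Sn.
pose ps (s : {perm 'I_n}) := pull s K.
have isoP G : iso K G -> exists t : {perm 'I_n}, G = ps t.
  case/iso_sym => f [bf e]; exists (perm (bij_inj bf)).
  by apply: graph_ext => x y; rewrite edge_pull !permE e.
rewrite -[RHS]sum1_card [RHS](partition_big ps (fun G => G \in [set G | `[< iso K G >]])) /=; last first.
  move=> s _; rewrite finset.in_set; apply/asboolP/iso_sym; apply: iso_pull.
  by exists s^-1%g; [exact: permK | exact: permKV].
rewrite -sum_nat_const; apply: eq_bigr => G; rewrite finset.in_set => /asboolP /isoP[t ->].
rewrite sum1dep_card /aut; apply/eqP; rewrite eqn_leq; apply/andP; split.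
  apply: (@leq_card_inj _ _ _ _ (fun s : {perm 'I_n} => (t * s)%g)); first by move=> s s' _ _ /mulgI.
  move=> s; rewrite !finset.in_set /= => /forallP h; apply/eqP/graph_ext => x y.
  rewrite !edge_pull !permM; apply/eqP.
  by move/forallP: (h (t x)) => /(_ (t y)).
apply: (@leq_card_inj _ _ _ _ (fun s : {perm 'I_n} => (t^-1 * s)%g)); first by move=> s s' _ _ /mulgI.
move=> s; rewrite !finset.in_set /= => /eqP E; apply/forallP => x; apply/forallP => y.
apply/eqP; rewrite !permM.
have := congr1 (fun Q => edge Q (t^-1%g x) (t^-1%g y)) E.
by rewrite !edge_pull !permKV.
Qed.

Definition canon n (G : graph 'I_n) : graph 'I_n :=
  [arg min_(K < G | `[< iso G K >]) (enum_rank K : nat)].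

Lemma canonP n (G : graph 'I_n) : iso G (canon G) /\ canonical (canon G).
Proof.
rewrite /canon; case: arg_minnP; first by apply/asboolP; exact: iso_refl.
move=> K /asboolP i h; split=> // K' i'; apply: h; apply/asboolP; exact: iso_trans i i'.
Qed.

Lemma canon_eq n (G K : graph 'I_n) : canonical K -> iso K G -> canon G = K.
Proof.
move=> cK i; have [i' c'] := canonP G; apply: enum_rank_inj; apply/val_inj/eqP.
rewrite eqn_leq c' /=; last by apply: iso_sym; exact: iso_trans i i'.
exact/cK/(iso_trans i i').
Qed.

(** The class of [K] contains n! / aut K labelled graphs; grouping by classes turns unlabelled
    Boltzmann weights into coefficients of exponential generating functions. *)
Lemma sum_canonical (R : realType) (Q : gclass) n : iso_closed Q ->
  (\sum_(G : graph 'I_n | `[< canonical G /\ Q _ G >]) ((aut G)%:R : R)^-1 =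
   (cnt Q n)%:R / (n`!)%:R)%R.
Proof.
move=> icQ.
have -> : ((cnt Q n)%:R = \sum_(G in gset Q 'I_n) 1 :> R)%R.
  by rewrite cntE -sum1_card natr_sum.
rewrite [in RHS](partition_big (@canon n) (fun K => `[< canonical K /\ Q _ K >])) /=; last first.
  move=> G /gsetP QG; apply/asboolP; have [i c] := canonP G; split=> //.
  exact: icQ i QG.
rewrite mulr_suml; apply: eq_bigr => K /asboolP[cK QK].
have -> : (\sum_(G in gset Q 'I_n | canon G == K) 1 =
    #|[set G : graph 'I_n | `[< iso K G >]]|%:R :> R)%R.
  rewrite -sum1_card natr_sum; apply: eq_bigl => G; rewrite [RHS]finset.in_set.
  apply/andP/asboolP => [[_ /eqP <-]|i].
    by apply: iso_sym; case: (canonP G).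
  split; first by apply/gsetP; exact: icQ i QK.
  by apply/eqP; exact: canon_eq.
rewrite -(card_iso_aut K) natrM invfM mulrA mulfV ?mul1r //.
rewrite pnatr_eq0 -lt0n; apply/card_gt0P; exists K; rewrite finset.in_set.
by apply/asboolP; exact: iso_refl.
Qed.

End Labelled.

(** * Expected component sizes and the bound on the generating function *)

Section Mass.
Variable R : realType.
Local Open Scope ring_scope.
Variables (A C : gclass) (gamma : R).
Hypotheses (ba : bridge_addable A) (gA : has_growth_constant A gamma).
Hypothesis icC : iso_closed C.
Hypothesis hC : forall (V : finType) (H : graph V), @C V H ->
     [/\ gconnected H, bridge_deletable H A,
         weakly_attachable R H A & weakly_detachable R H A].

Let a n : R := (cnt A n)%:R.
Let rho := gamma^-1.

Lemma C_conn (W : finType) (H : graph W) : @C W H -> gconnected H.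
Proof. by case/hC. Qed.

Lemma rho_pos : 0 < rho.
Proof. by rewrite invr_gt0; case: gA. Qed.

(** Term of order k of the exponential generating function of [P] at rho. *)
Definition et (P : gclass) k : R := (cnt P k)%:R / (k`!)%:R * rho ^+ k.

Lemma et_ge0 P k : 0 <= et P k.
Proof.
rewrite mulr_ge0 ?divr_ge0 ?ler0n //; apply: exprn_ge0; apply: ltW; exact: rho_pos.
Qed.

Lemma a_pos : exists N, forall n, (N <= n)%N -> 0 < a n.
Proof.
have g0 : 0 < gamma by case: gA.
have [N hN] := @cnt_lower R A gamma (gamma / 2) gA ltac:(lra) ltac:(lra).
exists N => n /hN; apply: lt_le_trans.
by rewrite mulr_gt0 ?ltr0n ?fact_gt0 // exprn_gt0 //; lra.
Qed.

(** For the empty class every graph satisfies [Dcond], so [Usum_asymp] yields rho^h |A_n| itself for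
    the underlying graph with components in [C]; adding the bridges only increases the count. *)
Lemma Cst_Esum h : forall e, 0 < e -> exists N, forall n, (N <= n)%N ->
  forall H : graph 'I_h, Cst C H -> (rho ^+ h - e) * a n <= (Esum A H n)%:R.
Proof.
move=> e e0; apply: (@common_N (graph 'I_h) (fun H n => Cst C H ->
  (rho ^+ h - e) * a n <= (Esum A H n)%:R)) => H.
case: (pselect (Cst C H)) => [[_ [F [iF rF]]]|nH]; last by exists 0%N.
have sD : sizes_le D0 0 by [].
have [N hN] := Usum_asymp ba gA icC hC sD iF e0.
exists N => n nN _; have := hN n nN; rewrite card_ord -Esum_D0.
have -> : #|[set G in gset A 'I_n | Dcond D0 G finset.set0]| = cnt A n.
  rewrite cntE; congr #|pred_of_set _|; apply/setP => G.
  by rewrite [LHS]finset.in_set andb_idr // => _; apply/asboolP => x _ [].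
rewrite -/(a n) -/rho ler_norml => /andP[h1 _].
have h2 : (Esum A F n)%:R <= (Esum A H n)%:R :> R.
  by rewrite ler_nat; exact: Esum_reach.
by apply: le_trans h2; rewrite mulrBl; lra.
Qed.

Definition smallv (V : finType) (G : graph V) m := [set y | (#|comp G y| <= m)%N].

(** [small_components] for the empty graph, which has exactly one embedding. *)
Lemma smallv_sum m n :
  (((\sum_(G in gset A 'I_n) #|smallv G m|) * (n - m) <= cnt A n * (2 * n)))%N.
Proof.
pose F0 : graph 'I_0 := mkgraph (fun _ _ => false).
have := @small_components A 'I_0 'I_n F0 m ba; rewrite !card_ord subn0.
have -> : (\sum_(G in gset A 'I_n) #|[set f | cemb F0 G f]| = cnt A n)%N.
  rewrite cntE -sum1_card; apply: eq_bigr => G _.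
  rewrite -uset0 uset_void ?card_ord //.
  by case: (boolP (Dcond _ _ _)) => // /asboolP []; move=> x _ [].
apply: leq_trans; rewrite leq_mul2r; apply/orP; right; apply: leq_sum => G _.
pose f0 : {ffun 'I_0 -> 'I_n} := [ffun i => widen_ord (leq0n n) i].
apply: (@leq_card_inj _ _ _ _ (fun y => (f0, y))) => [y y' _ _ []//|y].
rewrite !finset.in_set /= => ->; rewrite andbT; apply/andP; split.
  have : f0 \in uset D0 F0 G.
    have : (0 < #|uset D0 F0 G|)%N.
      rewrite uset_void ?card_ord //.
      by case: (boolP (Dcond _ _ _)) => // /asboolP []; move=> x _ [].
    case/card_gt0P => f; rewrite (_ : f = f0) //; apply/ffunP => -[//].
  by rewrite uset0 finset.in_set.
by apply/imsetP => -[[]].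
Qed.

Lemma smallv_sum4 m n : (2 * m <= n)%N -> (0 < n)%N ->
  (\sum_(G in gset A 'I_n) #|smallv G m| <= 4 * cnt A n)%N.
Proof.
move=> mn n0; have := smallv_sum m n; set S := (\sum_(G in _) _)%N => h.
have h2 : (S * n <= 2 * (S * (n - m)))%N.
  by rewrite mulnCA leq_mul2l; apply/orP; right; clear -mn; lia.
have h3 : (S * n <= 4 * cnt A n * n)%N.
  apply: leq_trans h2 _; rewrite (_ : 4 * cnt A n * n = 2 * (cnt A n * (2 * n)))%N ?leq_mul2l //.
  by clear; lia.
by move: h3; rewrite leq_mul2r; clear -n0; lia.
Qed.

Lemma Cst_conn (W : finType) (H : graph W) : Cst C H -> gconnected H.
Proof. by case. Qed.

(** Up to a small error, each term is a lower bound for the expected number of vertices in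
    components of exactly h vertices. These sets are disjoint for different h, and on average at
    most 4 vertices lie in components of at most K vertices. *)
Lemma mass_bound K : psum (fun h => h%:R * et (Cst C) h) K <= 4.
Proof.
apply: (@le_trans _ _ (psum (fun h => h%:R * et (Cst C) h) K.+1)).
  by apply: psum_mono => // k; rewrite mulr_ge0 ?ler0n // et_ge0.
pose w h : R := h%:R / (h`!)%:R * (cnt (Cst C) h)%:R.
have w0 h : 0 <= w h by rewrite mulr_ge0 ?divr_ge0 ?ler0n.
apply/ler_addgt0Pr => e e0; pose Wt := psum w K.+1.
have Wt0 : 0 <= Wt by exact: sumr_ge0.
(* Chosen so that the errors e1 w(h), summed over all h <= K, stay below e. *)
pose e1 := e / (Wt + 1); have e10 : 0 < e1 by apply: divr_gt0 => //; lra.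
have [N1 hN1] : exists N, forall n, (N <= n)%N -> forall h : 'I_K.+1,
  forall H : graph 'I_h, Cst C H -> (rho ^+ h - e1) * a n <= (Esum A H n)%:R.
  apply: (@common_N 'I_K.+1 (fun h n => forall H : graph 'I_h, Cst C H ->
    (rho ^+ h - e1) * a n <= (Esum A H n)%:R)) => h.
  exact: Cst_Esum.
have [N2 hN2] := a_pos.
(* The claim does not involve n, so one sufficiently large n is enough. *)
pose n := (N1 + N2 + 2 * K).+1.
have [n1 n2 n3] : [/\ N1 <= n, N2 <= n & 2 * K <= n]%N by rewrite /n; clear; split; lia.
have an0 := hN2 n n2.
have key (h : 'I_K.+1) : w h * (rho ^+ h - e1) * a n <=
    (\sum_(G in gset A 'I_n) #|[set y | #|comp G y| == h]|)%:R.
  have f0 : 0 < (h`!)%:R :> R by rewrite ltr0n fact_gt0.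
  have c1 : ((\sum_(H in gset (Cst C) 'I_h) Esum A H n) * h <=
      h`! * \sum_(G in gset A 'I_n) #|[set y | #|comp G y| == h]|)%N.
    rewrite exchange_big big_distrl big_distrr /=; apply: leq_sum => G _.
    exact: comp_count Cst_conn.
  have c2 : (cnt (Cst C) h)%:R * ((rho ^+ h - e1) * a n) <=
      (\sum_(H in gset (Cst C) 'I_h) Esum A H n)%:R.
    rewrite natr_sum cntE mulr_natl -sumr_const; apply: ler_sum => H /gsetP; exact: hN1.
  rewrite -(ler_pM2l f0); apply: (@le_trans _ _ (((\sum_(H in gset (Cst C) 'I_h) Esum A H n) * h)%:R)); last first.
    by rewrite -natrM ler_nat.
  have -> : (h`!)%:R * (w h * (rho ^+ h - e1) * a n) =
     (cnt (Cst C) h)%:R * ((rho ^+ h - e1) * a n) * h%:R.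
    by rewrite /w; field; rewrite gt_eqF.
  by rewrite natrM; apply: ler_wpM2r c2; rewrite ler0n.
have tot : (\sum_(h < K.+1) w h * (rho ^+ h - e1)) * a n <= 4 * a n.
  rewrite mulr_suml; apply: (le_trans (ler_sum _ (fun h _ => key h))).
  rewrite -natr_sum /a -natrM ler_nat; apply: leq_trans (smallv_sum4 n3 _) => //.
  rewrite exchange_big /=; apply: leq_sum => G _.
  rewrite -sum1_card (partition_big (fun y => inord #|comp G y| : 'I_K.+1) xpredT) //=.
  apply: leq_sum => h _; rewrite sum1dep_card; apply: subset_leq_card.
  apply/fintype.subsetP => y; rewrite !finset.in_set => /eqP ->.
  have hK : (h <= K)%N by rewrite -ltnS.
  by rewrite hK inord_val eqxx.
rewrite ler_pM2r // in tot.
have -> : psum (fun h => h%:R * et (Cst C) h) K.+1 =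
    \sum_(h < K.+1) w h * (rho ^+ h - e1) + e1 * Wt.
  rewrite /psum /Wt /psum mulr_sumr -big_split; apply: eq_bigr => h _ /=.
  by rewrite /w /et; ring.
have : e1 * Wt <= e.
  apply: (@le_trans _ _ (e1 * (Wt + 1))); first by apply: ler_wpM2l; [exact: ltW | lra].
  by rewrite le_eqVlt; apply/orP; left; apply/eqP; rewrite /e1; field; rewrite gt_eqF //; lra.
by lra.
Qed.

Lemma et_binom (P Q : gclass) n k : (k <= n)%N ->
  ('C(n, k) * (cnt P k * cnt Q (n - k)))%:R / (n`!)%:R * rho ^+ n =
  et P k * et Q (n - k)%N.
Proof.
move=> kn; rewrite /et -(bin_fact kn) !natrM.
have -> : rho ^+ n = rho ^+ k * rho ^+ (n - k) by rewrite -exprD subnKC.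
field; rewrite !pnatr_eq0 -!lt0n bin_gt0 kn !fact_gt0 //.
Qed.

Lemma et_superadd n : \sum_(k < n.+1) (k%:R * et (Cst C) k) *
    ((n - k)%:R * et (Cst C) (n - k)%N) <= 2 * (n%:R * et (Cst C) n - et (Cst C) n).
Proof.
have := Cst_superadd n icC; rewrite -(ler_nat R) natr_sum.
case: n => [|n] h.
  (* For n = 0 the truncated [n.-1] is not n - 1; both sides vanish because a connected graph has a
     vertex. *)
  have cz : cnt (Cst C) 0 = 0%N.
    apply/eqP; rewrite cntE cards_eq0; apply/eqP/setP => G; rewrite in_gset inE.
    by apply/asboolP => -[[]]; rewrite card_ord.
  rewrite big_ord_recl big_ord0 /= !mul0r /et cz !mul0r; lra.
have nf : 0 < (n.+1`!)%:R^-1 * rho ^+ n.+1.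
  by rewrite mulr_gt0 ?invr_gt0 ?ltr0n ?fact_gt0 // exprn_gt0 // rho_pos.
move: h; rewrite -(ler_pM2r nf) mulr_suml => /le_trans h.
apply: le_trans (h _ _); last first.
  rewrite le_eqVlt; apply/orP; left; apply/eqP; rewrite /et /= !natrM -[n.+1%:R]natr1; ring.
rewrite le_eqVlt; apply/orP; left; apply/eqP/eq_bigr => k _.
have kn : (k <= n.+1)%N by rewrite -ltnS.
have -> : (k%:R * et (Cst C) k) * ((n.+1 - k)%:R * et (Cst C) (n.+1 - k)%N) =
  k%:R * (n.+1 - k)%:R * (et (Cst C) k * et (Cst C) (n.+1 - k)%N) by ring.
by rewrite -et_binom // !natrM; ring.
Qed.

Lemma et_C_le k : et C k <= et (Cst C) k.
Proof.
apply: ler_wpM2r; first by apply: exprn_ge0; apply: ltW; exact: rho_pos.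
apply: ler_wpM2r; first by rewrite invr_ge0 ler0n.
rewrite ler_nat !cntE; apply: subset_leq_card; apply/fintype.subsetP => H /gsetP CH.
by apply/gsetP; apply: sub_Cst => // W K; exact: C_conn.
Qed.

Lemma psum_C_half n : psum (et C) n <= 2^-1.
Proof.
apply: (@le_trans _ _ (psum (et (Cst C)) n)).
  by apply: ler_sum => k _; exact: et_C_le.
apply: (@half_bound R (fun h => h%:R * et (Cst C) h) (et (Cst C)) 4).
- by move=> k; rewrite mulr_ge0 ?ler0n // et_ge0.
- by move=> k; exact: et_ge0.
- exact: mass_bound.
- exact: et_superadd.
Qed.

Lemma et_C0 : et C 0 = 0.
Proof.
rewrite /et (_ : cnt C 0 = 0%N) ?mul0r //.
apply/eqP; rewrite cntE cards_eq0; apply/eqP/setP => G; rewrite in_gset inE.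
by apply/asboolP => /C_conn [] ; rewrite card_ord.
Qed.

Lemma et_inF0 : et (inF C) 0 = 1.
Proof.
rewrite /et expr0 fact0 divr1 mulr1 (_ : cnt (inF C) 0 = 1%N) //.
rewrite cntE; apply/eqP/cards1P; exists (mkgraph (fun _ _ => false)).
apply/setP => G; rewrite in_gset finset.in_set1.
have -> : G = mkgraph (fun _ _ => false) by apply: graph_ext => -[].
by rewrite eqxx; apply/asboolP => -[].
Qed.

Lemma et_inF_rec n : n%:R * et (inF C) n =
  \sum_(k < n.+1) k%:R * et C k * et (inF C) (n - k)%N.
Proof.
rewrite /et !mulrA -natrM (inF_recurrence n icC C_conn) natr_sum !mulr_suml.
apply: eq_bigr => k _; have kn : (k <= n)%N by rewrite -ltnS.
by rewrite -[in RHS]mulrA -!/(et _ _) -et_binom // !natrM; ring.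
Qed.

Lemma egf_facts : exists S : R, [/\ egf C rho = S%:E, S <= 2^-1,
  forall n, psum (et C) n <= S & (psum (et (inF C)) n @[n --> \oo] --> expR S)%classic].
Proof.
have [S [cv [up _]]] := psum_cvg (et_ge0 C) psum_C_half.
exists S; split=> //.
- exact: eseries1_psum et_C0 cv.
- apply/ler_addgt0Pr => e e0; have /cvgrPdist_le /(_ e e0)[N _ hN] := cv.
  have := hN N (leqnn N); have := psum_C_half N; rewrite ler_norml => h1 /andP[_ h2]; lra.
- apply: (@exp_formula R (et C)) => //.
  + exact: et_ge0.
  + exact: et_C0.
  + exact: et_ge0.
  + exact: et_inF0.
  + exact: et_inF_rec.
Qed.

Lemma BP_massE (A' : gclass) : iso_closed A' ->
  BP_mass C rho A' = (\sum_(0 <= n <oo) (et (fun V G => inF C G /\ A' V G) n)%:E)%E.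
Proof.
move=> icA'; apply: eq_eseriesr => n _; congr _%:E.
have icQ : iso_closed (fun V (G : graph V) => inF C G /\ A' V G).
  move=> V W G H i [h1 h2]; split; first exact: inF_iso i h1.
  exact: icA' i h2.
by rewrite /et -(sum_canonical R n icQ) mulr_suml; apply: eq_bigr => G _; rewrite mulrC.
Qed.

End Mass.

(** * The limit law *)

Section Truncation.
Variable C : gclass.
Hypothesis icC : iso_closed C.
Implicit Types (V W : finType).

Definition Ctr m : gclass := fun V G => @C V G /\ #|V| <= m.
Definition Zset m V (G : graph V) : {set V} :=
  [set x | `[< Ctr m (induced G (comp G x)) >]].
Definition Qcls (A' : gclass) : gclass := fun V G => inF C G /\ A' V G.

Lemma in_Zset m V (G : graph V) x :
  x \in Zset m G <-> @C _ (induced G (comp G x)) /\ #|comp G x| <= m.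
Proof.
by rewrite finset.in_set; split=> [/asboolP[h1]|[h1 h2]];
  [rewrite card_sigset | apply/asboolP; split=> //; rewrite card_sigset].
Qed.

Lemma clo_Zset m V (G : graph V) : clo G (Zset m G).
Proof.
apply/cloP => x y /in_Zset h e; apply/in_Zset.
by rewrite -(comp_eq (edge_conn e)).
Qed.

(** A bijection from [s] onto [Zset m G] is the same thing as an exhaustive embedding of its own
    pullback. The bound s <= m ensures that components inside the image are small enough to belong
    to [Zset m G]. *)
Lemma Zset_pull m s V (G : graph V) (A' : gclass) (f : {ffun 'I_s -> V}) :
  iso_closed A' -> s <= m ->
  [&& #|Zset m G| == s, `[< A' _ (induced G (Zset m G)) >],
      f \in ffun_on (mem (Zset m G)) & injectiveb f] =
  (pull f G \in gset (Qcls A') 'I_s) && (f \in uset (Ctr m) (pull f G) G).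
Proof.
move=> icA' sm; apply/idP/idP.
  case/and4P => /eqP cZ /asboolP aZ /ffun_onP fZ /injectiveP fi.
  have im : f @: 'I_s = Zset m G.
    apply/eqP; rewrite eqEcard card_imset // card_ord cZ leqnn andbT.
    by apply/fintype.subsetP => _ /imsetP[i _ ->]; exact: fZ.
  have cl : clo G (f @: 'I_s) by rewrite im; exact: clo_Zset.
  apply/andP; split.
    apply/gsetP; split; last exact/(cls_pull_im _ icA' fi im).
    by move=> i; apply/cls_comp_pull => //; case/in_Zset: (fZ i).
  rewrite finset.in_set; apply/andP; split; first by apply/cembP.
  apply/asboolP => x; rewrite im finset.in_set => /asboolP; exact.
case/andP => /gsetP[iF aF]; rewrite finset.in_set => /andP[/cembP[fi _ cl] /asboolP Dc].
have fZ i : f i \in Zset m G.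
  apply/in_Zset; split; first by apply/(cls_comp_pull i icC fi cl); exact: iF.
  apply: leq_trans sm; apply: (@leq_trans #|f @: 'I_s|); last by rewrite card_imset // card_ord.
  by apply: subset_leq_card; apply: comp_sub => //; exact: imset_f.
have im : f @: 'I_s = Zset m G.
  apply/eqP; rewrite finset.eqEsubset; apply/andP; split; apply/fintype.subsetP => x.
    by case/imsetP => i _ ->.
  by rewrite finset.in_set => /asboolP xC; apply/negPn/negP => /Dc.
apply/and4P; split.
- by rewrite -im card_imset // card_ord.
- by apply/asboolP/(cls_pull_im _ icA' fi im).
- exact/ffun_onP.
- exact/injectiveP.
Qed.

(** Each graph on the left has s! bijections from [s] onto its [Zset], and each bijection is counted
    on the right for exactly one [F], its pullback. *)
Lemma count_Zset (A A' : gclass) m s n : iso_closed A' -> s <= m ->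
  #|[set G in gset A 'I_n | (#|Zset m G| == s) &&
      `[< A' _ (induced G (Zset m G)) >]]| * s`! =
  \sum_(F in gset (Qcls A') 'I_s) Usum A (Ctr m) F n.
Proof.
move=> icA' sm; set X0 := [set G in _ | _].
pose X := [set p : graph 'I_n * {ffun 'I_s -> 'I_n} | (p.1 \in X0) &&
  ((p.2 \in ffun_on (mem (Zset m p.1))) && injectiveb p.2)].
pose Y1 (F : graph 'I_s) := [set p : graph 'I_n * {ffun 'I_s -> 'I_n} |
  (p.1 \in gset A 'I_n) && (p.2 \in uset (Ctr m) F p.1)].
have XE : #|X0| * s`! = #|X|.
  rewrite -(@sum_card_pair _ _ X0 (fun G (f : {ffun 'I_s -> 'I_n}) =>
    (f \in ffun_on (mem (Zset m G))) && injectiveb f)) -sum_nat_const; apply: eq_bigr => G.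
  rewrite finset.in_set => /and3P[_ /eqP cZ _].
  by rewrite card_inj_ffuns_on cZ card_ord ffactnn.
have YE : \sum_(F in gset (Qcls A') 'I_s) Usum A (Ctr m) F n =
   #|[set q : graph 'I_s * (graph 'I_n * {ffun 'I_s -> 'I_n}) |
      (q.1 \in gset (Qcls A') 'I_s) && (q.2 \in Y1 q.1)]|.
  rewrite -(@sum_card_pair _ _ _ (fun F p => p \in Y1 F)); apply: eq_bigr => F _.
  rewrite (_ : [set b | b \in Y1 F] = Y1 F); last by apply/setP => b; rewrite finset.in_set.
  rewrite -(@sum_card_pair _ _ _ (fun G f => f \in uset (Ctr m) F G)); apply: eq_bigr => G _.
  by congr #|pred_of_set _|; apply/setP => f; rewrite [RHS]finset.in_set.
have inX G f : ((G, f) \in X) = (G \in gset A 'I_n) &&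
    ((pull f G \in gset (Qcls A') 'I_s) && (f \in uset (Ctr m) (pull f G) G)).
  rewrite -Zset_pull // finset.in_set /=.
  by rewrite [G \in X0]finset.in_set -!andbA.
have inY1 F G f : ((G, f) \in Y1 F) = (G \in gset A 'I_n) && (f \in uset (Ctr m) F G).
  by rewrite finset.in_set.
rewrite XE YE; apply/eqP; rewrite eqn_leq; apply/andP; split.
  apply: (@leq_card_inj _ _ _ _ (fun p : graph 'I_n * {ffun 'I_s -> 'I_n} =>
    (pull p.2 p.1, p))) => [p p' _ _ [_] //|[G f]].
  rewrite inX => /and3P[h1 h2 h3].
  by rewrite finset.in_set /= inY1 h1 h2 h3.
apply: (@leq_card_inj _ _ _ _ snd).
  move=> [F [G f]] [F' [G' f']] hq hq' /= E.
  have FE (F1 : graph 'I_s) (G1 : graph 'I_n) f1 :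
    (F1, (G1, f1)) \in [set q : graph 'I_s * (graph 'I_n * {ffun 'I_s -> 'I_n}) |
      (q.1 \in gset (Qcls A') 'I_s) && (q.2 \in Y1 q.1)] -> pull f1 G1 = F1.
    rewrite finset.in_set /= inY1 => /and3P[_ _]; rewrite finset.in_set.
    by case/andP => /cembP[].
  by rewrite -(FE _ _ _ hq) -(FE _ _ _ hq'); case: E => -> ->.
move=> [F [G f]]; rewrite [in X in X -> _]finset.in_set /= inY1 => /and3P[QF AG uf].
have FE : pull f G = F by move: uf; rewrite finset.in_set => /andP[/cembP[]].
by rewrite inX FE AG QF.
Qed.

Lemma card_close (T : finType) (S S' B : {set T}) :
  (forall x, x \notin B -> (x \in S) = (x \in S')) -> #|S| <= #|S'| + #|B|.
Proof.
move=> h; apply: leq_trans (leq_card_setU _ _); apply: subset_leq_card.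
apply/fintype.subsetP => x xS; rewrite inE.
by case: (boolP (x \in B)) => [_|xB]; rewrite ?orbT // -h // xS.
Qed.

Lemma card_by_value (T : finType) (S : {set T}) (z : T -> nat) (b : pred T) m :
  #|[set x in S | (z x <= m) && b x]| = \sum_(s < m.+1) #|[set x in S | (z x == s) && b x]|.
Proof.
rewrite -sum1_card (partition_big (fun x => inord (z x) : 'I_m.+1) xpredT) //=.
apply: eq_bigr => s _; rewrite -sum1_card; apply: eq_bigl => x.
rewrite !finset.in_set -!andbA; case: (x \in S) => //=.
case: (leqP (z x) m) => zm /=.
  have -> : (inord (z x) == s) = (z x == s) by rewrite -val_eqE /= inordK.
  by rewrite andbC.
by case: eqP => // E; move: zm; rewrite E ltnNge -ltnS ltn_ord.
Qed.

(** If at most m vertices lie in components of at most n/2 vertices, some component exceeds n/2. It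
    is the only largest one, so ties do not arise, and every other component has at most m
    vertices. *)
Lemma frag_Zset (L : forall n, graph 'I_n -> {set 'I_n}) m n (G : graph 'I_n) :
  largest_choice L -> 2 * m <= n -> 0 < n -> #|smallv G n./2| <= m ->
  [set x | (x \notin L n G) && `[< @C _ (induced G (comp G x)) >]] = Zset m G /\
  #|Zset m G| <= m.
Proof.
move=> lc mn n0 sm; have [x0 [LE big]] := lc n G n0.
have mh : m <= n./2 by clear -mn; lia.
have Zs : Zset m G \subset smallv G n./2.
  apply/fintype.subsetP => x /in_Zset[_ h]; rewrite finset.in_set.
  exact: leq_trans h mh.
split; last exact: leq_trans (subset_leq_card Zs) sm.
have small_m x : #|comp G x| <= n./2 -> #|comp G x| <= m.
  move=> h; apply: leq_trans sm; apply: subset_leq_card; apply/fintype.subsetP => y.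
  by rewrite inE finset.in_set => xy; rewrite -(comp_eq xy).
have x0b : n./2 < #|comp G x0|.
  rewrite ltnNge; apply/negP => h.
  have : #|[set: 'I_n]| <= m.
    apply: leq_trans sm; apply: subset_leq_card; apply/fintype.subsetP => y _.
    by rewrite finset.in_set; exact: leq_trans (big y) h.
  by rewrite cardsT card_ord; clear -mn n0; lia.
apply/setP => x; apply/idP/idP.
  rewrite finset.in_set LE inE => /andP[nx /asboolP Cx]; apply/in_Zset; split=> //.
  apply: small_m; have dis : [disjoint comp G x & comp G x0].
    rewrite -setI_eq0; apply/eqP/setP => z; rewrite !inE; apply/negP => /andP[h1 h2].
    by move: nx; rewrite (conn_trans h2) // conn_sym.
  have := max_card (mem (comp G x :|: comp G x0)); rewrite card_ord.
  have := leq_card_setU (comp G x) (comp G x0); rewrite dis => /leqifP /eqP.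
  move=> ->; move: x0b; clear; lia.
move=> /in_Zset[Cx cx]; rewrite finset.in_set; apply/andP; split; last exact/asboolP.
rewrite LE inE; apply/negP => h; move: x0b.
by rewrite (comp_eq h); move: cx mh; clear; lia.
Qed.

End Truncation.

(** Here x is the probability of the event and p that of having no small component; b and B are the
    truncated masses of the event and of all graphs, T and E their limits, and r = 1/E. As x is near
    p b and 1 is near p B, p is near r and x is near r T. *)
Lemma close_ratio (R : realType) (x p b B E r T d e : R) :
  (`|x - p * b| <= d -> `|1 - p * B| <= d -> 0 <= b -> b <= B -> B <= E -> E - B <= e ->
  b <= T -> T - b <= e -> 1 <= E -> 0 <= p -> p <= 1 -> r * E = 1 ->
  `|x - r * T| <= 2 * d + 2 * e)%R.
Proof.
move=> h1 h2 b0 bB BE EBe bT Tbe E1 p0 p1 rE.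
have E0 : (0 < E)%R by lra.
have r0 : (0 < r)%R by rewrite -(ltr_pM2r E0) mul0r rE.
have r1 : (r <= 1)%R by rewrite -(ler_pM2r E0) rE; lra.
have -> : (x - r * T = (x - p * b) + ((p * E - 1) * (r * b) + r * (b - T)))%R.
  have -> : ((p * E - 1) * (r * b) = p * (r * E) * b - r * b)%R by ring.
  by rewrite rE; ring.
have rb0 : (0 <= r * b)%R by rewrite mulr_ge0 // ltW.
have rb1 : (r * b <= 1)%R.
  by rewrite -rE; apply: ler_wpM2l; [exact: ltW | lra].
have pe : (p * (E - B) <= e)%R.
  apply: (@le_trans _ _ (1 * (E - B))%R); last by rewrite mul1r.
  by apply: ler_wpM2r => //; lra.
have pe0 : (0 <= p * (E - B))%R by rewrite mulr_ge0 //; lra.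
have h3 : (`|p * E - 1| <= d + e)%R.
  move: h2; rewrite !ler_norml => /andP[h2 h2']; apply/andP; split; lra.
have h4 : (`|r * (b - T)| <= e)%R.
  rewrite normrM gtr0_norm // ler0_norm; last by lra.
  apply: (@le_trans _ _ (1 * - (b - T))%R); last by lra.
  by apply: ler_wpM2r => //; lra.
apply: le_trans (ler_normD _ _) _; apply: (@le_trans _ _ (d + ((d + e) + e))%R); last by lra.
apply: lerD => //; apply: le_trans (ler_normD _ _) _; apply: lerD => //.
rewrite normrM (ger0_norm rb0); apply: le_trans h3.
by rewrite -[X in (_ <= X)%R]mulr1; apply: ler_wpM2l.
Qed.

(** * Uniform asymptotics of the fragment *)

Section Final.
Variable R : realType.
Local Open Scope ring_scope.
Variables (A C : gclass) (gamma : R).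
Hypotheses (ba : bridge_addable A) (gA : has_growth_constant A gamma).
Hypothesis icC : iso_closed C.
Hypothesis hC : forall (V : finType) (H : graph V), @C V H ->
     [/\ gconnected H, bridge_deletable H A,
         weakly_attachable R H A & weakly_detachable R H A].

Let a n : R := (cnt A n)%:R.
Let rho := gamma^-1.
Let Zfree m n : R := (#|[set G in gset A 'I_n | Dcond (Ctr C m) G finset.set0]|)%:R.

(** N is chosen at once for the finitely many graphs on [s]; the event [A'] only selects which of
    them are summed, hence the uniformity. *)
Lemma Zcount_asymp m s : (s <= m)%N -> forall e, 0 < e ->
  exists N, forall n, (N <= n)%N -> forall A' : gclass, iso_closed A' ->
  `|(#|[set G in gset A 'I_n | (#|Zset C m G| == s) &&
      `[< A' _ (induced G (Zset C m G)) >]]|)%:R -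
    et gamma (Qcls C A') s * Zfree m n| <= e * a n.
Proof.
move=> sm e e0; pose T := #|{: graph 'I_s}|.
have e10 : 0 < e / T.+1%:R by rewrite divr_gt0 ?ltr0n.
have sD : sizes_le (Ctr C m) m by move=> V G [].
have [N hN] : exists N, forall n, (N <= n)%N -> forall F : graph 'I_s, inF C F ->
   `|(Usum A (Ctr C m) F n)%:R - rho ^+ s * Zfree m n| <= e / T.+1%:R * a n.
  apply: (@common_N (graph 'I_s) (fun F n => inF C F ->
    `|(Usum A (Ctr C m) F n)%:R - rho ^+ s * Zfree m n| <= e / T.+1%:R * a n)) => F.
  case: (pselect (inF C F)) => [iF|nF]; last by exists 0%N.
  have [N hN] := Usum_asymp ba gA icC hC sD iF e10.
  by exists N => n nN _; have := hN n nN; rewrite card_ord.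
exists N => n nN A' icA'; set X := (#|_|)%:R.
have f1 : 1 <= (s`!)%:R :> R by rewrite ler1n fact_gt0.
have f0 : 0 < (s`!)%:R :> R by rewrite ltr0n fact_gt0.
have an0 : 0 <= a n by rewrite ler0n.
have XE : X * (s`!)%:R = \sum_(F in gset (Qcls C A') 'I_s) (Usum A (Ctr C m) F n)%:R.
  by rewrite -natrM count_Zset // natr_sum.
have bd : `|(X - et gamma (Qcls C A') s * Zfree m n) * (s`!)%:R| <= e * a n.
  have -> : (X - et gamma (Qcls C A') s * Zfree m n) * (s`!)%:R =
     \sum_(F in gset (Qcls C A') 'I_s) ((Usum A (Ctr C m) F n)%:R - rho ^+ s * Zfree m n).
    rewrite sumrB -XE sumr_const -cntE mulrBl -[X in _ = _ - X]mulr_natl /et -/rho; congr (_ - _).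
    by field; rewrite gt_eqF.
  apply: le_trans (ler_norm_sum _ _ _) _.
  apply: (@le_trans _ _ (\sum_(F in gset (Qcls C A') 'I_s) (e / T.+1%:R * a n))).
    by apply: ler_sum => F /gsetP[iF _]; exact: hN.
  rewrite sumr_const -[X in X <= _]mulr_natl.
  apply: (@le_trans _ _ (T.+1%:R * (e / T.+1%:R * a n))).
    apply: ler_wpM2r; first by rewrite mulr_ge0 // ltW.
    by rewrite ler_nat; apply: leqW; apply: max_card.
  rewrite le_eqVlt; apply/orP; left; apply/eqP; field.
  by rewrite gt_eqF // ltr_wpDl ?ler0n.
apply: le_trans bd; rewrite normrM (gtr0_norm f0) -[X in X <= _]mulr1.
by apply: ler_wpM2l.
Qed.

(** The term 4/m is Markov's inequality: on average at most 4 vertices lie in components of at most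
    n/2 vertices, so at most a proportion 4/m of the graphs have more than m of them. On all others
    the fragment is [Zset m G]. *)
Lemma frag_asymp (L : forall n, graph 'I_n -> {set 'I_n}) m : largest_choice L ->
  (0 < m)%N -> forall e, 0 < e -> exists N, forall n, (N <= n)%N ->
  forall A' : gclass, iso_closed A' ->
  `|(#|[set G in gset A 'I_n | `[< A' _ (FragC L C G) >]]|)%:R -
    Zfree m n * psum (et gamma (Qcls C A')) m.+1| <= (4 / m%:R + e) * a n.
Proof.
move=> lc m0 e e0.
have e10 : 0 < e / m.+1%:R by rewrite divr_gt0 ?ltr0n.
have [N hN] : exists N, forall n, (N <= n)%N -> forall s : 'I_m.+1,
  forall A' : gclass, iso_closed A' ->
  `|(#|[set G in gset A 'I_n | (#|Zset C m G| == s) &&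
      `[< A' _ (induced G (Zset C m G)) >]]|)%:R -
    et gamma (Qcls C A') s * Zfree m n| <= e / m.+1%:R * a n.
  apply: (@common_N 'I_m.+1 (fun s n => forall A' : gclass, iso_closed A' ->
  `|(#|[set G in gset A 'I_n | (#|Zset C m G| == s) &&
      `[< A' _ (induced G (Zset C m G)) >]]|)%:R -
    et gamma (Qcls C A') s * Zfree m n| <= e / m.+1%:R * a n)) => s.
  by apply: Zcount_asymp => //; rewrite -ltnS.
exists (N + 2 * m).+1%N => n nN A' icA'.
have [n1 n2 n3] : [/\ N <= n, 2 * m <= n & 0 < n]%N by clear -nN; split; lia.
have an0 : 0 <= a n by rewrite ler0n.
set Xf := [set G in _ | _].
pose X := [set G in gset A 'I_n | (#|Zset C m G| <= m)%N &&
      `[< A' _ (induced G (Zset C m G)) >]].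
pose hb := [set G in gset A 'I_n | (m < #|smallv G n./2|)%N].
have hbm : (m * #|hb| <= 4 * cnt A n)%N.
  have hn : (2 * n./2 <= n)%N by clear; lia.
  apply: leq_trans (smallv_sum4 ba hn n3).
  rewrite mulnC -sum_nat_const; apply: (@leq_trans (\sum_(G in hb) #|smallv G n./2|)%N).
    by apply: leq_sum => G; rewrite finset.in_set => /andP[_ /ltnW].
  rewrite big_mkcond [X in (_ <= X)%N]big_mkcond; apply: leq_sum => G _ /=.
  case: (boolP (G \in hb)) => // Gh.
  have GA : G \in gset A 'I_n by move: Gh; rewrite finset.in_set => /andP[].
  by rewrite GA.
have hbR : #|hb|%:R <= 4 / m%:R * a n.
  rewrite mulrAC ler_pdivlMr ?ltr0n // mulrC /a -!natrM ler_nat //.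
have agree (G : graph 'I_n) : G \notin hb -> (G \in Xf) = (G \in X).
  rewrite !finset.in_set; case AG : `[< @A _ G >] => //= .
  rewrite -leqNgt => sm; have [ZE Zm] := frag_Zset C lc n2 n3 sm.
  by rewrite Zm /= /FragC ZE.
have d1 : `|#|Xf|%:R - #|X|%:R| <= #|hb|%:R :> R.
  have c1 := card_close agree.
  have c2 : (#|X| <= #|Xf| + #|hb|)%N by apply: card_close => G /agree ->.
  move: c1 c2; rewrite -!(ler_nat R) !natrD ler_norml => c1 c2.
  by apply/andP; split; lra.
have XE : #|X|%:R = \sum_(s < m.+1) (#|[set G in gset A 'I_n | (#|Zset C m G| == s) &&
      `[< A' _ (induced G (Zset C m G)) >]]|)%:R :> R.
  rewrite -natr_sum; congr _%:R.
  exact: (@card_by_value _ (gset A 'I_n) (fun G => #|Zset C m G|)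
    (fun G => `[< A' _ (induced G (Zset C m G)) >]) m).
have d2 : `|#|X|%:R - Zfree m n * psum (et gamma (Qcls C A')) m.+1| <= e * a n.
  rewrite XE /psum mulr_sumr -sumrB; apply: le_trans (ler_norm_sum _ _ _) _.
  apply: (@le_trans _ _ (\sum_(s < m.+1) (e / m.+1%:R * a n))).
    by apply: ler_sum => s _; rewrite [Zfree m n * _]mulrC; exact: hN.
  rewrite sumr_const card_ord -[X in X <= _]mulr_natl le_eqVlt; apply/orP; left; apply/eqP; field.
  by rewrite gt_eqF // ltr_wpDl ?ler0n.
have -> : #|Xf|%:R - Zfree m n * psum (et gamma (Qcls C A')) m.+1 =
  (#|Xf|%:R - #|X|%:R) + (#|X|%:R - Zfree m n * psum (et gamma (Qcls C A')) m.+1) by ring.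
apply: le_trans (ler_normD _ _) _; rewrite mulrDl; apply: lerD => //.
exact: le_trans d1 hbR.
Qed.

End Final.

(** * Convergence in total variation *)

Local Open Scope ring_scope.

Theorem theorem1p4 (R : realType) (A C : gclass) (gamma : R) :
  iso_closed A -> bridge_addable A -> has_growth_constant A gamma ->
  iso_closed C ->
  (exists (V : finType) (H : graph V), C V H) ->
  (forall (V : finType) (H : graph V), C V H ->
     [/\ gconnected H, bridge_deletable H A,
         weakly_attachable R H A & weakly_detachable R H A]) ->
  let rho := gamma^-1 in
  ((0 < egf C rho)%E /\ (egf C rho <= (2^-1)%:E)%E) /\
  forall L : (forall n, graph 'I_n -> {set 'I_n}), largest_choice L ->
    forall eps : R, 0 < eps -> exists N : nat, forall n : nat, (N <= n)%N ->
      forall A' : gclass, iso_closed A' ->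
        `| frag_prob R A C L n A' - BP_prob C rho A' | <= eps.
Proof.
move=> icA ba gA icC [V0 [H0 CH0]] hC rho.
have [S [ES S2 Sup Fcv]] := egf_facts ba gA icC hC.
have r0 : 0 < rho := rho_pos gA.
(* One graph of [C] makes the term of its order positive. *)
have S0 : 0 < S.
  apply: lt_le_trans (Sup #|V0|.+1); rewrite /psum big_ord_recr /=.
  rewrite ltr_wpDl //; first by apply: sumr_ge0 => k _; exact: (et_ge0 gA).
  apply: mulr_gt0; last exact: exprn_gt0.
  apply: divr_gt0; rewrite ltr0n ?fact_gt0 // -card_gset //.
  by apply/card_gt0P; exists H0; exact/gsetP.
split; first by rewrite ES !lte_fin lee_fin.
move=> L lc eps eps0; pose E := expR S.
have E1 : 1 <= E by rewrite -expR0 ler_expR ltW.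
have e8 : 0 < eps / 8 by lra.
have mono := @psum_mono R _ (et_ge0 gA (inF C)).
have FE n : psum (et gamma (inF C)) n <= E.
  have cv : cvgn (psum (et gamma (inF C))) by apply: cvgP Fcv.
  by have := nondecreasing_cvgn_le mono cv n; rewrite (cvg_lim _ Fcv).
have /cvgrPdist_le /(_ _ e8)[M _ hM] := Fcv.
have [m1 _ hm1] := archi_nat (32 / eps).
(* Large enough that both the tail of the exponential series and the Markov term 4/m are at most
   eps/8. *)
pose m := (M + m1).+1.
have hEm : E - psum (et gamma (inF C)) m.+1 <= eps / 8.
  have := hM m.+1; rewrite /= => /(_ _); rewrite ler_norml.
  by move=> /(_ ltac:(rewrite /m; clear; lia)) /andP[_].
have m4 : 4 / m%:R <= eps / 8.
  rewrite ler_pdivrMr ?ltr0n //.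
  have : 32 / eps <= m%:R by apply: le_trans hm1 _; rewrite ler_nat /m; clear; lia.
  rewrite ler_pdivrMr // => ?; lra.
have [N1 hN1] := frag_asymp ba gA icC hC lc (ltn0Sn _ : (0 < m)%N) e8.
have [N2 hN2] := a_pos gA.
exists (N1 + N2)%N => n nN A' icA'.
have [n1 n2] : (N1 <= n /\ N2 <= n)%N by clear -nN; split; lia.
have a0 := hN2 n n2.
have hA' := hN1 n n1 A' icA'.
(* The event that always holds: it shows that p times the truncated total mass is close to 1, which
   fixes p. *)
have hT := hN1 n n1 (fun _ _ => True) (fun _ _ _ _ _ h => h).
set Z := (#|[set G in gset A 'I_n | Dcond (Ctr C m) G finset.set0]|)%:R in hA' hT.
set d := eps / 8 + eps / 8.
have dle : 4 / m%:R + eps / 8 <= d by rewrite /d; lra.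
pose p := Z / (cnt A n)%:R; pose Q := et gamma (Qcls C A').
have p0 : 0 <= p by rewrite divr_ge0 ?ler0n.
have p1 : p <= 1.
  rewrite ler_pdivrMr // mul1r ler_nat cntE; apply: subset_leq_card.
  by apply/fintype.subsetP => G; rewrite finset.in_set => /andP[].
have Q0 k : 0 <= Q k := et_ge0 gA (Qcls C A') k.
have QF k : Q k <= et gamma (inF C) k.
  apply: ler_wpM2r; first by rewrite exprn_ge0 // ltW.
  apply: ler_wpM2r; first by rewrite invr_ge0 ler0n.
  rewrite ler_nat !cntE; apply: subset_leq_card; apply/fintype.subsetP => F /gsetP[h _].
  exact/gsetP.
have QE k : psum Q k <= E by apply: le_trans (FE k); apply: ler_sum => i _.
have [T [Tcv [Tup Tlow]]] := psum_cvg Q0 QE.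
(* The tail of the event is dominated termwise by that of all graphs with components in [C], so [m]
   does not depend on [A']. *)
have tailT : T - psum Q m.+1 <= eps / 8.
  apply/ler_addgt0Pr => e e0; have [K hK] := Tlow e e0.
  have hk := hK (K + m.+1)%N (leq_addr _ _).
  have sp (u : nat -> R) : psum u (K + m.+1) = psum u m.+1 + \sum_(m.+1 <= i < K + m.+1) u i.
    rewrite /psum -!(big_mkord xpredT u) (big_cat_nat (n := m.+1)) //=.
    exact: leq_addl.
  have h1 : \sum_(m.+1 <= i < K + m.+1) Q i <= \sum_(m.+1 <= i < K + m.+1) et gamma (inF C) i.
    by apply: ler_sum => i _.
  have h2 := FE (K + m.+1)%N; rewrite sp in h2; rewrite sp in hk.
  by lra.
have BPE : BP_prob C rho A' = expR (- S) * T.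
  rewrite /BP_prob ES BP_massE //= (eseries_psum Tcv) //.
have fE : frag_prob R A C L n A' =
    (#|[set G in gset A 'I_n | `[< A' _ (FragC L C G) >]]|)%:R / (cnt A n)%:R.
  rewrite /frag_prob; congr (_%:R / _); apply: eq_card => G.
  by rewrite [RHS]finset.in_set in_gset; exact: asbool_and.
have BE : psum (et gamma (Qcls C (fun _ _ => True))) m.+1 = psum (et gamma (inF C)) m.+1.
  apply: eq_bigr => k _; rewrite /et; congr (_%:R / _ * _); rewrite !cntE.
  congr #|pred_of_set _|; apply/setP => F; rewrite !in_gset.
  by apply/asboolP/asboolP => [[]|h] //; split.
rewrite fE BPE.
apply: (@le_trans _ _ (2 * d + 2 * (eps / 8))); last by rewrite /d; lra.
apply: (@close_ratio R _ p (psum Q m.+1) (psum (et gamma (inF C)) m.+1) E).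
- have -> : #|[set G in gset A 'I_n | `[< A' _ (FragC L C G) >]]|%:R / (cnt A n)%:R -
     p * psum Q m.+1 =
     (#|[set G in gset A 'I_n | `[< A' _ (FragC L C G) >]]|%:R - Z * psum Q m.+1) / (cnt A n)%:R.
    by rewrite /p; ring.
  rewrite normrM normfV (gtr0_norm a0) ler_pdivrMr //; apply: le_trans hA' _.
  by apply: ler_wpM2r => //; exact: ltW.
- have cE : #|[set G in gset A 'I_n | `[< True >]]| = cnt A n.
    rewrite cntE; congr #|pred_of_set _|; apply/setP => G; rewrite [LHS]finset.in_set.
    by rewrite andb_idr // => _; exact/asboolP.
  rewrite cE BE in hT.
  have -> : 1 - p * psum (et gamma (inF C)) m.+1 =
     ((cnt A n)%:R - Z * psum (et gamma (inF C)) m.+1) / (cnt A n)%:R.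
    by rewrite /p; field; rewrite gt_eqF.
  rewrite normrM normfV (gtr0_norm a0) ler_pdivrMr //; apply: le_trans hT _.
  by apply: ler_wpM2r => //; exact: ltW.
- by apply: sumr_ge0.
- by apply: ler_sum => i _.
- exact: FE.
- exact: hEm.
- exact: Tup.
- exact: tailT.
- exact: E1.
- exact: p0.
- exact: p1.
- by rewrite /E -expRD addNr expR0.
Qed.
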